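(* Let $\beta>0$ and let $m\ge1$ be an integer. Then the essential spectrum of $L_m$ is $\sigma_{ess}(L_m)=[0,1]$. Moreover: (1) any eigenvalue $c\in\mathbb{C}$ of $L_m$ such that $|\mathrm{Re}(c)-1/2|\ge1/2$ must have $\mathrm{Im}(c)=0$; (2) if $\beta^2>1/4$: (a) there are no eigenvalues $c\in\mathbb{C}$ with $\mathrm{Im}(c)\ne0$ and $\mathrm{Re}(c)\in(0,1)$; (b) there are no real eigenvalues $c$ with $c<-\beta/m$ or $c>1+\beta/m$; (c) there is a countably infinite number of discrete eigenvalues $c$ with $\mathrm{Im}(c)=0$ and $\mathrm{Re}(c)\in(-\beta/m,0)\cup(1,1+\beta/m)$; moreover, they accumulate towards $0$ and $1$; (3) if $\beta^2\le1/4$: (a) there is no eigenvalue $c\in\mathbb{C}$ with $\mathrm{Re}(c)\le0$ or $\mathrm{Re}(c)\ge1$; (b) there exists $\varepsilon_0>0$ such that there is no eigenvalue $c\in\mathbb{C}$ with $|\mathrm{Im}(c)|\ge\beta/m$ or $|\mathrm{Im}(c)|\le\varepsilon_0$.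
   Context: Let $\Delta_m=\partial_y^2-m^2$ on $(0,1)$ with inverse $\Delta_m^{-1}$ taken with homogeneous Dirichlet conditions at $y=0,1$. The operator $$L_m=\begin{pmatrix}\Delta_m^{-1}(y\Delta_m)&\beta^2\Delta_m^{-1}\\-1&y\end{pmatrix}$$ acts on pairs $(\psi,\rho)$ with $\psi$ vanishing at $y=0,1$ and $(\Delta_m\psi,\rho)\in L^2(0,1)^2$, i.e. on $(H^2\cap H^1_0)(0,1)\times L^2(0,1)$ (complex-valued). An eigenvalue $c$ corresponds to a nontrivial $(\psi,\rho)$ with $L_m(\psi,\rho)^T=c(\psi,\rho)^T$; a discrete eigenvalue is an isolated one, lying outside $[0,1]$. *)

(* Defs.v *)
(* MathComp-Analysis development, over an arbitrary R : realType. *)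
From mathcomp Require Import all_boot all_order all_algebra.
From mathcomp Require Import all_classical all_reals all_analysis.
From mathcomp Require Export complex.

Set Implicit Arguments.
Unset Strict Implicit.
Unset Printing Implicit Defensive.

Import Order.TTheory GRing.Theory Num.Theory.
Import numFieldNormedType.Exports.

Local Open Scope classical_set_scope.
Local Open Scope ring_scope.
Local Open Scope complex_scope.

Section Defs.
Variable R : realType.

Local Notation C := R[i].
Local Notation mu := (@lebesgue_measure R).

Definition I01 : set R := `]0, 1[.

(* Elements of L^2(0,1) are represented by functions R -> C, whose values
   outside (0,1) are irrelevant; equality in L^2(0,1) is [ae_eq01]. *)
Definition cfun := R -> C^o.

Definition ae_eq01 (f g : cfun) : Prop := ae_eq mu I01 f g.

Definition Cintegral (f : cfun) : C :=
  (\int[mu]_(y in I01) complex.Re (f y)) +i*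
  (\int[mu]_(y in I01) complex.Im (f y)).

Definition L2 (f : cfun) : Prop :=
  [/\ measurable_fun I01 (fun y => complex.Re (f y)),
      measurable_fun I01 (fun y => complex.Im (f y)) &
      mu.-integrable I01
        (fun y => (complex.Re (f y) ^+ 2 + complex.Im (f y) ^+ 2)%:E)].

(* The class C^1_c(0,1), which yields the same weak derivatives as
   C^infty_c(0,1). Real-valued test functions suffice for complex-valued f, by
   linearity. *)
Definition test_function (phi : R -> R) : Prop :=
  [/\ forall x, derivable phi x 1,
      continuous (derive1 phi) &
      exists a b, [/\ 0 < a, b < 1 & forall x, ~ (a <= x <= b) -> phi x = 0]].

Definition weak_derivative (f g : cfun) : Prop :=
  forall phi, test_function phi ->
    Cintegral (fun y => f y * (derive1 phi y)%:C) =
    - Cintegral (fun y => g y * (phi y)%:C).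

Definition H1 (f : cfun) : Prop :=
  L2 f /\ exists g, L2 g /\ weak_derivative f g.

Definition H2 (f : cfun) : Prop :=
  L2 f /\ exists g, H1 g /\ weak_derivative f g.

(* H^2 \cap H^1_0: a class is represented by a member that is continuous on
   [0,1], so that the boundary values make sense. *)
Definition H2_dirichlet (f : cfun) : Prop :=
  [/\ H2 f,
      {within `[0, 1], continuous (fun y => complex.Re (f y))},
      {within `[0, 1], continuous (fun y => complex.Im (f y))},
      f 0 = 0 &
      f 1 = 0].

(* The weak derivative is unique almost everywhere on (0,1); [wderiv f] is a
   representative of it when f is in H^1, and the zero function otherwise. *)
Definition wderiv (f : cfun) : cfun :=
  xget 0 [set g | L2 g /\ weak_derivative f g].

Definition Delta (m : nat) (f : cfun) : cfun :=
  wderiv (wderiv f) - (m%:R ^+ 2) *: f.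

(* For h in L^2(0,1): the solution f in H^2 \cap H^1_0 of Delta_m f = h. *)
Definition Delta_inv (m : nat) (h : cfun) : cfun :=
  xget 0 [set f | H2_dirichlet f /\ ae_eq01 (Delta m f) h].

Definition ymul (f : cfun) : cfun := fun y => y%:C * f y.

Definition state := (cfun * cfun)%type.

(* The space on which the operators act, and its equality (equality of
   classes in both components). *)
Definition X : set state := [set v | H2_dirichlet v.1 /\ L2 v.2].

Definition eqX (v w : state) : Prop := ae_eq01 v.1 w.1 /\ ae_eq01 v.2 w.2.

Definition Lop (beta : R) (m : nat) (v : state) : state :=
  (Delta_inv m (ymul (Delta m v.1)) + (beta ^+ 2)%:C *: Delta_inv m v.2,
   - v.1 + ymul v.2).

Definition eigenvalues (T : state -> state) : set C :=
  [set c | exists v, [/\ X v, ~ eqX v 0 & eqX (T v) (c *: v)]].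

Definition injectiveX (T : state -> state) : Prop :=
  forall v, X v -> eqX (T v) 0 -> eqX v 0.

Definition surjectiveX (T : state -> state) : Prop :=
  forall w, X w -> exists v, X v /\ eqX (T v) w.

Definition shift (T : state -> state) (c : C) : state -> state :=
  fun v => T v - c *: v.

(* For a bounded operator on a Hilbert space a bijective T - c has a bounded
   inverse, by the bounded inverse theorem. *)
Definition spectrum (T : state -> state) : set C :=
  [set c | ~ (injectiveX (shift T c) /\ surjectiveX (shift T c))].

Definition finite_dim_kernel (T : state -> state) : Prop :=
  exists (n : nat) (e : 'I_n -> state),
    (forall i, X (e i) /\ eqX (T (e i)) 0) /\
    forall v, X v -> eqX (T v) 0 ->
      exists a : 'I_n -> C, eqX v (\sum_(i < n) a i *: e i).

Definition finite_codim_range (T : state -> state) : Prop :=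
  exists (n : nat) (e : 'I_n -> state),
    (forall i, X (e i)) /\
    forall w, X w ->
      exists (u : state) (a : 'I_n -> C),
        X u /\ eqX w (T u + \sum_(i < n) a i *: e i).

(* For a bounded operator, a range of finite codimension is closed, so
   closedness need not be required separately. *)
Definition fredholm (T : state -> state) : Prop :=
  finite_dim_kernel T /\ finite_codim_range T.

(* Fredholm (Wolf) essential spectrum. *)
Definition essential_spectrum (T : state -> state) : set C :=
  [set c | ~ fredholm (shift T c)].

Definition segment01 : set C :=
  [set c | complex.Im c = 0 /\ 0 <= complex.Re c <= 1].

Definition discrete_eigenvalues (T : state -> state) : set C :=
  [set c | [/\ eigenvalues T c, isolated (spectrum T : set C^o) c & ~ segment01 c]].

End Defs.

Arguments segment01 {R}.

(* Main.v *)
(* Eliminating rho turns the eigenvalue equation into the Taylor-Goldstein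
   equation psi'' = (m^2 - beta^2 / (y - c)^2) psi, psi(0) = psi(1) = 0.

   Outside [0,1] its coefficient is regular: variation of parameters solves
   (L - c) v = w up to one compatibility condition, so L - c is Fredholm, and
   bijective unless c is an eigenvalue. For s in [0,1] the second component
   (y - s) rho - psi = g forces psi(s) + z = 0 as soon as g equals z on infinitely
   many dyadic shells around s, since 1/(y - s) is not square integrable there;
   indicators of disjoint families of shells show that the range of L - s has
   infinite codimension.

   No eigenvalue c is nonreal, whatever beta is. With W = y - c,
   E = (W / |W|)^(2a) and chi = psi' - a psi / W,
     (E psi^* chi)' =
       E (|chi|^2 + m^2 |psi|^2) - (beta^2 - a (1 - a)) E |psi|^2 / W^2,
   and for a suitable a the imaginary parts of both terms have the same sign.
   If beta^2 <= 1/4, the real analogue u u' - u^2 / (2 (y - c)) (Hardy's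
   inequality) rules out the real eigenvalues as well.

   If beta^2 > 1/4, let f1, f2 be a basis of solutions of
   f'' = (m^2 - beta^2 / x^2) f on x > 0. Then c = -t, or c = 1 + t, is an
   eigenvalue exactly when D(t) = f1(t) f2(1 + t) - f2(t) f1(1 + t) vanishes.
   Solutions oscillate at 0, and D takes both signs at zeros of f1 with slopes
   of opposite signs, so D has zeros arbitrarily close to 0; they are simple
   because u'^2 - (m^2 - beta^2 / x^2) u^2 decreases strictly. *)

Require Import Defs.
From mathcomp Require Import all_boot all_order all_algebra.
From mathcomp Require Import all_classical all_reals all_analysis.
From mathcomp Require Import measurable_realfun ring lra.
Set Implicit Arguments.
Unset Strict Implicit.
Unset Printing Implicit Defensive.
Import Order.TTheory GRing.Theory Num.Theory.
Import numFieldNormedType.Exports.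
Local Open Scope classical_set_scope.
Local Open Scope ring_scope.
Local Open Scope complex_scope.

(** [wderiv], [Delta_inv] and hence [Lop] pick representatives by choice, so nothing can be computed
    from them directly. The bridge is du Bois-Reymond's lemma: psi is an iterated primitive of its
    second weak derivative, and applying Delta_m, which is injective under Dirichlet conditions,
    turns (L - c) v = w into two pointwise equations valid almost everywhere. From there on only
    ordinary differential equations are studied.

    The exponent a of the nonreal case comes from the indicial equation a (1 - a) = beta^2 at y = c:
    for beta^2 <= 1/4 its smaller root removes the singular term; beyond 1/4 the roots are complex
    and their real part 1/2 is taken. The bound a <= 1/2 keeps the argument of E in (0, pi), so that
    Im E > 0.

    Simplicity of the zeros of D: if D(t) = 0, the solution u with u(t) = 0, u'(t) = 1 vanishes at 1
    + t, and the constant Wronskian gives D'(t) = 1 / u'(1 + t) - u'(1 + t). A double zero would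
    force u'(1 + t)^2 = u'(t)^2, against the strict decrease. Simple zeros are isolated, which makes
    the eigenvalues isolated in the spectrum and countable. *)

Local Notation Re := complex.Re.
Local Notation Im := complex.Im.

(** * Real derivatives, monotonicity and antiderivatives *)

Section real_calculus.
Context {R : realType}.
Implicit Types (f g h : R -> R) (a b x y : R).

Lemma eq_ler x y : x = y -> x <= y.
Proof. by move->. Qed.

(** Derivatives are kept as a relation with an explicit value: the value is first assembled by the
    rules, then brought into the wanted form through [der_eq] by [ring] or [field]. *)
Definition der f x (d : R) := is_derive x (1 : R) f d.

Lemma der_eq f x d d' : der f x d -> d = d' -> der f x d'.
Proof. by move=> fd <-. Qed.

Lemma der_ext f g x d : (forall y, f y = g y) -> der f x d -> der g x d.
Proof. by move=> /funext ->. Qed.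

Lemma der_cst c x : der (fun=> c) x 0.
Proof. exact: is_derive_cst. Qed.

Lemma der_id x : der (fun y => y) x 1.
Proof. exact: is_derive_id. Qed.

Lemma derD f g x df dg : der f x df -> der g x dg ->
  der (fun y => f y + g y) x (df + dg).
Proof. exact: is_deriveD. Qed.

Lemma derN f x df : der f x df -> der (fun y => - f y) x (- df).
Proof. exact: is_deriveN. Qed.

Lemma derB f g x df dg : der f x df -> der g x dg ->
  der (fun y => f y - g y) x (df - dg).
Proof. exact: is_deriveB. Qed.

Lemma derM f g x df dg : der f x df -> der g x dg ->
  der (fun y => f y * g y) x (df * g x + f x * dg).
Proof.
by move=> fd gd; apply: der_eq (is_deriveM fd gd) _; rewrite /GRing.scale/=; ring.
Qed.

Lemma der_sqr f x df : der f x df -> der (fun y => f y ^+ 2) x (2 * f x * df).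
Proof.
move=> fd; apply: (@der_ext (fun y => f y * f y)); first by move=> y; rewrite expr2.
by apply: der_eq (derM fd fd) _; ring.
Qed.

Lemma derV f x df : f x != 0 -> der f x df -> der (fun y => (f y)^-1) x (- df / f x ^+ 2).
Proof.
move=> fx fd; apply: der_eq (is_deriveV fx fd) _.
by rewrite /GRing.scale/= !mulNr mulrC.
Qed.

Lemma der_comp f g x df dg : der f (g x) df -> der g x dg ->
  der (fun y => f (g y)) x (df * dg).
Proof. exact: is_derive1_comp. Qed.

Lemma der_continuous f x d : der f x d -> {for x, continuous f}.
Proof. by move=> fd; apply: differentiable_continuous; apply/derivable1_diffP; case: fd. Qed.

Lemma der_derive1 f x d : der f x d -> derivable f x 1 /\ derive1 f x = d.
Proof. by case=> dfx <-; split => //; rewrite derive1E. Qed.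

Lemma derivable_der f x : derivable f x 1 -> der f x (derive1 f x).
Proof. by move=> fx; split => //; rewrite derive1E. Qed.

Lemma der_near f g x d : {near x, f =1 g} -> der f x d -> der g x d.
Proof. exact: near_eq_is_derive. Qed.

Definition cont_on a b f := {within `[a, b], continuous f}.

Lemma cont_onD a b f g : cont_on a b f -> cont_on a b g ->
  cont_on a b (fun y => f y + g y).
Proof. by move=> fc gc x; apply: cvgD; [exact: fc|exact: gc]. Qed.

Lemma cont_onN a b f : cont_on a b f -> cont_on a b (fun y => - f y).
Proof. by move=> fc x; apply: cvgN; exact: fc. Qed.

Lemma cont_onM a b f g : cont_on a b f -> cont_on a b g ->
  cont_on a b (fun y => f y * g y).
Proof. by move=> fc gc x; apply: cvgM; [exact: fc|exact: gc]. Qed.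

Lemma cont_on_continuous a b f : continuous f -> cont_on a b f.
Proof. exact: continuous_subspaceT. Qed.

Lemma cont_on_cst a b c : cont_on a b (fun=> c).
Proof. by apply: cont_on_continuous => x; exact: cvg_cst. Qed.

Lemma cont_on_der a b f (df : R -> R) :
  (forall x, a <= x <= b -> der f x (df x)) -> cont_on a b f.
Proof.
move=> fd; apply: derivable_within_continuous => x.
by rewrite in_itv/= => /fd[].
Qed.

Lemma cont_on_sub a b a' b' f : a <= a' -> b' <= b -> cont_on a b f -> cont_on a' b' f.
Proof.
move=> aa bb; apply: continuous_subspaceW => x /=.
by rewrite !in_itv/= => /andP[? ?]; apply/andP; split; lra.
Qed.

Lemma cont_on_ext a b f g : (forall x, a <= x <= b -> f x = g x) ->
  cont_on a b f -> cont_on a b g.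
Proof.
move=> fg; apply: subspace_eq_continuous => x.
by rewrite inE/= in_itv/= => /fg.
Qed.

Lemma cont_on_at (h : R -> R) (a b x : R) : cont_on a b h -> a < x < b -> {for x, continuous h}.
Proof.
move=> hc xab; have /andP[ax xb] := xab.
have [|h1 _ _] := (continuous_within_itvP h _).1 hc; first exact: lt_trans ax xb.
by apply: h1; rewrite in_itv.
Qed.

Lemma cont_on_bounded a b f : a <= b -> cont_on a b f ->
  exists2 M : R, 0 <= M & forall x, a <= x <= b -> `|f x| <= M.
Proof.
move=> ab fc.
have [c _ hc] := EVT_max ab fc.
have [d _ hd] := EVT_min ab fc.
exists (`|f c| + `|f d|); first by rewrite addr_ge0.
move=> x xab; have xi : x \in `[a, b] by rewrite in_itv.
rewrite ler_norml; apply/andP; split.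
  apply: le_trans (hd _ xi); rewrite -lerN2 opprK.
  by apply: le_trans (ler_norm _) _; rewrite normrN lerDr.
by apply: le_trans (hc _ xi) _; apply: le_trans (ler_norm _) _; rewrite lerDl.
Qed.

Lemma der_ge0_le a b f (df : R -> R) : a <= b ->
  (forall x, a < x < b -> der f x (df x)) -> cont_on a b f ->
  (forall x, a < x < b -> 0 <= df x) -> f a <= f b.
Proof.
rewrite le_eqVlt => /predU1P[->//|ab] fd fc df0.
have [x|c] := @MVT R f df a b ab _ fc; first by rewrite in_itv/= => /fd.
rewrite in_itv/= => /df0 dfc e; rewrite -subr_ge0 e mulr_ge0 //; lra.
Qed.

Lemma der_gt0_lt a b f (df : R -> R) : a < b ->
  (forall x, a < x < b -> der f x (df x)) -> cont_on a b f ->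
  (forall x, a < x < b -> 0 < df x) -> f a < f b.
Proof.
move=> ab fd fc df0.
have [x|c] := @MVT R f df a b ab _ fc; first by rewrite in_itv/= => /fd.
rewrite in_itv/= => /df0 dfc e; rewrite -subr_gt0 e mulr_gt0 //; lra.
Qed.

Lemma der0_cst a b f : (forall x, a < x < b -> der f x 0) -> cont_on a b f ->
  forall x, a <= x <= b -> f x = f a.
Proof.
move=> fd fc x /andP[ax xb].
have fc' : cont_on a x f by apply: cont_on_sub fc.
apply/eqP; rewrite eq_le; apply/andP; split; last first.
  apply: (@der_ge0_le a x f (fun=> 0)) => // y /andP[? ?]; apply: fd; lra.
rewrite -lerN2; apply: (@der_ge0_le a x (fun y => - f y) (fun=> - 0)) => //.
- by move=> y /andP[? ?]; apply/derN/fd; lra.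
- exact: cont_onN.

Qed.

(** A monotone function with equal end values is constant, so its derivative vanishes inside. The
    Riccati and energy identities below conclude through this fact. *)
Lemma der_ge0_eq0 a b f (df : R -> R) :
  (forall x, a < x < b -> der f x (df x)) -> cont_on a b f ->
  (forall x, a < x < b -> 0 <= df x) -> f a = f b ->
  forall x, a < x < b -> df x = 0.
Proof.
move=> fd fc df0 fab x xab; have /andP[ax xb] := xab.
have fcst y : a <= y <= b -> f y = f a.
  move=> /andP[ay yb]; apply/eqP; rewrite eq_le; apply/andP; split.
    rewrite fab; apply: (@der_ge0_le y b f df) => //.
    - by move=> z /andP[? ?]; apply: fd; lra.
    - by apply: cont_on_sub fc.
    - by move=> z /andP[? ?]; apply: df0; lra.
  apply: (@der_ge0_le a y f df) => //.
  - by move=> z /andP[? ?]; apply: fd; lra.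
  - by apply: cont_on_sub fc.
  - by move=> z /andP[? ?]; apply: df0; lra.
have nfa : {near x, f =1 (fun=> f a)}.
  near=> y; apply: fcst; apply/andP; split.
    by apply: ltW; near: y; apply: lt_nbhsr.
  by apply: ltW; near: y; apply: lt_nbhsl.
have [_ <-] := der_derive1 (fd _ xab).
have := der_near _ (fd _ xab); move=> /(_ (fun=> f a) nfa)/der_derive1[_ e].
have [_ e'] := der_derive1 (fd _ xab); rewrite e' -e.
by have [_] := der_derive1 (der_cst (f a) x).
Unshelve. all: by end_near. Qed.

Lemma continuous_integrable a b h : continuous h ->
  (@lebesgue_measure R).-integrable `[a, b] (EFin \o h).
Proof.
move=> hc; apply: continuous_compact_integrable; first exact: segment_compact.
exact: continuous_subspaceT.
Qed.

Lemma antiderivative h : continuous h ->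
  exists F, F 0 = 0 /\ forall x, der F x (h x).
Proof.
move=> hc; pose mu := @lebesgue_measure R.
pose I a y : R := (\int[mu]_(t in `[a, y]) h t)%R.
have IB a k z : a <= k -> k <= z -> I a z = I a k + I k z.
  move=> ak kz; apply/eqP; rewrite addrC -subr_eq; apply/eqP.
  rewrite -[RHS]subr0 -(Rintegral_set1 h k) -set_itv1.
  rewrite !Rintegral_itvB ?bnd_simp//; exact: continuous_integrable.
(* The base point lies to the left of both 0 and [y], where the fundamental theorem applies. By [IB]
   the difference does not depend on it, so near a given [x] it can be frozen at one [n]. *)
pose F y := I (- `|y| - 1) y - I (- `|y| - 1) 0.
have FE n y : n <= 0 -> n <= y -> n <= - `|y| - 1 -> F y = I n y - I n 0.
  move=> n0 ny nn; rewrite /F; set k := - `|y| - 1.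
  have k0 : k <= 0 by rewrite /k; have := normr_ge0 y; lra.
  have ky : k <= y by rewrite /k; have := ler_norm (- y); rewrite normrN; lra.
  by rewrite (IB n k y) // (IB n k 0) //; ring.
exists F; split; first by rewrite /F subrr.
move=> x; pose n := - `|x| - 2.
have xn : n < x by rewrite /n; have := ler_norm (- x); rewrite normrN; lra.
have n0 : n <= 0 by rewrite /n; have := normr_ge0 x; lra.
have [dI I'] : derivable (I n) x 1 /\ derive1 (I n) x = h x.
  apply: (@continuous_FTC1_closed _ h n x (x + 1)) => //; first by rewrite ltrDl.
    exact: continuous_integrable.
  exact: hc.
apply: (@der_near (fun y => I n y - I n 0)); last first.
  rewrite -I'; apply: der_eq; first exact: (derB (derivable_der dI) (der_cst _ _)).
  by rewrite subr0.
near=> y; apply/esym/FE => //.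
  by apply: ltW; near: y; apply: lt_nbhsr.
rewrite /n; have : `|y - x| <= 1.
  by near: y; apply/nbhs_normP; exists 1 => //= z /=; rewrite distrC => /ltW.
have := ler_distD 0 y x; rewrite sub0r subr0 normrN.
have := ler_normD (y - x) x; rewrite subrK; lra.
Unshelve. all: by end_near. Qed.

End real_calculus.

(** * Linear systems with continuous coefficients: the Picard series *)

Section linear_system.
Context {R : realType}.

(** A total choice of antiderivative, so that the recursion [picard] carries no continuity proofs;
    its properties are recovered by [prim0P]. *)
Definition prim0 (h : R -> R) : R -> R :=
  xget (fun=> 0) [set F | F 0 = 0 /\ forall x, der F x (h x)].

Lemma prim0P (h : R -> R) : continuous h ->
  prim0 h 0 = 0 /\ forall x, der (prim0 h) x (h x).
Proof.
move=> hc; have [F F0] := antiderivative hc.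
exact: (@xgetPex _ (fun=> 0) [set F | F 0 = 0 /\ forall x, der F x (h x)]
  (ex_intro _ F F0)).
Qed.

Lemma der_expR_lin (L x : R) : der (fun y => expR (L * y)) x (L * expR (L * x)).
Proof.
apply: der_eq; first exact: (der_comp (is_derive_expR _) (derM (der_cst L x) (der_id x))).
by rewrite /=; ring.
Qed.

(** Both K e^(L x) - f and K e^(L x) + f are nonnegative at 0 and have nonnegative derivative on
    [0, T]. The exponential weight gives estimates on any bounded interval, without a smallness
    condition on its length. *)
Lemma der_expR_bound_right (f df : R -> R) (K L T : R) : 0 <= K -> f 0 = 0 ->
  (forall x, der f x (df x)) ->
  (forall x, 0 <= x <= T -> `|df x| <= K * L * expR (L * x)) ->
  forall x, 0 <= x <= T -> `|f x| <= K * expR (L * x).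
Proof.
move=> K0 f0 fd dfb x /andP[x0 xT].
have Kd y : der (fun z => K * expR (L * z)) y (K * L * expR (L * y)).
  by apply: der_eq (derM (der_cst K y) (der_expR_lin L y)) _; ring.
have mono g dg : g 0 = 0 -> (forall y, der g y (dg y)) ->
    (forall y, 0 <= y <= T -> dg y <= K * L * expR (L * y)) -> g x <= K * expR (L * x).
  move=> g0 gd gb; rewrite -subr_ge0.
  have dd y : der (fun z => K * expR (L * z) - g z) y (K * L * expR (L * y) - dg y).
    exact: derB.
  apply: (le_trans _ (der_ge0_le x0 (fun y _ => dd y) _ _)).
  - by rewrite g0 subr0 mulr_ge0 // expR_ge0.
  - by apply: cont_on_der => y _; exact: dd.
  - by move=> y /andP[? ?]; rewrite subr_ge0; apply: gb; lra.
rewrite ler_norml; apply/andP; split.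
  rewrite lerNl; apply: (mono (fun z => - f z) (fun z => - df z)).
  - by rewrite f0 oppr0.
  - by move=> y; exact: derN.
  - by move=> y /dfb; apply: le_trans; rewrite -normrN ler_norm.
apply: (mono f df) => // y /dfb; apply: le_trans; exact: ler_norm.
Qed.

Lemma der_expR_bound (f df : R -> R) (K L T : R) : 0 <= K -> f 0 = 0 ->
  (forall x, der f x (df x)) ->
  (forall x, `|x| <= T -> `|df x| <= K * L * expR (L * `|x|)) ->
  forall x, `|x| <= T -> `|f x| <= K * expR (L * `|x|).
Proof.
move=> K0 f0 fd dfb x xT.
have [x0|x0] := leP 0 x.
  rewrite (ger0_norm x0) in xT *.
  apply: (@der_expR_bound_right f df K L T) => //; last by rewrite x0.
  by move=> y /andP[y0 yT]; have := dfb y; rewrite ger0_norm //; apply.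
rewrite (ltr0_norm x0) in xT *.
have := @der_expR_bound_right (fun z => f (- z)) (fun z => - df (- z)) K L T K0 _ _ _ (- x).
rewrite opprK; apply.
- by rewrite oppr0.
- move=> y; apply: der_eq; first exact: (der_comp (fd _) (derN (der_id y))).
  ring.
- move=> y /andP[y0 yT]; rewrite normrN; have := dfb (- y).
  by rewrite normrN ger0_norm //; apply.
- by rewrite xT andbT; lra.
Qed.

Variables (n : nat) (A : 'I_n -> 'I_n -> R -> R) (b : 'I_n -> R).
Hypothesis A_cont : forall i j, continuous (A i j).

(** The k-th term of the Picard series, that is, the difference of two successive iterates: only the
    term of index 0 carries the initial value, and the solution is the sum of all terms. *)
Fixpoint picard (k : nat) : 'I_n -> R -> R :=
  if k is k'.+1 then fun i => prim0 (fun x => \sum_j A i j x * picard k' j x)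
  else fun i _ => b i.

Let rhs_cont (Y : 'I_n -> R -> R) i : (forall j, continuous (Y j)) ->
  continuous (fun x => \sum_j A i j x * Y j x).
Proof.
move=> Yc x; apply: cvg_big => [|j _]; [exact: add_continuous|apply: cvgM]; [exact: A_cont|exact: Yc].
Qed.

Let picard_cont k i : continuous (picard k i).
Proof.
elim: k i => [i x|k IH i x]; first exact: cvg_cst.
by apply: der_continuous; apply: (prim0P _).2; exact: rhs_cont.
Qed.

Let picard0 k i : picard k.+1 i 0 = 0.
Proof. by apply: (prim0P _).1; exact: rhs_cont. Qed.

Let picard_der k i x : der (picard k.+1 i) x (\sum_j A i j x * picard k j x).
Proof. by apply: (prim0P _).2; exact: rhs_cont. Qed.

Let coef_bound (T : R) : 0 <= T -> exists2 M : R, 0 < M &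
  forall i x, `|x| <= T -> \sum_j `|A i j x| <= M.
Proof.
move=> T0.
have /choice[M hM] (p : 'I_n * 'I_n) :
    exists M : R, 0 <= M /\ forall x, `|x| <= T -> `|A p.1 p.2 x| <= M.
  have TT : - T <= T by lra.
  have [M M0 hM] := cont_on_bounded TT (@cont_on_continuous _ _ _ _ (@A_cont p.1 p.2)).
  by exists M; split => // x; rewrite ler_norml => /hM.
exists (1 + \sum_i \sum_j M (i, j)).
  apply: ltr_pwDl => //; apply: sumr_ge0 => i _; apply: sumr_ge0 => j _.
  by case: (hM (i, j)).
move=> i x xT; apply: (@le_trans _ _ (\sum_j M (i, j))).
  by apply: ler_sum => j _; case: (hM (i, j)) => _; exact.
rewrite [X in _ <= 1 + X](bigD1 i)//= addrA [1 + _]addrC -addrA lerDl.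
apply: addr_ge0 => //; apply: sumr_ge0 => k _; apply: sumr_ge0 => j _.
by case: (hM (k, j)).
Qed.

Let picard_bound (T : R) : 0 <= T -> exists2 K : R, 0 <= K &
  forall k i x, `|x| <= T -> `|picard k i x| <= K / 2 ^+ k.
Proof.
move=> T0; have [M M0 hM] := coef_bound T0.
(* Against the weight e^(L |x|) each integration divides the bound by L; with L = 2 M the bound M on
   the coefficients then leaves a factor 1/2 per step. *)
pose B : R := \sum_i `|b i|; pose L := 2 * M.
have B0 : 0 <= B by apply: sumr_ge0.
have E1 (x : R) : 1 <= expR (L * `|x|).
  by rewrite -expR0 ler_expR; rewrite mulr_ge0 // /L; lra.
have main k i x : `|x| <= T -> `|picard k i x| <= B / 2 ^+ k * expR (L * `|x|).
  elim: k i x => [i x _|k IH i x xT].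
    rewrite expr0 divr1 /=; apply: (@le_trans _ _ B); last by rewrite ler_peMr.
    by rewrite /B (bigD1 i)//= lerDl; apply: sumr_ge0.
  apply: (der_expR_bound _ (picard0 k i) (picard_der k i) _ xT).
    by rewrite divr_ge0 // exprn_ge0.
  move=> z zT'; apply: le_trans (ler_norm_sum _ _ _) _.
  apply: (@le_trans _ _ (\sum_j `|A i j z| * (B / 2 ^+ k * expR (L * `|z|)))).
    by apply: ler_sum => j _; rewrite normrM ler_wpM2l //; exact: IH.
  rewrite -mulr_suml /L exprS.
  apply: (@le_trans _ _ (M * (B / 2 ^+ k * expR (2 * M * `|z|)))).
    rewrite ler_wpM2r ?hM // mulr_ge0 ?expR_ge0 //.
    by rewrite divr_ge0 // exprn_ge0.
  apply: eq_ler; field; rewrite expf_neq0 //.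
exists (B * expR (L * T)); first by rewrite mulr_ge0 ?expR_ge0.
move=> k i x xT; apply: le_trans (main k i x xT) _.
rewrite mulrAC ler_wpM2r // ?invr_ge0 ?exprn_ge0 // ler_wpM2l // ler_expR.
by rewrite ler_wpM2l // /L; lra.
Qed.

Let S i x N : R := series (fun k => picard k i x) N.
Let sol i x : R := limn (S i x).

Let S_S i x N : S i x N.+1 = S i x N + picard N i x.
Proof. by rewrite /S /series/= big_nat_recr. Qed.

Let sol_approx (T : R) : 0 <= T -> exists2 K : R, 0 <= K &
  forall i x N, `|x| <= T -> `|sol i x - S i x N| <= K / 2 ^+ N.
Proof.
move=> T0; have [K K0 hK] := picard_bound T0.
exists (2 * K); first by lra.
move=> i x N xT.
have Scv : cvgn (S i x).
  apply: normed_cvg.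
  apply: (@series_le_cvg _ _ (geometric K 2^-1)) => //.
  - by move=> k /=.
  - by move=> k; rewrite /geometric/= mulr_ge0 // exprn_ge0 // invr_ge0.
  - by move=> k; rewrite /geometric/= exprVn; exact: hK.
  - by apply: is_cvg_geometric_series; rewrite ger0_norm ?invr_ge0 // invf_lt1 // ltr1n.
(* The geometric tail is written as a telescoping difference, so that the induction on [m]
   closes. *)
have tail m : `|S i x (N + m)%N - S i x N| <= 2 * K / 2 ^+ N - 2 * K / 2 ^+ (N + m).
  elim: m => [|m IH]; first by rewrite addn0 !subrr normr0.
  rewrite addnS S_S addrAC; apply: le_trans (ler_normD _ _) _.
  apply: le_trans (lerD IH (hK _ _ _ xT)) _.
  apply: eq_ler; rewrite exprS exprD; field.
  by rewrite !expf_neq0.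
have cv : `|S i x (N + m)%N - S i x N| @[m --> \oo] --> `|sol i x - S i x N|.
  apply: cvg_norm; apply: cvgB; last exact: cvg_cst.
  by rewrite (_ : (fun m => _) = (fun m => S i x (m + N)%N));
    [rewrite cvg_shiftn|apply/funext => m; rewrite addnC].
rewrite -(cvg_lim _ cv) //; apply: limr_le; first by apply/cvg_ex; eexists; exact: cv.
near=> m; apply: le_trans (tail m) _; rewrite lerBlDr lerDl.
by rewrite divr_ge0 ?exprn_ge0 //; lra.
Unshelve. all: by end_near. Qed.

Let half_small (K e : R) : 0 <= K -> 0 < e -> exists N, K / 2 ^+ N < e.
Proof.
move=> K0 e0; have [N _ hN] : \forall N \near \oo, `|(2^-1 : R) ^+ N| < e / (K + 1).
  have h : (2^-1 : R) ^+ N @[N --> \oo] --> (0 : R).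
    by apply: cvg_expr; rewrite ger0_norm ?invr_ge0 // invf_lt1 // ltr1n.
  move/cvgr0Pnorm_lt : h; apply; rewrite divr_gt0 //; lra.
exists N; have := hN N (leqnn N); rewrite /= ger0_norm ?exprn_ge0 ?invr_ge0 //.
rewrite exprVn ltr_pdivlMr; last by lra.
apply: le_lt_trans; rewrite mulrC ler_wpM2l ?invr_ge0 ?exprn_ge0 //; lra.
Qed.

Let S_cont i N : continuous (S i ^~ N).
Proof.
elim: N => [|N IH] x.
  by rewrite (_ : S i ^~ 0%N = cst 0); [exact: cvg_cst|apply/funext => y; rewrite /S /series/= big_geq].
rewrite (_ : S i ^~ N.+1 = fun y => S i y N + picard N i y); last first.
  by apply/funext => y; rewrite S_S.
by apply: cvgD; [exact: IH|exact: picard_cont].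
Qed.

Let sol_cont i : continuous (sol i).
Proof.
move=> x; have [|K K0 hK] := @sol_approx (`|x| + 1); first by have := normr_ge0 x; lra.
apply/cvgrPdist_lt => e e0.
have [|N hN] := @half_small K (e / 3) K0; first by lra.
have /cvgrPdist_lt/(_ (e / 3)) := @S_cont i N x.
have e3 : 0 < e / 3 by lra.
move=> /(_ e3) hS; near=> y.
have yT : `|y| <= `|x| + 1.
  have : `|x - y| <= 1 by near: y; apply/nbhs_normP; exists 1 => //= z /= /ltW.
  by have := ler_normB x (x - y); rewrite opprB addrC subrK; lra.
have xT : `|x| <= `|x| + 1 by lra.
have h1 : `|S i x N - S i y N| < e / 3 by near: y.
have h2 := hK i x N xT; have h3 := hK i y N yT.
rewrite (_ : sol i x - sol i y = (sol i x - S i x N) + (S i x N - S i y N)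
   - (sol i y - S i y N)); last by ring.
apply: le_lt_trans (ler_normB _ _) _.
have := ler_normD (sol i x - S i x N) (S i x N - S i y N); lra.
Unshelve. all: by end_near. Qed.

(** The limit is not differentiated term by term but identified with b + P, where P is an
    antiderivative of the limiting right-hand side. The partial sum S_(N+1) differs from b + P by an
    integral of A (S_N - sol), which is O(2^(-N)) on [-|x|, |x|]. *)
Lemma linear_system_solution : exists Y : 'I_n -> R -> R,
  forall i, Y i 0 = b i /\ forall x, der (Y i) x (\sum_j A i j x * Y j x).
Proof.
exists sol => i.
pose g := fun x => \sum_j A i j x * sol j x.
have gc : continuous g by exact: rhs_cont.
have [P [P0 Pd]] := antiderivative gc.
suff solE x : sol i x = b i + P x.
  split; first by rewrite solE P0 addr0.
  move=> x; apply: (@der_ext _ (fun y => b i + P y)); first by move=> y; rewrite solE.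
  by apply: der_eq (derD (der_cst _ _) (Pd x)) _; rewrite add0r.
have SE N y : der (fun z => S i z N.+1) y (\sum_j A i j y * S j y N).
  elim: N => [|N IH].
    apply: (@der_ext _ (fun=> b i)); first by move=> z; rewrite /S /series/= big_nat1.
    by apply: der_eq (der_cst _ _) _; rewrite big1 // => j _; rewrite /S /series/= big_geq // mulr0.
  apply: (@der_ext _ (fun z => S i z N.+1 + picard N.+1 i z)); first by move=> z; rewrite -S_S.
  apply: der_eq (derD IH (picard_der _ _ _)) _.
  by rewrite -big_split/=; apply: eq_bigr => j _; rewrite S_S; ring.
have S0 N : S i 0 N.+1 = b i.
  elim: N => [|N IH]; first by rewrite /S /series/= big_nat1.
  by rewrite S_S IH picard0 addr0.
have T0 := normr_ge0 x.
have [K K0 hK] := sol_approx T0; have [M M0 hM] := coef_bound T0.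
have [|e0] := leP `|sol i x - (b i + P x)| 0.
  by rewrite normr_le0 subr_eq0 => /eqP.
pose C := K + M * K * expR `|x|.
have C0 : 0 <= C by rewrite addr_ge0 // mulr_ge0 ?expR_ge0 // mulr_ge0 //; lra.
have [N hN] := half_small C0 e0.
have h1 := hK i x N.+1 (lexx _).
have h2 : `|S i x N.+1 - b i - P x| <= M * K / 2 ^+ N * expR (1 * `|x|).
  apply: (@der_expR_bound (fun y => S i y N.+1 - b i - P y)
    (fun y => \sum_j A i j y * S j y N - 0 - g y) (M * K / 2 ^+ N) 1 `|x|) => //.
  - by rewrite divr_ge0 ?exprn_ge0 // mulr_ge0 //; lra.
  - by rewrite S0 P0 subrr subr0.
  - by move=> y; apply: derB => //; apply: derB (der_cst _ _); exact: SE.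
  move=> y yx; rewrite subr0 /g -sumrB.
  rewrite mulr1.
  apply: le_trans (ler_norm_sum _ _ _) _.
  apply: (@le_trans _ _ (\sum_j `|A i j y| * (K / 2 ^+ N))).
    apply: ler_sum => j _; rewrite -mulrBr normrM ler_wpM2l // distrC; exact: hK.
  have KN : 0 <= K / 2 ^+ N by rewrite divr_ge0 ?exprn_ge0.
  apply: (@le_trans _ _ (M * K / 2 ^+ N)).
    by rewrite -mulr_suml -[M * K / _]mulrA ler_wpM2r // hM.
  rewrite ler_peMr //; first by rewrite -mulrA mulr_ge0 //; lra.
  by rewrite mul1r -expR0 ler_expR.
have : `|sol i x - (b i + P x)| <= C / 2 ^+ N.
  rewrite (_ : _ - _ = (sol i x - S i x N.+1) + (S i x N.+1 - b i - P x)); last by ring.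
  apply: le_trans (ler_normD _ _) _.
  apply: le_trans (lerD h1 h2) _; rewrite mul1r /C mulrDl.
  apply: lerD; last by apply: eq_ler; ring.
  rewrite ler_wpM2l // lef_pV2 ?posrE ?exprn_gt0 // exprS.
  by have : 0 < (2 : R) ^+ N; [rewrite exprn_gt0|lra].
by move=> /le_lt_trans/(_ hN); rewrite ltxx.
Qed.

End linear_system.

(** * Calculus of complex-valued functions of a real variable *)

Section complex_calculus.
Context {R : realType}.
Local Notation C := R[i].
Implicit Types (f g : R -> C) (x : R) (z : C).

Lemma cvg_max_real (f g : R -> R) x : {for x, continuous f} -> {for x, continuous g} ->
  {for x, continuous (fun y => Num.max (f y) (g y))}.
Proof.
move=> fc gc; rewrite (_ : (fun y => _) = (fun y => (f y + g y + `|f y - g y|) / 2)).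
  apply: cvgM; last exact: cvg_cst.
  by apply: cvgD; [exact: cvgD|apply: cvg_norm; exact: cvgB].
by apply/funext => y; rewrite maxr_absE.
Qed.

Lemma cvg_min_real (f g : R -> R) x : {for x, continuous f} -> {for x, continuous g} ->
  {for x, continuous (fun y => Num.min (f y) (g y))}.
Proof.
move=> fc gc; rewrite (_ : (fun y => _) = (fun y => (f y + g y - `|f y - g y|) / 2)).
  apply: cvgM; last exact: cvg_cst.
  by apply: cvgB; [exact: cvgD|apply: cvg_norm; exact: cvgB].
by apply/funext => y; rewrite minr_absE.
Qed.

Lemma cReD (z w : C) : Re (z + w) = Re z + Re w.
Proof. by case: z; case: w. Qed.
Lemma cImD (z w : C) : Im (z + w) = Im z + Im w.
Proof. by case: z; case: w. Qed.
Lemma cReN (z : C) : Re (- z) = - Re z.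
Proof. by case: z. Qed.
Lemma cImN (z : C) : Im (- z) = - Im z.
Proof. by case: z. Qed.
Lemma cReM (z w : C) : Re (z * w) =
  Re z * Re w - Im z * Im w.
Proof. by case: z; case: w. Qed.
Lemma cImM (z w : C) : Im (z * w) =
  Re z * Im w + Im z * Re w.
Proof. by case: z; case: w. Qed.
Definition sqn (z : C) : R := Re z ^+ 2 + Im z ^+ 2.
Lemma cReV (z : C) : Re z^-1 = Re z / sqn z.
Proof. by case: z. Qed.
Lemma cImV (z : C) : Im z^-1 = - Im z / sqn z.
Proof. by case: z => a b /=; rewrite mulNr. Qed.

Lemma complexP (z w : C) :
  Re z = Re w -> Im z = Im w -> z = w.
Proof. by case: z w => a b [c d] /= -> ->. Qed.

Lemma sqn_ge0 z : 0 <= sqn z.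
Proof. by rewrite addr_ge0 ?sqr_ge0. Qed.

Lemma sqn_eq0 z : (sqn z == 0) = (z == 0).
Proof.
rewrite /sqn paddr_eq0 ?sqr_ge0 // !sqrf_eq0.
apply/andP/eqP => [[/eqP h1 /eqP h2]|->]; first exact: complexP.
by rewrite /= eqxx.
Qed.

Lemma sqn_gt0 z : (0 < sqn z) = (z != 0).
Proof. by rewrite lt0r sqn_ge0 andbT sqn_eq0. Qed.

Lemma sqnM z w : sqn (z * w) = sqn z * sqn w.
Proof. by rewrite /sqn cReM cImM; ring. Qed.

Lemma sqnD_le z w : sqn (z + w) <= 2 * sqn z + 2 * sqn w.
Proof.
rewrite /sqn cReD cImD -subr_ge0; set a := Re z; set b := Re w.
set c := Im z; set d := Im w.
have -> : 2 * (a ^+ 2 + c ^+ 2) + 2 * (b ^+ 2 + d ^+ 2) -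
  ((a + b) ^+ 2 + (c + d) ^+ 2) = (a - b) ^+ 2 + (c - d) ^+ 2 by ring.
by rewrite addr_ge0 ?sqr_ge0.
Qed.

Definition cder f x (d : C) :=
  der (fun y => Re (f y)) x (Re d) /\
  der (fun y => Im (f y)) x (Im d).

Lemma cder_eq f x d d' : cder f x d -> d = d' -> cder f x d'.
Proof. by move=> fd <-. Qed.

Lemma cder_ext f g x d : (forall y, f y = g y) -> cder f x d -> cder g x d.
Proof. by move=> /funext ->. Qed.

Lemma cder_cst z x : cder (fun=> z) x 0.
Proof. by split; exact: der_cst. Qed.

Lemma cder_real (f : R -> R) x d : der f x d -> cder (fun y => (f y)%:C) x d%:C.
Proof. by move=> fd; split => //=; exact: der_cst. Qed.

Lemma cderD f g x df dg : cder f x df -> cder g x dg ->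
  cder (fun y => f y + g y) x (df + dg).
Proof.
move=> [f1 f2] [g1 g2]; split.
  rewrite cReD; apply: der_ext (derD f1 g1) => y; by rewrite cReD.
rewrite cImD; apply: der_ext (derD f2 g2) => y; by rewrite cImD.
Qed.

Lemma cderN f x df : cder f x df -> cder (fun y => - f y) x (- df).
Proof.
move=> [f1 f2]; split.
  rewrite cReN; apply: der_ext (derN f1) => y; by rewrite cReN.
rewrite cImN; apply: der_ext (derN f2) => y; by rewrite cImN.
Qed.

Lemma cderB f g x df dg : cder f x df -> cder g x dg ->
  cder (fun y => f y - g y) x (df - dg).
Proof. by move=> fd gd; apply: cderD => //; exact: cderN. Qed.

Lemma cderM f g x df dg : cder f x df -> cder g x dg ->
  cder (fun y => f y * g y) x (df * g x + f x * dg).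
Proof.
move=> [f1 f2] [g1 g2]; split.
  apply: (@der_ext _ (fun y => Re (f y) * Re (g y) -
    Im (f y) * Im (g y))); first by move=> y; rewrite cReM.
  apply: der_eq; first exact: derB (derM f1 g1) (derM f2 g2).
  by rewrite cReD !cReM; ring.
apply: (@der_ext _ (fun y => Re (f y) * Im (g y) +
  Im (f y) * Re (g y))); first by move=> y; rewrite cImM.
apply: der_eq; first exact: derD (derM f1 g2) (derM f2 g1).
by rewrite cImD !cImM; ring.
Qed.

Lemma cderV f x df : f x != 0 -> cder f x df ->
  cder (fun y => (f y)^-1) x (- df / f x ^+ 2).
Proof.
move=> fx [f1 f2]; have fx' : sqn (f x) != 0 by rewrite sqn_eq0.
have sd : der (fun y => sqn (f y)) x
    (2 * Re (f x) * Re df + 2 * Im (f x) * Im df).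
  by apply: derD; exact: der_sqr.
have fx2 : Re (f x) ^+ 2 + Im (f x) ^+ 2 != 0 by exact: fx'.
have fx3 : sqn (f x ^+ 2) != 0 by rewrite sqn_eq0 expf_neq0.
split.
  apply: (@der_ext _ (fun y => Re (f y) * (sqn (f y))^-1)).
    by move=> y; rewrite cReV.
  apply: der_eq; first exact: derM f1 (@derV _ (fun y => sqn (f y)) _ _ fx' sd).
  rewrite cReM cReN cImN cReV cImV expr2 sqnM !cReM !cImM /sqn; field => //.
apply: (@der_ext _ (fun y => (- Im (f y)) * (sqn (f y))^-1)).
  by move=> y; rewrite cImV.
apply: der_eq; first exact: derM (derN f2) (@derV _ (fun y => sqn (f y)) _ _ fx' sd).
rewrite cImM cReN cImN cReV cImV expr2 sqnM !cReM !cImM /sqn; field => //.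
Qed.

Definition ccont_at x f := {for x, continuous (fun y => Re (f y))} /\
  {for x, continuous (fun y => Im (f y))}.

Definition ccont_on a b f := cont_on a b (fun y => Re (f y)) /\
  cont_on a b (fun y => Im (f y)).

Lemma cder_ccont_at f x d : cder f x d -> ccont_at x f.
Proof. by move=> [/der_continuous ? /der_continuous]. Qed.

Lemma ccont_on_cder a b f df : (forall x, a <= x <= b -> cder f x (df x)) ->
  ccont_on a b f.
Proof.
move=> fd; split.
  by apply: (@cont_on_der _ _ _ _ (fun x => Re (df x))) => x /fd[].
by apply: (@cont_on_der _ _ _ _ (fun x => Im (df x))) => x /fd[].
Qed.

Lemma ccont_onD a b f g : ccont_on a b f -> ccont_on a b g ->
  ccont_on a b (fun y => f y + g y).
Proof.
move=> [f1 f2] [g1 g2]; split.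
  by apply: cont_on_ext (cont_onD f1 g1) => y _; rewrite cReD.
by apply: cont_on_ext (cont_onD f2 g2) => y _; rewrite cImD.
Qed.

Lemma ccont_onN a b f : ccont_on a b f -> ccont_on a b (fun y => - f y).
Proof.
move=> [f1 f2]; split.
  by apply: cont_on_ext (cont_onN f1) => y _; rewrite cReN.
by apply: cont_on_ext (cont_onN f2) => y _; rewrite cImN.
Qed.

Lemma ccont_onM a b f g : ccont_on a b f -> ccont_on a b g ->
  ccont_on a b (fun y => f y * g y).
Proof.
move=> [f1 f2] [g1 g2]; split.
  apply: cont_on_ext (cont_onD (cont_onM f1 g1) (cont_onN (cont_onM f2 g2))) => y _.
  by rewrite cReM.
apply: cont_on_ext (cont_onD (cont_onM f1 g2) (cont_onM f2 g1)) => y _.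
by rewrite cImM.
Qed.

Lemma cder0_cst a b f : (forall x, a < x < b -> cder f x 0) -> ccont_on a b f ->
  forall x, a <= x <= b -> f x = f a.
Proof.
move=> fd [c1 c2] x xab; apply: complexP.
  by apply: (der0_cst _ c1 xab) => y /fd[].
by apply: (der0_cst _ c2 xab) => y /fd[].
Qed.

(** In real and imaginary parts, u' = p, p' = q u is a real 4 by 4 system, so
    [linear_system_solution] applies once the coefficients are continuous on the whole line. *)
Lemma complex_ode (a b x0 : R) (q : R -> C) (u0 p0 : C) :
  a <= x0 <= b -> (forall x, a <= x <= b -> ccont_at x q) ->
  exists u p : R -> C, [/\ u x0 = u0, p x0 = p0,
    forall x, cder u x (p x) &
    forall x, a <= x <= b -> cder p x (q x * u x)].
Proof.
move=> x0ab qc; have /andP[ax0 x0b] := x0ab.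
(* [q] is continuous only at the points of [a, b]; composing it with the clamp [cl] gives global
   coefficients that agree with it there. The shift by [x0] moves the initial point to 0. *)
pose cl (x : R) := Num.max a (Num.min b (x + x0)).
have clab x : a <= cl x <= b.
  by rewrite /cl le_max lexx/= ge_max ge_min lexx /= andbT; lra.
have clE x : a <= x + x0 <= b -> cl x = x + x0.
  by move=> /andP[? ?]; rewrite /cl min_r // max_r.
have clc : continuous cl.
  move=> x; apply: (@cvg_max_real (fun=> a) (fun x => Num.min b (x + x0))); first exact: cvg_cst.
  apply: (@cvg_min_real (fun=> b) (fun x => x + x0)); first exact: cvg_cst.
  by apply: cvgD; [exact: cvg_id|exact: cvg_cst].
have qr : continuous (fun x => Re (q (cl x))).
  move=> x; apply: (@continuous_comp _ _ _ cl (fun y => Re (q y))); first exact: clc.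
  by case: (qc _ (clab x)).
have qi : continuous (fun x => Im (q (cl x))).
  move=> x; apply: (@continuous_comp _ _ _ cl (fun y => Im (q y))); first exact: clc.
  by case: (qc _ (clab x)).
pose A (i j : 'I_4) : R -> R :=
  match val i, val j with
  | 0, 2 | 1, 3 => fun=> 1%R
  | 2, 0 | 3, 1 => fun x => Re (q (cl x))
  | 3, 0 => fun x => Im (q (cl x))
  | 2, 1 => fun x => (- Im (q (cl x)))%R
  | _, _ => fun=> 0%R
  end%N.
have Ac i j : continuous (A i j).
  move=> x; rewrite /A; case: i j => [[|[|[|[|i]]]] hi] [[|[|[|[|j]]]] hj] //=;
    try exact: cvg_cst; try exact: qr; try exact: qi.
  by apply: cvgN; exact: qi.
pose b0 (i : 'I_4) : R := [:: Re u0; Im u0; Re p0; Im p0]`_i.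
have [Y hY] := linear_system_solution b0 Ac.
pose k (i : nat) : 'I_4 := inord i.
have kE i : (i < 4)%N -> val (k i) = i by move=> i4; rewrite /= inordK.
have k0 : ord0 = k 0%N by apply/val_inj; rewrite kE.
have k1 : lift ord0 ord0 = k 1%N by apply/val_inj; rewrite kE.
have k2 : lift ord0 (lift ord0 ord0) = k 2%N by apply/val_inj; rewrite kE.
have k3 : lift ord0 (lift ord0 (lift ord0 ord0)) = k 3%N by apply/val_inj; rewrite kE.
pose u x : C := Y (k 0%N) (x - x0) +i* Y (k 1%N) (x - x0).
pose p x : C := Y (k 2%N) (x - x0) +i* Y (k 3%N) (x - x0).
have shd i x : der (fun y => Y i (y - x0)) x (\sum_j A i j (x - x0) * Y j (x - x0)).
  apply: der_eq; first exact: (der_comp ((hY i).2 _) (derB (der_id x) (der_cst x0 x))).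
  by rewrite subr0 mulr1.
have Y0 i : Y i (x0 - x0) = b0 i by rewrite subrr (hY i).1.
exists u, p; split.
- by apply: complexP; rewrite /u /= Y0 /b0 kE.
- by apply: complexP; rewrite /p /= Y0 /b0 kE.
- move=> x; split; apply: der_eq (shd _ _) _ => /=.
    by rewrite !big_ord_recl big_ord0 k3 k2 k1 k0 /A !kE //=; ring.
  by rewrite !big_ord_recl big_ord0 k3 k2 k1 k0 /A !kE //=; ring.
- move=> x xab; have clx : cl (x - x0) = x by rewrite clE subrK.
  split; apply: der_eq (shd _ _) _; rewrite ?cReM ?cImM /=.
    by rewrite !big_ord_recl big_ord0 k3 k2 k1 k0 /A !kE //= clx; ring.
  by rewrite !big_ord_recl big_ord0 k3 k2 k1 k0 /A !kE //= clx; ring.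
Qed.

End complex_calculus.

(** * Integration on (0,1) and primitives *)

Section integrals_on_the_unit_interval.
Context {R : realType}.
Local Notation mu := (@lebesgue_measure R).
Local Notation I := (@I01 R).
Implicit Types (f g h : R -> R) (x y : R).

Definition int01 f := mu.-integrable I (EFin \o f).

Definition mean01 f : R := (\int[mu]_(t in I) f t)%R.

Definition ci f y : R := (\int[mu]_(t in `[0, y]) f t)%R.

Lemma measurable_I01 : @measurable _ (measurableTypeR R) I.
Proof. exact: measurable_itv. Qed.
Hint Resolve measurable_I01 : core.

Lemma I01P y : I y <-> 0 < y < 1.
Proof. by rewrite /I01 /= in_itv. Qed.

Lemma mu_I01 : mu I = 1%E.
Proof. by rewrite /I01 lebesgue_measure_itv /= lte_fin ltr01 oppr0 adde0. Qed.

Lemma mu_I01_lty : (mu I < +oo)%E.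
Proof. by rewrite mu_I01 ltry. Qed.

Lemma int01_measurable f : int01 f -> measurable_fun I f.
Proof. by case/integrableP => /measurable_EFinP. Qed.

Lemma int01_cc f : int01 f -> mu.-integrable `[0, 1] (EFin \o f).
Proof.
case/integrableP => /measurable_EFinP fm fi.
have mc : measurable_fun `[(0 : R), 1] f by apply: measurable_fun_itv_cc fm.
apply/integrableP; split; first exact/measurable_EFinP.
rewrite integral_itv_bndoo //; apply/measurable_EFinP.
by apply: measurableT_comp => //; apply: measurable_funS mc => // z /=;
  rewrite !in_itv/= => /andP[/ltW -> /ltW].
Qed.

Lemma int01_sub f a b : 0 <= a -> b <= 1 -> int01 f -> mu.-integrable `[a, b] (EFin \o f).
Proof.
move=> a0 b1 /int01_cc; apply: integrableS => // z /=; rewrite !in_itv/=.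
by move=> /andP[? ?]; apply/andP; split; lra.
Qed.

Lemma mean01_ci f : int01 f -> mean01 f = ci f 1.
Proof.
move=> fi; rewrite /mean01 /ci /Rintegral (integral_itv_bndoo true false) //.
by case/integrableP : fi.
Qed.

Lemma int01_ext f g : (forall x, 0 < x < 1 -> f x = g x) -> int01 f -> int01 g.
Proof.
move=> fg; apply: eq_integrable => // x; rewrite inE => /I01P x01.
by rewrite /= fg.
Qed.

Lemma int01D f g : int01 f -> int01 g -> int01 (fun x => f x + g x).
Proof.
move=> fi gi; have := integrableD measurable_I01 fi gi.
by apply: eq_integrable.
Qed.

Lemma int01Z (k : R) f : int01 f -> int01 (fun x => k * f x).
Proof.
move=> fi; have := integrableZl measurable_I01 k fi.
by apply: eq_integrable.
Qed.

Lemma int01N f : int01 f -> int01 (fun x => - f x).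
Proof. by move=> /(int01Z (- 1)); apply: int01_ext => x _; rewrite mulN1r. Qed.

Lemma int01B f g : int01 f -> int01 g -> int01 (fun x => f x - g x).
Proof. by move=> fi gi; apply: int01D => //; exact: int01N. Qed.

Lemma int01_norm f : int01 f -> int01 (fun x => `|f x|).
Proof. by move=> /integrable_abse; apply: eq_integrable. Qed.

Lemma int01_le f g : measurable_fun I f -> (forall x, 0 < x < 1 -> `|f x| <= `|g x|) ->
  int01 g -> int01 f.
Proof.
move=> fm fg; apply: le_integrable => //; first exact/measurable_EFinP.
Qed.

Lemma int01_cst (k : R) : int01 (fun=> k).
Proof.
have h : mu.-integrable `[(0 : R), 1] (EFin \o (fun=> k)).
  by apply: continuous_integrable => x; exact: cvg_cst.
by apply: integrableS h => //= z /=; rewrite !in_itv/= => /andP[/ltW -> /ltW].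
Qed.

Lemma int01M_bounded f h (M : R) : measurable_fun I h -> (forall x, 0 < x < 1 -> `|h x| <= M) ->
  int01 f -> int01 (fun x => f x * h x).
Proof.
move=> hm hb fi; apply: (@int01_le _ (fun x => M * f x)); last exact: int01Z.
  by apply: measurable_funM => //; exact: int01_measurable.
move=> x x01; rewrite !normrM mulrC ler_wpM2r //.
by apply: le_trans (hb x x01) (ler_norm _).
Qed.

Lemma cont_on_measurable h : cont_on 0 1 h -> measurable_fun I h.
Proof.
move=> hc; have : measurable_fun `[(0 : R), 1] h by exact: subspace_continuous_measurable_fun.
by apply: measurable_funS => // z /=; rewrite !in_itv/= => /andP[/ltW -> /ltW].
Qed.

Lemma int01M_cont f h : cont_on 0 1 h -> int01 f -> int01 (fun x => f x * h x).
Proof.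
move=> hc; have [M M0 hM] := cont_on_bounded ler01 hc.
apply: (@int01M_bounded _ _ M); first exact: cont_on_measurable.
by move=> x /andP[? ?]; apply: hM; lra.
Qed.

Lemma int01_cont h : cont_on 0 1 h -> int01 h.
Proof.
move=> hc; apply: (int01_ext (f := fun x => 1 * h x)); first by move=> x _; rewrite mul1r.
by apply: int01M_cont => //; exact: int01_cst.
Qed.

Lemma mean01D f g : int01 f -> int01 g -> mean01 (fun x => f x + g x) = mean01 f + mean01 g.
Proof. by move=> fi gi; exact: RintegralD. Qed.

Lemma mean01Z (k : R) f : int01 f -> mean01 (fun x => k * f x) = k * mean01 f.
Proof. by move=> fi; exact: RintegralZl. Qed.

Lemma mean01B f g : int01 f -> int01 g -> mean01 (fun x => f x - g x) = mean01 f - mean01 g.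
Proof. by move=> fi gi; exact: RintegralB. Qed.

Lemma mean01_ext f g : (forall x, 0 < x < 1 -> f x = g x) -> mean01 f = mean01 g.
Proof.
move=> fg; apply: eq_Rintegral => x; rewrite inE => /I01P; exact: fg.
Qed.

Lemma mean01_le f g : int01 f -> int01 g -> (forall x, 0 < x < 1 -> f x <= g x) ->
  mean01 f <= mean01 g.
Proof.
by move=> fi gi fg; apply: le_Rintegral => // x /I01P; exact: fg.
Qed.

Lemma ae_eq_mean01 f g : int01 f -> int01 g -> ae_eq mu I f g -> mean01 f = mean01 g.
Proof.
move=> fi gi fg; rewrite /mean01 /Rintegral; congr fine.
apply: ae_eq_integral => //; [by case/integrableP: fi|by case/integrableP: gi|].
by apply: filterS fg => x /[apply] ->.
Qed.

Lemma ciD f g y : int01 f -> int01 g -> y <= 1 -> ci (fun x => f x + g x) y = ci f y + ci g y.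
Proof.
move=> fi gi y1; apply: RintegralD => //; exact: int01_sub.
Qed.

Lemma ciZ (k : R) f y : int01 f -> y <= 1 -> ci (fun x => k * f x) y = k * ci f y.
Proof. by move=> fi y1; apply: RintegralZl => //; exact: int01_sub. Qed.

Lemma ciN f y : int01 f -> y <= 1 -> ci (fun x => - f x) y = - ci f y.
Proof.
move=> fi y1; rewrite -mulN1r -ciZ //; congr ci.
by apply/funext => x; rewrite mulN1r.
Qed.

Lemma ciB f g y : int01 f -> int01 g -> y <= 1 -> ci (fun x => f x - g x) y = ci f y - ci g y.
Proof. by move=> fi gi y1; rewrite ciD // ?ciN //; exact: int01N. Qed.

Lemma ci0 f : ci f 0 = 0.
Proof. by rewrite /ci set_itv1 Rintegral_set1. Qed.

Lemma ci_ae f g y : int01 f -> int01 g -> ae_eq mu I f g -> y <= 1 -> ci f y = ci g y.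
Proof.
move=> fi gi fg y1; rewrite /ci /Rintegral; congr fine.
have fm : measurable_fun `]0, y[ f.
  apply: measurable_funS (int01_measurable fi) => // z /=.
  by rewrite /I01/= !in_itv/= => /andP[-> ?]; lra.
have gm : measurable_fun `]0, y[ g.
  apply: measurable_funS (int01_measurable gi) => // z /=.
  by rewrite /I01/= !in_itv/= => /andP[-> ?]; lra.
rewrite !(integral_itv_bndoo true false); try exact/measurable_EFinP.
apply: ae_eq_integral => //; try exact/measurable_EFinP.
apply: filterS fg => x h /=; rewrite in_itv/= => /andP[x0 xy].
by rewrite h //; apply/I01P; rewrite x0; lra.
Qed.

Lemma ci_ext f g y : (forall x, 0 <= x <= y -> f x = g x) -> ci f y = ci g y.
Proof. by move=> fg; apply: eq_Rintegral => x; rewrite inE/= in_itv/= => /fg. Qed.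

Lemma ci_le1 f y : int01 f -> (forall x, 0 <= f x) -> y <= 1 -> ci f y <= ci f 1.
Proof.
move=> fi f0 y1; apply: fine_le.
- by apply: integrable_fin_num => //; exact: int01_sub.
- by apply: integrable_fin_num => //; exact: int01_sub.
apply: ge0_subset_integral => //.
- by have /integrableP[] := int01_cc fi.
- by move=> x _; rewrite lee_fin.
- by move=> z /=; rewrite !in_itv/= => /andP[-> ?]; lra.
Qed.

Lemma ci_cont f : int01 f -> cont_on 0 1 (ci f).
Proof. by move=> fi; apply: parameterized_integral_continuous => //; exact: int01_cc. Qed.

Lemma ci_der f x : int01 f -> 0 < x < 1 -> {for x, continuous f} -> der (ci f) x (f x).
Proof.
move=> fi /andP[x0 x1] fx.
have [df <-] := @continuous_FTC1_closed _ f 0 x 1 x1 (int01_cc fi) x0 fx.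
exact: derivable_der.
Qed.

(** Lebesgue's differentiation theorem for the extension of [f] by zero; near a point of (0, 1) the
    primitives of [f] and of its extension agree. *)
Lemma ci_der_ae f : int01 f -> {ae mu, forall x, 0 < x < 1 -> der (ci f) x (f x)}.
Proof.
move=> fi; have Li := integrable_locally measurable_I01 fi.
have inty y : mu.-integrable [set` Interval (BLeft 0) (BRight y)] (EFin \o (f \_ I)).
  apply: integrableS (_ : mu.-integrable setT _) => //.
  have := (integrable_mkcond (T := measurableTypeR R) (EFin \o f) measurable_I01).1 fi.
  apply: eq_integrable => // x _; rewrite /= !patchE; by case: ifP.
have := FTC1 inty Li; apply: filterS; first exact: (ae_filter_ringOfSetsType mu).
move=> x h /andP[x0 x1].
have [|df dfE] := h; first by rewrite /= lte_fin.
have -> : f x = (f \_ I) x by rewrite patchE mem_set //; apply/I01P; rewrite x0.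
rewrite -dfE; apply: der_near (derivable_der df); near=> y.
have y01 : 0 < y < 1.
  by apply/andP; split; near: y; [exact: lt_nbhsr|exact: lt_nbhsl].
rewrite /ci /Rintegral; congr fine.
have /andP[y0 y1] := y01.
have fm : measurable_fun `]0, y[ (f \_ I).
  apply: (eq_measurable_fun f) => [z|].
    rewrite inE /= in_itv/= => /andP[z0 zy].
    by rewrite patchE mem_set //; apply/I01P; rewrite z0; lra.
  apply: measurable_funS (int01_measurable fi) => // z /=.
  by rewrite /I01/= !in_itv/= => /andP[-> ?]; lra.
have fm' : measurable_fun `]0, y[ f.
  apply: measurable_funS (int01_measurable fi) => // z /=.
  by rewrite /I01/= !in_itv/= => /andP[-> ?]; lra.
rewrite !(integral_itv_bndoo true false); try exact/measurable_EFinP.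
apply: eq_integral => z; rewrite inE /= in_itv/= => /andP[z0 zy].
by rewrite /= patchE mem_set //; apply/I01P; rewrite z0; lra.
Unshelve. all: by end_near. Qed.

(** The base point 1/2 stands for any interior point: the increments of the primitive will be known
    only between points of the open interval. *)
Lemma affine_ci_ae f (K : R) : int01 f -> (forall y, 0 < y < 1 -> ci f y = ci f (2^-1) + K * (y - 2^-1)) ->
  ae_eq mu I f (fun=> K).
Proof.
move=> fi fK; have := ci_der_ae fi; apply: filterS; first exact: (ae_filter_ringOfSetsType mu).
move=> x h /I01P x01.
have d1 := h x01.
have d2 : der (fun y => ci f (2^-1) + K * (y - 2^-1)) x K.
  apply: der_eq; first exact: derD (der_cst _ _) (derM (der_cst K x) (derB (der_id x) (der_cst _ _))).
  by rewrite /=; ring.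
have nE : {near x, ci f =1 fun y => ci f (2^-1) + K * (y - 2^-1)}.
  have /andP[x0 x1] := x01; near=> y; apply: fK.
  by apply/andP; split; near: y; [exact: lt_nbhsr|exact: lt_nbhsl].
have [_ <-] := der_derive1 (der_near nE d1).
by have [_ ->] := der_derive1 d2.
Unshelve. all: by end_near. Qed.

Lemma ci_eq0_ae f : int01 f -> (forall y, 0 < y < 1 -> ci f y = 0) -> ae_eq mu I f (fun=> 0).
Proof.
move=> fi f0; apply: affine_ci_ae => // y y01.
by rewrite !f0 // ?mul0r ?addr0 // invr_gt0 invf_lt1 // ltr1n ltr0n.
Qed.

Lemma ci_FTC (F f : R -> R) : cont_on 0 1 f -> cont_on 0 1 F ->
  (forall x, 0 < x < 1 -> der F x (f x)) ->
  forall y, 0 <= y <= 1 -> ci f y = F y - F 0.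
Proof.
move=> fc Fc Fd y y01; have fi := int01_cont fc.
have h : forall x, 0 <= x <= 1 -> ci f x - F x = ci f 0 - F 0.
  apply: (@der0_cst _ 0 1 (fun x => ci f x - F x)).
    move=> x x01; rewrite -(subrr (f x)); apply: derB (Fd x x01).
    by apply: ci_der => //; exact: cont_on_at x01.
  by apply: cont_onD; [exact: ci_cont|exact: cont_onN].
by have := h y y01; rewrite ci0; lra.
Qed.

Lemma mean01_FTC (F f : R -> R) : continuous f -> (forall x, der F x (f x)) ->
  mean01 f = F 1 - F 0.
Proof.
move=> fc Fd; have fc01 := @cont_on_continuous _ 0 1 _ fc.
rewrite mean01_ci; last exact: int01_cont.
apply: ci_FTC => //; last by rewrite ler01 lexx.
by apply: cont_on_continuous => x; exact: der_continuous (Fd x).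
Qed.

Lemma mean01_cst (k : R) : mean01 (fun=> k) = k.
Proof.
rewrite (@mean01_FTC (fun x => k * x) (fun=> k)) ?mulr1 ?mulr0 ?subr0 //.
  by move=> x; exact: cvg_cst.
by move=> x; apply: der_eq; [exact: derM (der_cst k x) (der_id x)|rewrite /=; ring].
Qed.

Lemma ci_norm_le f y : int01 f -> 0 <= y <= 1 -> `|ci f y| <= mean01 (fun x => `|f x|).
Proof.
move=> fi /andP[y0 y1]; apply: le_trans (le_normr_Rintegral _ _) _ => //.
  exact: int01_sub.
rewrite mean01_ci; last exact: int01_norm.
by apply: ci_le1 => //; exact: int01_norm.
Qed.

(* Continuous functions are dense in L^1, and the formula holds for them by
   the fundamental theorem of calculus. *)
Lemma ci_by_parts f (a a' : R -> R) : int01 f ->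
  (forall x, 0 <= x <= 1 -> der a x (a' x)) -> cont_on 0 1 a' ->
  forall y, 0 <= y <= 1 -> a y * ci f y = ci (fun t => a' t * ci f t + a t * f t) y.
Proof.
move=> fi ad a'c y y01; have ac : cont_on 0 1 a by exact: cont_on_der ad.
have [M M0 hM] := cont_on_bounded ler01 ac.
have [M' M'0 hM'] := cont_on_bounded ler01 a'c.
have [|g [gc gi glim]] := approximation_continuous_integrable measurable_I01 _ fi.
  exact: mu_I01_lty.
pose e n := mean01 (fun y => `|f y - g n y|).
have dgi n : int01 (fun y => f y - g n y) by apply: int01B => //; exact: gi.
have e_cvg : e n @[n --> \oo] --> (0 : R) by exact: (fine_cvg glim).
have mulC h k : int01 (fun t => h t * k t) -> int01 (fun t => k t * h t).
  by apply: int01_ext => x _; rewrite mulrC.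
have ri h : int01 h -> int01 (fun t => a' t * ci h t + a t * h t).
  move=> hi; apply: int01D; apply: mulC; apply: int01M_cont => //.
  by apply: int01_cont; exact: ci_cont.
pose X h := a y * ci h y - ci (fun t => a' t * ci h t + a t * h t) y.
have /andP[y0 y1] := y01.
have X_lin n : X f = X (g n) + X (fun t => f t - g n t).
  rewrite /X ciB //; last exact: gi.
  have -> : ci (fun t => a' t * ci f t + a t * f t) y =
      ci (fun t => a' t * ci (g n) t + a t * g n t) y +
      ci (fun t => a' t * ci (fun s => f s - g n s) t + a t * (f t - g n t)) y.
    rewrite -ciD //; [|by apply: ri; exact: gi|exact: ri].
    apply: ci_ext => t /andP[t0 ty]; rewrite ciB //; [by ring|exact: gi|lra].
  by ring.
have Xg n : X (g n) = 0.
  have gnc := @cont_on_continuous _ 0 1 _ (gc n).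
  have gcc : cont_on 0 1 (ci (g n)) by apply: ci_cont; exact: gi.
  apply/eqP; rewrite subr_eq0 eq_sym; apply/eqP.
  rewrite (@ci_FTC (fun t => a t * ci (g n) t)) ?ci0 ?mulr0 ?subr0 //.
  - by apply: cont_onD; exact: cont_onM.
  - exact: cont_onM.
  - move=> x x01; have /andP[x0 x1] := x01; apply: derM; first by apply: ad; lra.
    by apply: ci_der => //; [exact: gi|exact: gc].
have bound n : `|X f| <= (M + (M' + M)) * e n.
  rewrite (X_lin n) Xg add0r /X; set k := fun t => f t - g n t.
  have ki : int01 k by exact: dgi.
  have ke t : 0 <= t <= 1 -> `|ci k t| <= e n by exact: ci_norm_le.
  rewrite mulrDl; apply: le_trans (ler_normB _ _) _; apply: lerD.
    by rewrite normrM; apply: ler_pM => //; [exact: hM|exact: ke].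
  apply: le_trans (ci_norm_le (ri _ ki) y01) _.
  apply: (@le_trans _ _ (mean01 (fun x => M' * e n + M * `|k x|))).
    apply: mean01_le; first by apply: int01_norm; exact: ri.
      by apply: int01D; [exact: int01_cst|apply: int01Z; exact: int01_norm].
    move=> x /andP[/ltW x0 /ltW x1]; apply: le_trans (ler_normD _ _) _.
    have x01 : 0 <= x <= 1 by rewrite x0.
    rewrite !normrM; apply: lerD; last by rewrite ler_wpM2r // hM.
    by apply: ler_pM => //; [exact: hM'|exact: ke].
  have kni : int01 (fun x => `|k x|) by exact: int01_norm.
  rewrite mean01D ?mean01_cst ?mean01Z //; [|exact: int01_cst|exact: int01Z].
  by rewrite mulrDl.
apply/eqP; rewrite -subr_eq0 -normr_le0 -/(X f).
have cv : (M + (M' + M)) * e n @[n --> \oo] --> (0 : R).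
  by rewrite -(mulr0 (M + (M' + M))); apply: cvgM; [exact: cvg_cst|].
rewrite -(cvg_lim _ cv) //; apply: limr_ge; first by apply/cvg_ex; eexists; exact: cv.
by near=> n; exact: bound.
Unshelve. all: by end_near. Qed.

Lemma test_function_facts (phi : R -> R) : test_function phi ->
  [/\ forall x, der phi x (derive1 phi x), continuous (derive1 phi),
      continuous phi, phi 0 = 0 & phi 1 = 0].
Proof.
move=> [pd pc [a [b [a0 b1 p0]]]].
have pd' x : der phi x (derive1 phi x) by exact: derivable_der.
split => //.
- by move=> x; exact: der_continuous (pd' x).
- by apply: p0 => /andP[]; lra.
- by apply: p0 => /andP[]; lra.
Qed.

Lemma mean01_by_parts f phi : int01 f -> test_function phi ->
  mean01 (fun y => ci f y * derive1 phi y) = - mean01 (fun y => f y * phi y).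
Proof.
move=> fi /test_function_facts[pd pc' pc p0 p1].
have c' := @cont_on_continuous _ 0 1 _ pc'.
have c := @cont_on_continuous _ 0 1 _ pc.
have i1 : int01 (fun y => ci f y * derive1 phi y).
  by apply: int01M_cont => //; apply: int01_cont; exact: ci_cont.
have i2 : int01 (fun y => f y * phi y) by exact: int01M_cont.
have := ci_by_parts fi (fun x _ => pd x) c'; move=> /(_ 1); rewrite p1 mul0r ler01 lexx.
move=> /(_ isT)/esym h; apply/eqP; rewrite -addr_eq0 -mean01D //.
rewrite mean01_ci; last exact: int01D.
by rewrite -h; apply/eqP; apply: ci_ext => x _; ring.
Qed.

End integrals_on_the_unit_interval.

(** * The lemma of du Bois-Reymond *)

Section du_bois_reymond.
Context {R : realType}.
Local Notation mu := (@lebesgue_measure R).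
Local Notation I := (@I01 R).
Implicit Types (f g h : R -> R) (x y : R).

(** A continuous approximation of the indicator of (a, b), with ramps of slope n inside the
    interval. Being continuous, it can serve as the derivative of a C^1 test function once its mean
    is corrected. *)
Definition trapezoid (a b : R) (n : nat) x : R :=
  Num.max 0 (Num.min 1 (n%:R * Num.min (x - a) (b - x))).

Lemma trapezoid_cont a b n : continuous (trapezoid a b n).
Proof.
pose d x := Num.min (x - a) (b - x).
have dc : continuous d.
  move=> x; apply: (@cvg_min_real _ (fun x => x - a) (fun x => b - x)).
    by apply: cvgB; [exact: cvg_id|exact: cvg_cst].
  by apply: cvgB; [exact: cvg_cst|exact: cvg_id].
move=> x; apply: (@cvg_max_real _ (fun=> 0) (fun x => Num.min 1 (n%:R * d x))).
  exact: cvg_cst.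
apply: (@cvg_min_real _ (fun=> 1) (fun x => n%:R * d x)); first exact: cvg_cst.
by apply: cvgM; [exact: cvg_cst|exact: dc].
Qed.

Lemma trapezoid_bounds a b n x : 0 <= trapezoid a b n x <= 1.
Proof. by rewrite /trapezoid le_max lexx /= ge_max ler01 ge_min lexx. Qed.

Lemma trapezoid0 a b n x : ~ (a < x < b) -> trapezoid a b n x = 0.
Proof.
move=> xab; rewrite /trapezoid max_l // ge_min; apply/orP; right.
rewrite mulr_ge0_le0 // ge_min; apply/orP.
have [ax|xa] := ltP a x; last by left; lra.
by right; rewrite leNgt; apply/negP => bx; apply: xab; rewrite ax; lra.
Qed.

Lemma trapezoid_cvg a b x : a < x < b -> trapezoid a b n x @[n --> \oo] --> (1 : R).
Proof.
move=> /andP[ax xb]; apply: cvg_near_cst.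
set d := Num.min (x - a) (b - x).
have d0 : 0 < d by rewrite lt_min; apply/andP; split; lra.
near=> n; have nd : 1 <= n%:R * d.
  rewrite -ler_pdivrMr // mul1r; near: n.
  exact: nbhs_infty_ger.
by rewrite /trapezoid -/d min_l // max_r.
Unshelve. all: by end_near. Qed.

(** Dominated convergence with |f| as the dominating function. *)
Lemma trapezoid_mean_cvg f a b : 0 <= a -> a < b -> b <= 1 -> int01 f ->
  mean01 (fun x => f x * trapezoid a b n x) @[n --> \oo] --> ci f b - ci f a.
Proof.
move=> a0 ab b1 fi.
have tm n : measurable_fun I (trapezoid a b n).
  by apply: cont_on_measurable; apply: cont_on_continuous; exact: trapezoid_cont.
pose F : R -> R := f \_ `]a, b[.
have fm := int01_measurable fi.
have Fm : measurable_fun I F.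
  apply/measurable_restrict => //; first exact: measurable_I01.
  by apply: measurable_funS fm => [|x []]; first exact: measurable_I01.
have FE : mean01 F = ci f b - ci f a.
  rewrite /mean01 -Rintegral_mkcondr [RHS]Rintegral_itvB ?bnd_simp//; last first.
  - exact: ltW.
  - by apply: int01_sub.
  rewrite -Rintegral_itv_bndo_bndc; last first.
    apply: integrableS (int01_cc fi) => // x /=; rewrite !in_itv/= => /andP[? ?].
    by apply/andP; split; lra.
  congr Rintegral; apply/seteqP; split => x /=; rewrite /I01/= ?in_itv/=; first by case.
  by move=> /andP[? ?]; split; apply/andP; split; lra.
rewrite -FE.
have [] := @dominated_convergence _ (measurableTypeR R) R mu I measurable_I01
  (fun n x => (f x * trapezoid a b n x)%:E) (EFin \o F) (fun x => `|f x|%:E).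
- by move=> n; apply/measurable_EFinP; exact: (measurable_funM fm (tm n)).
- exact/measurable_EFinP.
- apply: aeW => x x01; apply: cvg_EFin; first by near=> n.
  rewrite /= /F patchE; case: ifPn => [|xab].
    rewrite inE/= in_itv/= => xab; rewrite -[X in _ --> X]mulr1.
    by apply: cvgM; [exact: cvg_cst|exact: trapezoid_cvg].
  rewrite (_ : point = 0 :> R) //; apply: cvg_near_cst; near=> n; rewrite /= trapezoid0 ?mulr0 // => xab2.
  by move: xab; rewrite notin_setE /= in_itv/= xab2.
- exact: int01_norm.
- apply: aeW => x n x01; rewrite lee_fin normrM ler_piMr //.
  by have /andP[t0 t1] := trapezoid_bounds a b n x; rewrite ger0_norm.
move=> Fi _ cv; apply: fine_cvg; rewrite fineK; first exact: cv.
exact: (integrable_fin_num measurable_I01 Fi).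
Unshelve. all: by end_near. Qed.

(* The antiderivative of a function of zero mean is a test function. *)
Lemma mean01_proportional f (eta eta0 : R -> R) (a b : R) : int01 f ->
  (forall phi, test_function phi -> mean01 (fun y => f y * derive1 phi y) = 0) ->
  0 < a -> a < b -> b < 1 -> continuous eta -> continuous eta0 ->
  (forall x, ~ (a < x < b) -> eta x = 0) -> (forall x, ~ (a < x < b) -> eta0 x = 0) ->
  mean01 eta0 * mean01 (fun y => f y * eta y) =
  mean01 eta * mean01 (fun y => f y * eta0 y).
Proof.
move=> fi f0 a0 ab b1 ec e0c ez e0z.
have [A [A0 Ad]] := antiderivative ec; have [B [B0 Bd]] := antiderivative e0c.
have AE : mean01 eta = A 1 by rewrite (mean01_FTC ec Ad) A0 subr0.
have BE : mean01 eta0 = B 1 by rewrite (mean01_FTC e0c Bd) B0 subr0.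
have side (F h : R -> R) : F 0 = 0 -> (forall x, der F x (h x)) ->
    (forall x, ~ (a < x < b) -> h x = 0) ->
    forall x, (x <= a -> F x = 0) /\ (b <= x -> F x = F 1).
  move=> F0 Fd hz x.
  have Fc u v : cont_on u v F by apply: cont_on_der => z _; exact: Fd.
  split=> hx.
    pose k := Num.min x 0.
    have kE z : k <= z <= a -> F z = F k.
      apply: der0_cst => // w /andP[_ wa]; rewrite -(hz w) //.
      by move=> /andP[]; lra.
    rewrite kE; last by rewrite hx ge_min lexx.
    by rewrite -(kE 0) // ge_min lexx orbT /=; lra.
  pose k := Num.max x 1.
  have kE z : b <= z <= k -> F z = F b.
    apply: der0_cst => // w /andP[wb _]; rewrite -(hz w) //.
    by move=> /andP[]; lra.
  by rewrite !kE // ?hx ?le_max ?lexx ?orbT ?andbT //; lra.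
(* To the right of (a, b) one has A = A(1) and B = B(1), to the left A = B = 0, so this combination
   vanishes on both sides. *)
pose phi x := B 1 * A x - A 1 * B x.
have phid x : der phi x (B 1 * eta x - A 1 * eta0 x).
  apply: der_eq.
    exact: derB (derM (der_cst (B 1) x) (Ad x)) (derM (der_cst (A 1) x) (Bd x)).
  by rewrite /=; ring.
have phi'E : derive1 phi = fun x => B 1 * eta x - A 1 * eta0 x.
  by apply/funext => x; case: (der_derive1 (phid x)).
have tphi : test_function phi.
  split.
  - by move=> x; case: (der_derive1 (phid x)).
  - rewrite phi'E => x.
    by apply: cvgB; apply: cvgM; by [exact: cvg_cst|exact: ec|exact: e0c].
  - exists a, b; split => // x xab; rewrite /phi.
    have [hA hA'] := side A eta A0 Ad ez x.
    have [hB hB'] := side B eta0 B0 Bd e0z x.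
    have [xa|ax] := leP x a; first by rewrite hA // hB // !mulr0 subrr.
    have [bx|xb] := leP b x; first by rewrite hA' // hB' // mulrC subrr.
    by exfalso; apply: xab; apply/andP; split; exact: ltW.
have := f0 _ tphi; rewrite phi'E AE BE => h.
have i1 : int01 (fun y => f y * eta y) by apply: int01M_cont => //; exact: cont_on_continuous.
have i2 : int01 (fun y => f y * eta0 y) by apply: int01M_cont => //; exact: cont_on_continuous.
apply/eqP; rewrite -subr_eq0 -!mean01Z // -mean01B; [|exact: int01Z|exact: int01Z].
by rewrite -h; apply/eqP; apply: mean01_ext => x _; ring.
Qed.

(** Testing against trapezoids and passing to the limit shows that increments of the primitive are
    proportional to the length of the interval. The primitive is thus affine, and [f] is constant
    almost everywhere. *)
Lemma du_bois_reymond f : int01 f ->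
  (forall phi, test_function phi -> mean01 (fun y => f y * derive1 phi y) = 0) ->
  exists K : R, ae_eq mu I f (fun=> K).
Proof.
move=> fi f0; pose eta0 := trapezoid (4^-1) (3 / 4) 1.
have e0c : continuous eta0 by exact: trapezoid_cont.
have m0 : 0 < mean01 eta0.
  have [B [B0 Bd]] := antiderivative e0c.
  rewrite (mean01_FTC e0c Bd) subr_gt0.
  have Bc u v : cont_on u v B by apply: cont_on_der => z _; exact: Bd.
  have e0 x : 0 <= eta0 x by case/andP : (trapezoid_bounds (4^-1) (3/4) 1 x).
  apply: (@le_lt_trans _ _ (B 4^-1)).
    by apply: (der_ge0_le _ (fun x _ => Bd x)) => //; lra.
  apply: (@lt_le_trans _ _ (B (3 / 4))); last first.
    by apply: (der_ge0_le _ (fun x _ => Bd x)) => //; lra.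
  apply: (der_gt0_lt _ (fun x _ => Bd x)) => //; first by lra.
  move=> x /andP[x1 x2]; rewrite /eta0 /trapezoid lt_max !lt_min ltr01 mul1r lt_min.
  by apply/orP; right; apply/andP; split => //; apply/andP; split; lra.
(* The value that [mean01_proportional] forces: the average of [f] against the fixed reference bump
   [eta0], which is supported in [1/4, 3/4]. *)
pose K := mean01 (fun y => f y * eta0 y) / mean01 eta0; exists K.
have key a b : 0 < a -> a < b -> b < 1 -> ci f b - ci f a = K * (b - a).
  move=> a0 ab b1.
  have cf := trapezoid_mean_cvg (ltW a0) ab (ltW b1) fi.
  have c1 := trapezoid_mean_cvg (ltW a0) ab (ltW b1) (int01_cst 1).
  have ci1 y : 0 <= y <= 1 -> ci (fun=> 1) y = y.
    move=> y01; rewrite (@ci_FTC _ (fun x => x)) ?subr0 //.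
    - by apply: cont_on_continuous => x; exact: cvg_cst.
    - by apply: cont_on_continuous => x; exact: cvg_id.
    - by move=> x _; exact: der_id.
  have e n : mean01 (fun x => f x * trapezoid a b n x) =
             mean01 (fun x => 1 * trapezoid a b n x) * K.
    (* A single compact interval in (0, 1) has to contain the supports of both the trapezoid and
       [eta0]; hence the minimum with 1/4 and the maximum with 3/4. *)
    have := @mean01_proportional f (trapezoid a b n) eta0
      (Num.min a 4^-1) (Num.max b (3 / 4)) fi f0.
    have -> : (fun x => 1 * trapezoid a b n x) = trapezoid a b n.
      by apply/funext => x; rewrite mul1r.
    move=> h; rewrite /K mulrA -h; first by field; rewrite gt_eqF.
    - by rewrite lt_min a0; lra.
    - by rewrite gt_min; apply/orP; left; rewrite lt_max ab.
    - by rewrite gt_max b1; lra.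
    - exact: trapezoid_cont.
    - exact: trapezoid_cont.
    - move=> x xab; apply: trapezoid0 => /andP[ax xb]; apply: xab.
      by rewrite gt_min ax lt_max xb.
    - move=> x xab; apply: trapezoid0 => /andP[ax xb]; apply: xab.
      by rewrite gt_min ax orbT lt_max xb orbT.
  have : mean01 (fun x => f x * trapezoid a b n x) @[n --> \oo] --> (b - a) * K.
    under eq_cvg do rewrite e.
    apply: cvgM; last exact: cvg_cst.
    by move: c1; rewrite !ci1 //; lra.
  by move=> c2; rewrite mulrC; exact: (cvg_unique (@Rhausdorff R) cf c2).
apply: affine_ci_ae => // y /andP[y0 y1].
have [yh|hy|->] := ltgtP y (2^-1); last by rewrite subrr mulr0 addr0.
- by have := key y 2^-1 y0 yh; lra.
- by have := key 2^-1 y _ hy y1; lra.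
Qed.

End du_bois_reymond.

(** * Square integrable functions and weak derivatives *)

Section weak_derivatives.
Context {R : realType}.
Local Notation C := R[i].
Local Notation mu := (@lebesgue_measure R).
Local Notation I := (@I01 R).
Implicit Types (f g h : R -> C) (x y : R).

Definition ae01 (P : R -> Prop) := {ae mu, forall x, I x -> P x}.

Lemma ae01_all (P : R -> Prop) : (forall x, 0 < x < 1 -> P x) -> ae01 P.
Proof. by move=> hP; apply: aeW => x /I01P; exact: hP. Qed.

Lemma ae01_imp (P Q : R -> Prop) : ae01 P -> (forall x, 0 < x < 1 -> P x -> Q x) -> ae01 Q.
Proof.
rewrite /ae01 => aP PQ; apply: (@filterS _ _ (ae_filter_ringOfSetsType mu) _ _ _ aP) => x h Ix.
by apply: PQ; [exact/I01P|exact: h].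
Qed.

Lemma ae01_imp2 (P Q S : R -> Prop) : ae01 P -> ae01 Q ->
  (forall x, 0 < x < 1 -> P x -> Q x -> S x) -> ae01 S.
Proof.
rewrite /ae01 => aP aQ PQ; apply: (@filterS2 _ _ (ae_filter_ringOfSetsType mu) _ _ _ _ aP aQ) => x h h' Ix.
by apply: PQ; [exact/I01P|exact: h|exact: h'].
Qed.

Lemma ae01_imp3 (P Q S T : R -> Prop) : ae01 P -> ae01 Q -> ae01 S ->
  (forall x, 0 < x < 1 -> P x -> Q x -> S x -> T x) -> ae01 T.
Proof.
move=> aP aQ aS PQ; apply: (ae01_imp2 (ae01_imp2 aP aQ (fun x _ p q => conj p q)) aS).
by move=> x x01 []; exact: PQ.
Qed.

Definition cint01 f := int01 (fun y => Re (f y)) /\ int01 (fun y => Im (f y)).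

Definition cci f y : C := ci (fun t => Re (f t)) y +i* ci (fun t => Im (f t)) y.

Lemma ccont_measurable f : ccont_on 0 1 f ->
  measurable_fun I (fun y => Re (f y)) /\ measurable_fun I (fun y => Im (f y)).
Proof. by move=> [? ?]; split; apply: cont_on_measurable. Qed.

Lemma measurable_ReM f g :
  measurable_fun I (fun y => Re (f y)) -> measurable_fun I (fun y => Im (f y)) ->
  measurable_fun I (fun y => Re (g y)) -> measurable_fun I (fun y => Im (g y)) ->
  measurable_fun I (fun y => Re (f y * g y)) /\
  measurable_fun I (fun y => Im (f y * g y)).
Proof.
move=> f1 f2 g1 g2; split.
  have -> : (fun y => Re (f y * g y)) = fun y => Re (f y) * Re (g y) -
    Im (f y) * Im (g y) by apply/funext => y; exact: cReM.
  exact: measurable_funB (measurable_funM f1 g1) (measurable_funM f2 g2).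
have -> : (fun y => Im (f y * g y)) = fun y => Re (f y) * Im (g y) +
  Im (f y) * Re (g y) by apply/funext => y; exact: cImM.
exact: measurable_funD (measurable_funM f1 g2) (measurable_funM f2 g1).
Qed.

Lemma measurable_sqn f :
  measurable_fun I (fun y => Re (f y)) -> measurable_fun I (fun y => Im (f y)) ->
  measurable_fun I (fun y => sqn (f y)).
Proof.
move=> f1 f2.
have -> : (fun y => sqn (f y)) = fun y => Re (f y) * Re (f y) +
  Im (f y) * Im (f y) by apply/funext => y; rewrite /sqn; ring.
exact: measurable_funD (measurable_funM f1 f1) (measurable_funM f2 f2).
Qed.

Lemma L2_intro f (g : R -> R) :
  measurable_fun I (fun y => Re (f y)) -> measurable_fun I (fun y => Im (f y)) ->
  int01 g -> (forall x, 0 < x < 1 -> sqn (f x) <= g x) -> L2 (f : cfun R).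
Proof.
move=> f1 f2 gi fg; split => //; apply: (int01_le (measurable_sqn f1 f2) _ gi) => x x01.
by rewrite ger0_norm ?sqn_ge0 //; apply: le_trans (fg x x01) (ler_norm _).
Qed.

Lemma L2D f g : L2 (f : cfun R) -> L2 (g : cfun R) -> L2 ((fun y => f y + g y) : cfun R).
Proof.
move=> [f1 f2 f3] [g1 g2 g3].
apply: (@L2_intro _ (fun y => 2 * sqn (f y) + 2 * sqn (g y))).
- have -> : (fun y => Re (f y + g y)) = fun y => Re (f y) + Re (g y).
    by apply/funext => y; exact: cReD.
  exact: measurable_funD.
- have -> : (fun y => Im (f y + g y)) = fun y => Im (f y) + Im (g y).
    by apply/funext => y; exact: cImD.
  exact: measurable_funD.
- by apply: int01D; apply: int01Z.
- by move=> x _; exact: sqnD_le.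
Qed.

Lemma L2M_bounded f g (M : R) :
  measurable_fun I (fun y => Re (g y)) -> measurable_fun I (fun y => Im (g y)) ->
  (forall x, 0 < x < 1 -> sqn (g x) <= M) ->
  L2 (f : cfun R) -> L2 ((fun y => f y * g y) : cfun R).
Proof.
move=> g1 g2 gM [f1 f2 f3]; have [m1 m2] := measurable_ReM f1 f2 g1 g2.
apply: (@L2_intro _ (fun y => M * sqn (f y))) => //; first exact: int01Z.
by move=> x x01; rewrite sqnM mulrC ler_wpM2r ?sqn_ge0 // gM.
Qed.

Lemma L2M_cont f g : ccont_on 0 1 g -> L2 (f : cfun R) -> L2 ((fun y => f y * g y) : cfun R).
Proof.
move=> gc; have [m1 m2] := ccont_measurable gc; have [c1 c2] := gc.
have [M M0 hM] := cont_on_bounded ler01 c1.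
have [M' M'0 hM'] := cont_on_bounded ler01 c2.
apply: (@L2M_bounded _ _ (M ^+ 2 + M' ^+ 2)) => // x /andP[/ltW x0 /ltW x1].
by apply: lerD; rewrite -real_normK ?num_real // lerXn2r ?nnegrE // ?hM ?hM' // x0.
Qed.

Lemma L2_cst (z : C) : L2 ((fun=> z) : cfun R).
Proof.
apply: (@L2_intro _ (fun=> sqn z)) => //; exact: int01_cst.
Qed.

Lemma ccont_cst a b (z : C) : ccont_on a b (fun=> z).
Proof. by split; apply: cont_on_continuous => x; exact: cvg_cst. Qed.

Lemma L2_cont f : ccont_on 0 1 f -> L2 (f : cfun R).
Proof.
move=> fc; rewrite (_ : f = fun y => 1 * f y); last by apply/funext => y; rewrite mul1r.
by apply: L2M_cont => //; exact: L2_cst.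
Qed.

Lemma L2Z (z : C) f : L2 (f : cfun R) -> L2 ((fun y => z * f y) : cfun R).
Proof.
move=> fL; rewrite (_ : (fun y => _) = fun y => f y * z); last by apply/funext => y; rewrite mulrC.
by apply: (L2M_cont (ccont_cst _ _ z)).
Qed.

Lemma L2N f : L2 (f : cfun R) -> L2 ((fun y => - f y) : cfun R).
Proof.
move=> /(L2Z (- 1)); congr L2; by apply/funext => y; rewrite mulN1r.
Qed.

Lemma L2B f g : L2 (f : cfun R) -> L2 (g : cfun R) -> L2 ((fun y => f y - g y) : cfun R).
Proof. by move=> fL gL; apply: L2D => //; exact: L2N. Qed.

(** Bounds a square integrable function by an integrable one, which gives the inclusion of L^2(0, 1)
    in L^1(0, 1). *)
Lemma le_sqr_half (x : R) : `|x| <= 1 + x ^+ 2.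
Proof.
have := sqr_ge0 (`|x| - 2^-1); rewrite sqrrB real_normK ?num_real //.
have -> : `|x| * 2^-1 *+ 2 = `|x| by rewrite -mulr_natr; field.
have -> : (2^-1 : R) ^+ 2 = 4^-1 by field.
by lra.
Qed.

Lemma L2_cint01 f : L2 (f : cfun R) -> cint01 f.
Proof.
move=> [f1 f2 f3]; have fi : int01 (fun y => 1 + sqn (f y)) by apply: int01D => //; exact: int01_cst.
have nn x : `|1 + sqn (f x)| = 1 + sqn (f x) by rewrite ger0_norm // addr_ge0 ?sqn_ge0.
split; apply: (int01_le _ _ fi) => // x _; rewrite nn; apply: le_trans (le_sqr_half _) _;
  by rewrite lerD2l /sqn ?lerDl ?lerDr sqr_ge0.
Qed.

Lemma cint01_cont f : ccont_on 0 1 f -> cint01 f.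
Proof. by move=> /L2_cont/L2_cint01. Qed.

Lemma cint01D f g : cint01 f -> cint01 g -> cint01 (fun y => f y + g y).
Proof.
move=> [f1 f2] [g1 g2]; split.
  by apply: int01_ext (int01D f1 g1) => x _; rewrite cReD.
by apply: int01_ext (int01D f2 g2) => x _; rewrite cImD.
Qed.

Lemma cint01N f : cint01 f -> cint01 (fun y => - f y).
Proof.
move=> [f1 f2]; split.
  by apply: int01_ext (int01N f1) => x _; rewrite cReN.
by apply: int01_ext (int01N f2) => x _; rewrite cImN.
Qed.

Lemma cci0 f : cci f 0 = 0.
Proof. by rewrite /cci !ci0. Qed.

Lemma cciD f g y : cint01 f -> cint01 g -> y <= 1 ->
  cci (fun t => f t + g t) y = cci f y + cci g y.
Proof.
move=> [f1 f2] [g1 g2] y1; apply: complexP; rewrite /= -ciD //.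
  by apply: ci_ext => x _; rewrite cReD.
by apply: ci_ext => x _; rewrite cImD.
Qed.

Lemma cciN f y : cint01 f -> y <= 1 -> cci (fun t => - f t) y = - cci f y.
Proof.
move=> [f1 f2] y1; apply: complexP; rewrite /= -ciN //.
  by apply: ci_ext => x _; rewrite cReN.
by apply: ci_ext => x _; rewrite cImN.
Qed.

Lemma cciZ (z : C) f y : cint01 f -> y <= 1 -> cci (fun t => z * f t) y = z * cci f y.
Proof.
move=> [f1 f2] y1; apply: complexP; rewrite /= ?cReM ?cImM /= -!ciZ // -?ciB -?ciD //;
  try exact: int01Z.
  by apply: ci_ext => x _; rewrite cReM.
by apply: ci_ext => x _; rewrite cImM.
Qed.

Lemma cci_ext f g y : (forall x, 0 <= x <= y -> f x = g x) -> cci f y = cci g y.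
Proof. by move=> fg; rewrite /cci; congr (_ +i* _); apply: ci_ext => x /fg ->. Qed.

Lemma cci_ae f g y : cint01 f -> cint01 g -> ae_eq mu I f g -> y <= 1 -> cci f y = cci g y.
Proof.
move=> [f1 f2] [g1 g2] fg y1; rewrite /cci; congr (_ +i* _); apply: ci_ae => //.
  by apply: ae01_imp fg _ => x _ ->.
by apply: ae01_imp fg _ => x _ ->.
Qed.

Lemma cci_cont f : cint01 f -> ccont_on 0 1 (cci f).
Proof. by move=> [f1 f2]; split; exact: ci_cont. Qed.

Lemma cci_der f x : cint01 f -> 0 < x < 1 -> ccont_at x f -> cder (cci f) x (f x).
Proof. by move=> [f1 f2] x01 [c1 c2]; split; apply: (ci_der _ x01). Qed.

Lemma ccont_on_at f a b x : ccont_on a b f -> a < x < b -> ccont_at x f.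
Proof. by move=> [c1 c2] xab; split; apply: cont_on_at xab. Qed.

(** The primitive of [h] vanishes, hence so does [h] inside. Continuity carries this to 0 and 1,
    where boundary conditions are read off. *)
Lemma ae_eq_cont_on (h : R -> R) : cont_on 0 1 h -> ae01 (fun x => h x = 0) ->
  forall x, 0 <= x <= 1 -> h x = 0.
Proof.
move=> hc h0; have hi := int01_cont hc.
have hin x : 0 < x < 1 -> h x = 0.
  move=> x01; have d1 := ci_der hi x01 (cont_on_at hc x01).
  have nE : {near x, ci h =1 fun=> 0}.
    have /andP[x0 x1] := x01; near=> y.
    rewrite (ci_ae hi (int01_cst 0) h0).
      have cF := @cont_on_cst R 0 1 0.
      rewrite (ci_FTC cF cF (fun z _ => der_cst 0 z)) ?subrr //.
      by apply/andP; split; apply: ltW; near: y; [exact: lt_nbhsr|exact: lt_nbhsl].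
    by apply: ltW; near: y; exact: lt_nbhsl.
  have [_ <-] := der_derive1 (der_near nE d1).
  by have [_ ->] := der_derive1 (der_cst 0 x).
have hcst x : 0 <= x <= 1 -> h x = h 0.
  apply: der0_cst => // z z01; apply: (@der_near _ (fun=> 0)); last exact: der_cst.
  by have /andP[z0 z1] := z01; near=> y; apply/esym/hin; apply/andP; split;
    near: y; [exact: lt_nbhsr|exact: lt_nbhsl].
by move=> x x01; rewrite hcst // -(hcst 2^-1) ?hin //; lra.
Unshelve. all: by end_near. Qed.

Lemma ae_eq_ccont f g : ccont_on 0 1 f -> ccont_on 0 1 g -> ae_eq mu I f g ->
  forall x, 0 <= x <= 1 -> f x = g x.
Proof.
move=> [f1 f2] [g1 g2] fg x x01; apply/eqP; rewrite -subr_eq0; apply/eqP.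
apply: complexP => /=; rewrite ?cReD ?cReN ?cImD ?cImN.
  apply: (@ae_eq_cont_on (fun x => Re (f x) - Re (g x))) => //.
    by apply: cont_onD => //; exact: cont_onN.
  by apply: ae01_imp fg _ => z _ ->; rewrite subrr.
apply: (@ae_eq_cont_on (fun x => Im (f x) - Im (g x))) => //.
  by apply: cont_onD => //; exact: cont_onN.
by apply: ae01_imp fg _ => z _ ->; rewrite subrr.
Qed.

Lemma Cintegral_real f (h : R -> R) : Cintegral ((fun y => f y * (h y)%:C) : cfun R) =
  mean01 (fun y => Re (f y) * h y) +i* mean01 (fun y => Im (f y) * h y).
Proof.
rewrite /Cintegral; congr (_ +i* _); apply: mean01_ext => x _.
  by rewrite cReM /= mulr0 subr0.
by rewrite cImM /= mulr0 add0r.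
Qed.

Lemma weak_derivativeP f g : weak_derivative (f : cfun R) (g : cfun R) <->
  forall phi, test_function phi ->
   mean01 (fun y => Re (f y) * derive1 phi y) =
     - mean01 (fun y => Re (g y) * phi y) /\
   mean01 (fun y => Im (f y) * derive1 phi y) =
     - mean01 (fun y => Im (g y) * phi y).
Proof.
split=> h phi tphi.
  by have := h phi tphi; rewrite !Cintegral_real => -[].
by rewrite !Cintegral_real; have [-> ->] := h phi tphi.
Qed.

Lemma test_mean0 (phi : R -> R) (K : R) : test_function phi ->
  mean01 (fun y => K * derive1 phi y) = 0.
Proof.
move=> /test_function_facts[pd pc _ p0 p1].
rewrite mean01Z ?(mean01_FTC pc pd) ?p0 ?p1 ?subrr ?mulr0 //.
by apply: int01_cont; exact: cont_on_continuous.
Qed.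

Lemma test_cont (phi : R -> R) : test_function phi ->
  cont_on 0 1 (derive1 phi) /\ cont_on 0 1 phi.
Proof.
by move=> /test_function_facts[_ ? ? _ _]; split; exact: cont_on_continuous.
Qed.

Lemma weak_derivative_primitive (K : C) g : cint01 g ->
  weak_derivative ((fun y => K + cci g y) : cfun R) (g : cfun R).
Proof.
move=> [g1 g2]; apply/weak_derivativeP => phi tphi.
have [pc' pc] := test_cont tphi.
have main (k : R) (h : R -> R) : int01 h -> mean01 (fun y => (k + ci h y) * derive1 phi y) =
    - mean01 (fun y => h y * phi y).
  move=> hi; rewrite -mean01_by_parts // -[RHS]add0r -(test_mean0 k tphi) -mean01D.
  - by apply: mean01_ext => y _; ring.
  - by apply: int01Z; exact: int01_cont.
  - by apply: int01M_cont => //; apply: int01_cont; exact: ci_cont.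
by split; [rewrite -(main (Re K) _ g1)|rewrite -(main (Im K) _ g2)];
  apply: mean01_ext => y _; rewrite ?cReD ?cImD.
Qed.

Lemma weak_derivative_ae f f' g g' : cint01 f -> cint01 f' -> cint01 g -> cint01 g' ->
  ae_eq mu I f f' -> ae_eq mu I g g' ->
  weak_derivative (f : cfun R) (g : cfun R) -> weak_derivative (f' : cfun R) (g' : cfun R).
Proof.
move=> [f1 f2] [f1' f2'] [g1 g2] [g1' g2'] ff gg /weak_derivativeP h.
apply/weak_derivativeP => phi tphi; have [pc' pc] := test_cont tphi.
have main (u u' v v' : R -> R) : int01 u -> int01 u' -> int01 v -> int01 v' ->
    ae_eq mu I u u' -> ae_eq mu I v v' ->
    mean01 (fun y => u y * derive1 phi y) = - mean01 (fun y => v y * phi y) ->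
    mean01 (fun y => u' y * derive1 phi y) = - mean01 (fun y => v' y * phi y).
  move=> ui ui' vi vi' uu vv uv.
  rewrite -(@ae_eq_mean01 _ (fun y => u y * derive1 phi y)); first rewrite uv.
  - congr (- _); apply: ae_eq_mean01; try exact: int01M_cont.
    by apply: ae01_imp vv _ => x _ ->.
  - exact: int01M_cont.
  - exact: int01M_cont.
  - by apply: ae01_imp uu _ => x _ ->.
have [h1 h2] := h phi tphi.
by split; [apply: main h1|apply: main h2] => //; [apply: ae01_imp ff _|apply: ae01_imp gg _|
  apply: ae01_imp ff _|apply: ae01_imp gg _] => x _ ->.
Qed.

(** [f] minus the primitive of [g] has weak derivative 0, so du Bois-Reymond's lemma applies to its
    real and imaginary parts. *)
Lemma weak_derivative_repr f g : cint01 f -> cint01 g ->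
  weak_derivative (f : cfun R) (g : cfun R) ->
  exists K : C, ae_eq mu I f (fun y => K + cci g y).
Proof.
move=> [f1 f2] [g1 g2] /weak_derivativeP h.
have aux (u v : R -> R) : int01 u -> int01 v ->
    (forall phi, test_function phi ->
      mean01 (fun y => u y * derive1 phi y) = - mean01 (fun y => v y * phi y)) ->
    exists K : R, ae01 (fun y => u y = K + ci v y).
  move=> ui vi uv; have ci_i : int01 (ci v) by apply: int01_cont; exact: ci_cont.
  have [||K hK] := @du_bois_reymond _ (fun y => u y - ci v y); first exact: int01B.
    move=> phi tphi; have [pc' pc] := test_cont tphi.
    rewrite (@mean01_ext _ _ (fun y => u y * derive1 phi y - ci v y * derive1 phi y)).
      by rewrite mean01B ?uv ?mean01_by_parts ?subrr //; exact: int01M_cont.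
    by move=> x _; rewrite mulrBl.
  by exists K; apply: ae01_imp hK _ => x _ <-; rewrite subrK.
have [K1 h1] := aux _ _ f1 g1 (fun phi t => (h phi t).1).
have [K2 h2] := aux _ _ f2 g2 (fun phi t => (h phi t).2).
exists (K1 +i* K2); apply: ae01_imp2 h1 h2 _ => x _ e1 e2.
by apply: complexP; rewrite ?cReD ?cImD.
Qed.

(** Both primitives represent [f], so they agree everywhere by continuity; the primitive of g - g'
    vanishes and is differentiated almost everywhere. *)
Lemma weak_derivative_unique f g g' : cint01 f -> cint01 g -> cint01 g' ->
  weak_derivative (f : cfun R) (g : cfun R) -> weak_derivative (f : cfun R) (g' : cfun R) ->
  ae_eq mu I g g'.
Proof.
move=> fi gi gi' /(weak_derivative_repr fi gi)[K hK] /(weak_derivative_repr fi gi')[K' hK'].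
have cK h z : cint01 h -> ccont_on 0 1 (fun y => z + cci h y).
  by move=> hi; apply: ccont_onD; [exact: ccont_cst|exact: cci_cont].
have E y : 0 <= y <= 1 -> K + cci g y = K' + cci g' y.
  apply: (@ae_eq_ccont (fun y => K + cci g y) (fun y => K' + cci g' y)); [exact: cK|exact: cK|].
  by apply: ae01_imp2 hK hK' _ => x _ <-.
have KK : K = K' by have := E 0; rewrite !cci0 !addr0 => -> //; rewrite lexx ler01.
have {}E y : 0 < y < 1 -> cci g y = cci g' y.
  move=> /andP[y0 y1]; have := E y; rewrite KK => h; apply: (addrI K'); apply: h.
  by rewrite !ltW.
have [g1 g2] := gi; have [g1' g2'] := gi'.
have main (u v : R -> R) : int01 u -> int01 v -> (forall y, 0 < y < 1 -> ci u y = ci v y) ->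
    ae01 (fun y => u y = v y).
  move=> ui vi uv; have := @ci_eq0_ae _ (fun y => u y - v y) (int01B ui vi) _.
  move=> h; apply: ae01_imp (h _) _ => [y y01|y _ /eqP]; last by rewrite subr_eq0 => /eqP.
  by have /andP[_ /ltW y1] := y01; rewrite ciB // uv // subrr.
apply: ae01_imp2 (main _ _ g1 g1' _) (main _ _ g2 g2' _) _ => [y y01|y y01|x _ e1 e2].
- by have /(congr1 (@complex.Re R)) := E y y01.
- by have /(congr1 (@complex.Im R)) := E y y01.
- exact: complexP.
Qed.

End weak_derivatives.

(** * Second weak derivatives under Dirichlet conditions *)

Section second_order.
Context {R : realType}.
Local Notation C := R[i].
Local Notation mu := (@lebesgue_measure R).
Local Notation I := (@I01 R).
Implicit Types (f g h u v p r q : R -> C) (x y : R).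

Lemma cder_near f g x d : (\forall y \near x, f y = g y) -> cder f x d -> cder g x d.
Proof.
move=> fg [d1 d2]; split.
  by apply: der_near d1; near=> y; congr Re; near: y.
by apply: der_near d2; near=> y; congr Im; near: y.
Unshelve. all: by end_near. Qed.

Lemma near_open01 (a b x : R) (P : R -> Prop) : a < x < b ->
  (forall y, a < y < b -> P y) -> \forall y \near x, P y.
Proof.
move=> /andP[ax xb] hP; near=> y; apply: hP; apply/andP; split; near: y.
  exact: lt_nbhsr.
exact: lt_nbhsl.
Unshelve. all: by end_near. Qed.

Lemma ccont_on_ext a b f g : (forall x, a <= x <= b -> f x = g x) ->
  ccont_on a b f -> ccont_on a b g.
Proof.
by move=> fg [c1 c2]; split; [apply: cont_on_ext c1|apply: cont_on_ext c2] => x /fg ->.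
Qed.

Lemma cci_FTC (F f : R -> C) : ccont_on 0 1 f -> (forall x, 0 <= x <= 1 -> cder F x (f x)) ->
  forall y, 0 <= y <= 1 -> cci f y = F y - F 0.
Proof.
move=> [c1 c2] Fd y y01; have [F1 F2] := ccont_on_cder Fd.
apply: complexP; rewrite ?cReD ?cImD ?cReN ?cImN /=.
  apply: (@ci_FTC _ (fun y => Re (F y))) => // x /andP[/ltW x0 /ltW x1].
  by case: (Fd x); rewrite ?x0.
apply: (@ci_FTC _ (fun y => Im (F y))) => // x /andP[/ltW x0 /ltW x1].
by case: (Fd x); rewrite ?x0.
Qed.

Lemma cint01M_cont f g : ccont_on 0 1 g -> cint01 f -> cint01 (fun y => g y * f y).
Proof.
move=> [g1 g2] [f1 f2]; split.
  apply: (@int01_ext _ (fun y => Re (f y) * Re (g y) -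
      Im (f y) * Im (g y))); first by move=> x _; rewrite cReM; ring.
  by apply: int01B; exact: int01M_cont.
apply: (@int01_ext _ (fun y => Im (f y) * Re (g y) +
    Re (f y) * Im (g y))); first by move=> x _; rewrite cImM; ring.
by apply: int01D; exact: int01M_cont.
Qed.

Lemma cci_by_parts f (a a' : R -> C) : cint01 f ->
  (forall x, 0 <= x <= 1 -> cder a x (a' x)) -> ccont_on 0 1 a' ->
  forall y, 0 <= y <= 1 -> a y * cci f y = cci (fun t => a' t * cci f t + a t * f t) y.
Proof.
move=> [f1 f2] ad [a1 a2] y y01; have /andP[y0 y1] := y01.
have d1 x : 0 <= x <= 1 -> der (fun t => Re (a t)) x (Re (a' x)) by case/ad.
have d2 x : 0 <= x <= 1 -> der (fun t => Im (a t)) x (Im (a' x)) by case/ad.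
have ri (h : R -> R) (b b' : R -> R) : int01 h -> cont_on 0 1 b' ->
    (forall x, 0 <= x <= 1 -> der b x (b' x)) -> int01 (fun t => b' t * ci h t + b t * h t).
  move=> hi b'c bd; have bc : cont_on 0 1 b by exact: cont_on_der bd.
  apply: int01D.
    apply: (@int01_ext _ (fun t => ci h t * b' t)); first by move=> x _; rewrite mulrC.
    by apply: int01M_cont => //; apply: int01_cont; exact: ci_cont.
  apply: (@int01_ext _ (fun t => h t * b t)); first by move=> x _; rewrite mulrC.
  exact: int01M_cont.
apply: complexP; rewrite ?cReM ?cImM /=.
  rewrite (ci_by_parts f1 d1 a1 y01) (ci_by_parts f2 d2 a2 y01) -ciB //; try exact: ri.
  by apply: ci_ext => t _; rewrite cReD !cReM /=; ring.
rewrite (ci_by_parts f2 d1 a1 y01) (ci_by_parts f1 d2 a2 y01) -ciD //; try exact: ri.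
by apply: ci_ext => t _; rewrite cImD !cImM /=; ring.
Qed.

Definition D2 (f : cfun R) : cfun R := wderiv (wderiv f).

Lemma H1_wderiv (f : cfun R) : H1 f -> L2 (wderiv f) /\ weak_derivative f (wderiv f).
Proof.
move=> [_ [g hg]]; rewrite /wderiv.
by case: xgetP => [h _ //|/(_ g)[]].
Qed.

Lemma wderiv_ae (f g : cfun R) : L2 f -> L2 g -> weak_derivative f g ->
  ae_eq mu I (wderiv f) g.
Proof.
move=> fL gL fg; have [] := @H1_wderiv f; first by split => //; exists g.
move=> wL fw.
by apply: (@weak_derivative_unique _ f) => //; exact: L2_cint01.
Qed.

Lemma ae_refl f : ae_eq mu I f f.
Proof. exact: ae01_all. Qed.

Lemma ae_sym f g : ae_eq mu I f g -> ae_eq mu I g f.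
Proof. by move=> h; apply: ae01_imp h _ => x _ ->. Qed.

(** [H2] provides some chain of derivatives, whereas [wderiv] picks its own; uniqueness almost
    everywhere transfers the property to the chosen ones. *)
Lemma H2_wderiv (f : cfun R) : H2 f ->
  [/\ L2 (wderiv f), weak_derivative f (wderiv f), L2 (D2 f) &
      weak_derivative (wderiv f) (D2 f)].
Proof.
move=> [fL [g [[gL [k [kL gk]]] fg]]].
have [wL fw] : L2 (wderiv f) /\ weak_derivative f (wderiv f).
  by apply: H1_wderiv; split => //; exists g.
have wk : weak_derivative (wderiv f) k.
  apply: weak_derivative_ae gk; try exact: L2_cint01.
    by apply: ae_sym; exact: wderiv_ae.
  exact: ae_refl.
have [D2L wD2] : L2 (D2 f) /\ weak_derivative (wderiv f) (D2 f).
  by apply: H1_wderiv; split => //; exists k.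
by split.
Qed.

(** Trades weak derivatives for integral equations valid at every point, with a continuous first
    derivative [p]. The condition f(0) = 0 removes the constant of integration. *)
Lemma H2_dirichlet_repr (f : cfun R) : H2_dirichlet f -> L2 (D2 f) /\
  exists p, [/\ ccont_on 0 1 p, (forall y, 0 <= y <= 1 -> f y = cci p y) &
    forall y, 0 <= y <= 1 -> p y = p 0 + cci (D2 f) y].
Proof.
move=> [fH c1 c2 f0 f1]; have [wL fw DL wD] := H2_wderiv fH; split => //.
have fL := fH.1; have Di := L2_cint01 DL; have wi := L2_cint01 wL.
have [K hK] := weak_derivative_repr wi Di wD.
have [K1 hK1] := weak_derivative_repr (L2_cint01 fL) wi fw.
pose p y := K + cci (D2 f) y.
have pc : ccont_on 0 1 p by apply: ccont_onD; [exact: ccont_cst|exact: cci_cont].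
have pi := cint01_cont pc.
exists p; split => //; last by move=> y _; rewrite /p cci0 addr0.
have E : forall y, 0 <= y <= 1 -> (f y : C) = K1 + cci p y.
  apply: (@ae_eq_ccont _ f (fun y => K1 + cci p y)) => //.
    by apply: ccont_onD; [exact: ccont_cst|exact: cci_cont].
  apply: ae01_imp hK1 _ => y /andP[_ /ltW y1] ->.
  by rewrite (cci_ae wi pi hK).
have K10 : K1 = 0 by have := E 0; rewrite f0 cci0 addr0 lexx ler01 => ->.
by move=> y /E; rewrite K10 add0r.
Qed.

(** The way back from integral equations: every solution constructed below enters the Sobolev space
    through this lemma. *)
Lemma H2_dirichlet_intro (f : cfun R) (p h : R -> C) : L2 (h : cfun R) ->
  (forall y, 0 <= y <= 1 -> f y = cci p y) ->
  (forall y, 0 <= y <= 1 -> p y = p 0 + cci h y) -> f 1 = 0 ->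
  H2_dirichlet f /\ ae_eq mu I (D2 f) h.
Proof.
move=> hL fE pE f1; have hi := L2_cint01 hL.
have pc : ccont_on 0 1 p.
  apply: (@ccont_on_ext _ _ (fun y => p 0 + cci h y)); first by move=> y /pE ->.
  by apply: ccont_onD; [exact: ccont_cst|exact: cci_cont].
have pi := cint01_cont pc; have pL := L2_cont pc.
have fc : ccont_on 0 1 f.
  by apply: (@ccont_on_ext _ _ (cci p)); [move=> y /fE ->|exact: cci_cont].
have fL := L2_cont fc.
have sub x : 0 < x < 1 -> 0 <= x <= 1 by move=> /andP[/ltW -> /ltW].
have fp : weak_derivative f (p : cfun R).
  apply: (weak_derivative_ae _ _ pi pi _ (ae_refl p)
    (weak_derivative_primitive 0 pi)); try exact: cint01_cont.
    apply: cint01_cont; apply: ccont_onD; [exact: ccont_cst|exact: cci_cont].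
  by apply: ae01_all => x /sub/fE ->; rewrite add0r.
have ph : weak_derivative (p : cfun R) (h : cfun R).
  apply: (weak_derivative_ae _ _ hi hi _ (ae_refl h)
    (weak_derivative_primitive (p 0) hi)) => //.
    apply: cint01_cont; apply: ccont_onD; [exact: ccont_cst|exact: cci_cont].
  by apply: ae01_all => x /sub/pE ->.
have [c1 c2] := fc.
have fD : H2_dirichlet f.
  split => //; last by rewrite fE ?cci0 // lexx ler01.
  by split => //; exists p; split => //; split => //; exists h.
split=> //.
have fH : H2 f by case: fD.
have [wL fw DL wD] := H2_wderiv fH.
have wp := wderiv_ae fL pL fp.
apply: wderiv_ae => //.
apply: (weak_derivative_ae _ _ hi hi _ (ae_refl h) ph) => //; first exact: L2_cint01.
exact: ae_sym.
Qed.

End second_order.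

(** * Second-order boundary value problems *)

Section boundary_value_problems.
Context {R : realType}.
Local Notation C := R[i].
Local Notation mu := (@lebesgue_measure R).
Local Notation I := (@I01 R).
Implicit Types (f g h u v p r q : R -> C) (x y : R).

(* For [F = u u' - g u^2], [F' = (u' - g u)^2 + (q - g' - g^2) u^2]. *)
Lemma riccati_zero (a b : R) (u p q g g' : R -> R) :
  (forall y, a < y < b -> der u y (p y)) ->
  (forall y, a < y < b -> der p y (q y * u y)) ->
  (forall y, a < y < b -> der g y (g' y)) ->
  (forall y, a < y < b -> 0 < q y - g' y - g y ^+ 2) ->
  cont_on a b (fun y => u y * p y - g y * u y ^+ 2) ->
  u a * p a - g a * u a ^+ 2 = u b * p b - g b * u b ^+ 2 ->
  forall y, a < y < b -> u y = 0.
Proof.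
move=> ud pd gd qg Fc Fab y yab.
pose dF y := (p y - g y * u y) ^+ 2 + (q y - g' y - g y ^+ 2) * u y ^+ 2.
have dF0 z : a < z < b -> 0 <= (q z - g' z - g z ^+ 2) * u z ^+ 2.
  by move=> zab; rewrite mulr_ge0 ?sqr_ge0 // ltW // qg.
have Fd z : a < z < b -> der (fun y => u y * p y - g y * u y ^+ 2) z (dF z).
  move=> zab; apply: der_eq.
    exact: derB (derM (ud z zab) (pd z zab)) (derM (gd z zab) (der_sqr (ud z zab))).
  by rewrite /dF; ring.
have dFge z : a < z < b -> 0 <= dF z by move=> zab; rewrite addr_ge0 ?sqr_ge0 ?dF0.
have /eqP := der_ge0_eq0 Fd Fc dFge Fab yab; rewrite paddr_eq0 ?sqr_ge0 ?dF0 // => /andP[_].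
by rewrite mulf_eq0 sqrf_eq0 gt_eqF ?qg //= => /eqP.
Qed.

(** Derivatives inside, continuity up to the ends: this is what an H^2 solution provides and what
    the monotonicity lemmas consume. *)
Definition csol (a b : R) q f p := [/\ ccont_on a b f, ccont_on a b p,
  forall y, a < y < b -> cder f y (p y) &
  forall y, a < y < b -> cder p y (q y * f y)].

Lemma cder_unique f x d d' : cder f x d -> cder f x d' -> d = d'.
Proof.
move=> [/der_derive1[_ e1] /der_derive1[_ e2]] [/der_derive1[_ e3] /der_derive1[_ e4]].
by apply: complexP; [rewrite -e1 -e3|rewrite -e2 -e4].
Qed.

Lemma csol_zero q f p : csol 0 1 q f p -> (forall y, 0 < y < 1 -> f y = 0) ->
  forall y, 0 <= y <= 1 -> p y = 0.
Proof.
move=> [fc pc fd pd] f0; apply: (@ae_eq_ccont _ p (fun=> 0)) => //; first exact: ccont_cst.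
apply: ae01_all => y y01; apply: (cder_unique (fd y y01)).
apply: (@cder_near _ (fun=> 0)); last exact: cder_cst.
by apply: (near_open01 y01) => z /f0.
Qed.

(** Every solution that vanishes at 0 is a multiple of [u], so u(1) = 0 decides whether nonzero
    Dirichlet solutions exist; [v] completes the basis with Wronskian -1. *)
Definition fundamental q u p v r :=
  [/\ forall y, 0 <= y <= 1 -> cder u y (p y) /\ cder p y (q y * u y),
      forall y, 0 <= y <= 1 -> cder v y (r y) /\ cder r y (q y * v y),
      u 0 = 0 /\ p 0 = 1 & v 0 = 1 /\ r 0 = 0].

Lemma fundamental_exists q : (forall x, 0 <= x <= 1 -> ccont_at x q) ->
  exists u p v r, fundamental q u p v r.
Proof.
move=> qc; have x0 : (0 : R) <= 0 <= (1 : R) by rewrite lexx ler01.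
have [u [p [u0 p0 ud pd]]] := complex_ode 0 1 x0 qc.
have [v [r [v0 r0 vd rd]]] := complex_ode 1 0 x0 qc.
by exists u, p, v, r; split=> // y y01; split=> //; [exact: pd|exact: rd].
Qed.

Lemma wronskian_cst (a b : R) q f p g r : csol a b q f p -> csol a b q g r ->
  forall y, a <= y <= b -> f y * r y - p y * g y = f a * r a - p a * g a.
Proof.
move=> [fc pc fd pd] [gc rc gd rd]; apply: (@cder0_cst _ a b (fun y => f y * r y - p y * g y)).
  move=> y yab; apply: cder_eq.
    exact: cderB (cderM (fd y yab) (rd y yab)) (cderM (pd y yab) (gd y yab)).
  by ring.
by apply: ccont_onD; [|apply: ccont_onN]; exact: ccont_onM.
Qed.

Lemma fundamental_csol q u p v r : fundamental q u p v r ->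
  csol 0 1 q u p /\ csol 0 1 q v r.
Proof.
move=> [ud vd _ _].
have sub x : 0 < x < 1 -> 0 <= x <= 1 by move=> /andP[/ltW -> /ltW].
split; split.
- by apply: ccont_on_cder => y /ud[h _]; exact: h.
- by apply: (@ccont_on_cder _ _ _ _ (fun y => q y * u y)) => y /ud[].
- by move=> y /sub/ud[].
- by move=> y /sub/ud[].
- by apply: ccont_on_cder => y /vd[h _]; exact: h.
- by apply: (@ccont_on_cder _ _ _ _ (fun y => q y * v y)) => y /vd[].
- by move=> y /sub/vd[].
- by move=> y /sub/vd[].
Qed.

Lemma fundamental_wronskian q u p v r : fundamental q u p v r ->
  forall y, 0 <= y <= 1 -> u y * r y - p y * v y = - 1.
Proof.
move=> F y y01; have [su sv] := fundamental_csol F.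
rewrite (wronskian_cst su sv y01); case: F => _ _ [-> ->] [-> ->]; ring.
Qed.

(** Cramer's rule: the Wronskians of [f] with [u] and with [v] are constant and can be evaluated at
    0. *)
Lemma fundamental_repr q u p v r f g : fundamental q u p v r -> csol 0 1 q f g ->
  forall y, 0 <= y <= 1 -> f y = f 0 * v y + g 0 * u y.
Proof.
move=> F sf y y01; have [su sv] := fundamental_csol F.
have w := fundamental_wronskian F y01.
have w1 := wronskian_cst sf su y01; have w2 := wronskian_cst sf sv y01.
case: F => _ _ [u0 p0] [v0 r0]; rewrite u0 p0 in w1; rewrite v0 r0 in w2.
have : f y * - (u y * r y - p y * v y) =
  v y * (f y * p y - g y * u y) - u y * (f y * r y - g y * v y) by ring.
rewrite w w1 w2 => e; have -> : f y = f y * - (- 1) by ring.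
by rewrite e; ring.
Qed.

(** Stated as integral equations because [h] is merely integrable. Both follow by integration by
    parts, the second one also from the Wronskian -1. The parameter [alpha] is the free slope
    psi'(0). *)
Lemma variation_of_parameters q u p v r h : fundamental q u p v r ->
  ccont_on 0 1 q -> cint01 h -> forall alpha : C,
  let psi y := u y * (alpha + cci (fun t => v t * h t) y) - v y * cci (fun t => u t * h t) y in
  let pi y := p y * (alpha + cci (fun t => v t * h t) y) - r y * cci (fun t => u t * h t) y in
  (forall y, 0 <= y <= 1 -> psi y = cci pi y) /\
  (forall y, 0 <= y <= 1 -> pi y = pi 0 + cci (fun t => q t * psi t + h t) y).
Proof.
move=> F qc hi alpha psi pi; have [[uc pc _ _] [vc rc _ _]] := fundamental_csol F.
have W := fundamental_wronskian F.
case: F => ud vd [u0 p0] [v0 r0].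
have vhi : cint01 (fun t => v t * h t) by exact: cint01M_cont.
have uhi : cint01 (fun t => u t * h t) by exact: cint01M_cont.
have ud1 x : 0 <= x <= 1 -> cder u x (p x) by move=> /ud[].
have ud2 x : 0 <= x <= 1 -> cder p x (q x * u x) by move=> /ud[].
have vd1 x : 0 <= x <= 1 -> cder v x (r x) by move=> /vd[].
have vd2 x : 0 <= x <= 1 -> cder r x (q x * v x) by move=> /vd[].
have quc : ccont_on 0 1 (fun x => q x * u x) by exact: ccont_onM.
have qvc : ccont_on 0 1 (fun x => q x * v x) by exact: ccont_onM.
have parts a a' k : cint01 k -> (forall x, 0 <= x <= 1 -> cder a x (a' x)) ->
    ccont_on 0 1 a' -> cint01 (fun t => a' t * cci k t + a t * k t).
  move=> ki ad a'c; apply: cint01D; apply: cint01M_cont => //.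
    by apply: cint01_cont; exact: cci_cont.
  exact: ccont_on_cder ad.
split=> y y01; have /andP[y0 y1] := y01.
  rewrite /psi mulrDr (cci_by_parts vhi ud1 pc y01) (cci_by_parts uhi vd1 rc y01).
  have -> : u y * alpha = cci (fun t => alpha * p t) y.
    by rewrite cciZ ?(cci_FTC pc ud1) ?u0 ?subr0 ?[alpha * _]mulrC //; exact: cint01_cont.
  have i1 : cint01 (fun t => alpha * p t).
    by apply: cint01_cont; apply: ccont_onM => //; exact: ccont_cst.
  have i2 := parts _ _ _ vhi ud1 pc; have i3 := parts _ _ _ uhi vd1 rc.
  rewrite -cciD // -cciN // -cciD //; [|exact: cint01D|exact: cint01N].
  by apply: cci_ext => t _; rewrite /pi; ring.
rewrite {1}/pi mulrDr (cci_by_parts vhi ud2 quc y01) (cci_by_parts uhi vd2 qvc y01).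
have -> : p y * alpha = alpha + cci (fun t => alpha * (q t * u t)) y.
  by rewrite cciZ ?(cci_FTC quc ud2) ?p0 //; [ring|exact: cint01_cont].
have i1 : cint01 (fun t => alpha * (q t * u t)).
  by apply: cint01_cont; apply: ccont_onM => //; exact: ccont_cst.
have i2 := parts _ _ _ vhi ud2 quc; have i3 := parts _ _ _ uhi vd2 qvc.
have -> : pi 0 = alpha by rewrite /pi !cci0 p0 r0; ring.
rewrite -addrA -addrA; congr (alpha + _).
rewrite addrA -cciD // -cciN // -cciD //; [|exact: cint01D|exact: cint01N].
apply: cci_ext => t /andP[t0 ty].
have w : u t * r t - p t * v t = - 1 by apply: W; rewrite t0; lra.
rewrite /psi; apply/eqP; rewrite -subr_eq0; apply/eqP.
by transitivity ((- (u t * r t - p t * v t) - 1) * h t); [ring|rewrite w; ring].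
Qed.

(** psi(1) = 0 is a linear equation for [alpha] with coefficient u(1). If u(1) = 0, it reduces to
    v(1) times the integral of u h being 0, whence the orthogonality condition. *)
Lemma dirichlet_problem q u p v r h : fundamental q u p v r ->
  ccont_on 0 1 q -> L2 (h : cfun R) ->
  u 1 != 0 \/ cci (fun t => u t * h t) 1 = 0 ->
  exists psi : cfun R, H2_dirichlet psi /\ ae_eq mu I (D2 psi) (fun y => q y * psi y + h y).
Proof.
move=> F qc hL solv; have hi := L2_cint01 hL.
have [alpha ha] : exists alpha : C,
    u 1 * (alpha + cci (fun t => v t * h t) 1) - v 1 * cci (fun t => u t * h t) 1 = 0.
  case: (eqVneq (u 1) 0) => [u1|u1].
    exists 0; rewrite u1 mul0r sub0r; case: solv => [|->]; first by rewrite u1 eqxx.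
    by rewrite mulr0 oppr0.
  exists (v 1 * cci (fun t => u t * h t) 1 / u 1 - cci (fun t => v t * h t) 1).
  by rewrite subrK mulrC divfK // subrr.
have [h1 h2] := variation_of_parameters F qc hi alpha.
have [[uc pc _ _] [vc rc _ _]] := fundamental_csol F.
have cc k : cint01 k -> ccont_on 0 1 (cci k) by exact: cci_cont.
have vhi : cint01 (fun t => v t * h t) by exact: cint01M_cont.
have uhi : cint01 (fun t => u t * h t) by exact: cint01M_cont.
eexists; apply: (@H2_dirichlet_intro _ _ _ _ _ h1 h2 ha).
apply: L2D => //; apply: L2_cont; apply: ccont_onM => //.
apply: ccont_onD; [|apply: ccont_onN]; apply: ccont_onM => //; last exact: cc.
by apply: ccont_onD; [exact: ccont_cst|exact: cc].
Qed.

(** The function q f is continuous, so the second weak derivative has a continuous representative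
    and the equation holds classically. *)
Lemma H2_dirichlet_csol (f : cfun R) q : H2_dirichlet f ->
  ae_eq mu I (D2 f) (fun y => q y * f y) -> ccont_on 0 1 q ->
  exists p, csol 0 1 q f p.
Proof.
move=> fH fq qc; have [DL [p [pc fE pE]]] := H2_dirichlet_repr fH.
have fc : ccont_on 0 1 f by case: fH.
have qfc : ccont_on 0 1 (fun y => q y * f y) by exact: ccont_onM.
have qfi := cint01_cont qfc; have pi := cint01_cont pc.
have sub x : 0 < x < 1 -> 0 <= x <= 1 by move=> /andP[/ltW -> /ltW].
exists p; split => // y y01.
  apply: (@cder_near _ (cci p)); last by apply: cci_der => //; exact: ccont_on_at y01.
  by apply: (near_open01 y01) => z /sub/fE ->.
apply: (@cder_near _ (fun y => p 0 + cci (fun y => q y * f y) y)).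
  apply: (near_open01 y01) => z z01; rewrite (pE z (sub z z01)).
  by rewrite (cci_ae (L2_cint01 DL) qfi fq) //; case/andP : z01 => _ /ltW.
rewrite -[X in cder _ _ X]add0r; apply: cderD; first exact: cder_cst.
by apply: cci_der => //; exact: ccont_on_at y01.
Qed.

(** [D2] is a choice and not visibly linear; the integral representation is linear, and
    [H2_dirichlet_intro] brings this back. *)
Lemma D2_linear (a : C) (f g : cfun R) : H2_dirichlet f -> H2_dirichlet g ->
  H2_dirichlet ((fun y => a * f y + g y) : cfun R) /\
  ae_eq mu I (D2 (fun y => a * f y + g y)) (fun y => a * D2 f y + D2 g y).
Proof.
move=> fH gH.
have [fL [p [pc fE pE]]] := H2_dirichlet_repr fH.
have [gL [r [rc gE rE]]] := H2_dirichlet_repr gH.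
have fi := L2_cint01 fL; have gi := L2_cint01 gL.
have pi := cint01_cont pc; have ri := cint01_cont rc.
have Zi k : cint01 k -> cint01 (fun y => a * k y).
  by move=> ki; apply: cint01M_cont => //; exact: ccont_cst.
apply: (@H2_dirichlet_intro _ _ (fun y => a * p y + r y)).
- by apply: L2D => //; exact: L2Z.
- move=> y y01; have /andP[_ y1] := y01.
  by rewrite (fE y y01) (gE y y01) cciD ?cciZ //; exact: Zi.
- move=> y y01; have /andP[_ y1] := y01.
  rewrite (pE y y01) (rE y y01) cciD ?cciZ //; last exact: Zi.
  by rewrite mulrDr addrACA.
- by case: fH gH => _ _ _ _ -> [_ _ _ _ ->]; rewrite mulr0 addr0.
Qed.

Lemma H2_dirichlet_ae_eq (f g : cfun R) : H2_dirichlet f -> H2_dirichlet g ->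
  ae_eq mu I f g -> forall y, 0 <= y <= 1 -> f y = g y.
Proof. by move=> [_ f1 f2 _ _] [_ g1 g2 _ _] fg y; apply: ae_eq_ccont. Qed.

Lemma D2_ae_eq (f g : cfun R) : H2_dirichlet f -> H2_dirichlet g ->
  ae_eq mu I f g -> ae_eq mu I (D2 f) (D2 g).
Proof.
move=> fH gH fg; have E := H2_dirichlet_ae_eq fH gH fg.
have [fL [p [pc fE pE]]] := H2_dirichlet_repr fH.
have g1 : g 1 = 0 by case: gH.
have gE y : 0 <= y <= 1 -> g y = cci p y by move=> y01; rewrite -E // fE.
by have [_ /ae_sym] := H2_dirichlet_intro fL gE pE g1.
Qed.

Lemma natrC (m : nat) : (m%:R ^+ 2 : C) = ((m%:R ^+ 2 : R)%:C).
Proof. by rewrite rmorphXn /= rmorph_nat. Qed.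

Lemma csol_real_parts (a b : R) (q : R -> R) f p : csol a b (fun y => (q y)%:C) f p ->
  (forall y, a < y < b -> der (fun y => Re (f y)) y (Re (p y)) /\
     der (fun y => Re (p y)) y (q y * Re (f y))) /\
  (forall y, a < y < b -> der (fun y => Im (f y)) y (Im (p y)) /\
     der (fun y => Im (p y)) y (q y * Im (f y))).
Proof.
move=> [_ _ fd pd]; split=> y yab; have [f1 f2] := fd y yab; have [p1 p2] := pd y yab.
  by split => //; apply: der_eq p1 _; rewrite cReM /=; ring.
by split => //; apply: der_eq p2 _; rewrite cImM /=; ring.
Qed.

(** The Riccati argument with g = 0, that is, monotonicity of u u', applied to real and imaginary
    parts. *)
Lemma csol_zero_pos (a b : R) (q : R -> R) f p : csol a b (fun y => (q y)%:C) f p ->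
  (forall y, a < y < b -> 0 < q y) -> f a = 0 -> f b = 0 ->
  forall y, a < y < b -> f y = 0.
Proof.
move=> fs q0 fa fb y yab; have [h1 h2] := csol_real_parts fs.
have [[fc1 fc2] [pc1 pc2] _ _] := fs.
have main (u p' : R -> R) : cont_on a b u -> cont_on a b p' ->
    (forall z, a < z < b -> der u z (p' z) /\ der p' z (q z * u z)) -> u a = 0 -> u b = 0 ->
    u y = 0.
  move=> uc pc ud ua ub; apply: (@riccati_zero a b u p' q (fun=> 0) (fun=> 0)) yab.
  - by move=> z /ud[].
  - by move=> z /ud[].
  - by move=> z _; exact: der_cst.
  - by move=> z /q0; rewrite subr0 expr0n subr0.
  - by apply: cont_on_ext (cont_onM uc pc) => z _; rewrite mul0r subr0.
  - by rewrite ua ub !mul0r.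
by apply: complexP; [exact: main fc1 pc1 h1 (congr1 (@complex.Re R) fa) (congr1 (@complex.Re R) fb)|
  exact: main fc2 pc2 h2 (congr1 (@complex.Im R) fa) (congr1 (@complex.Im R) fb)].
Qed.

End boundary_value_problems.

(** * The operator in pointwise form *)

Section the_operator.
Context {R : realType}.
Local Notation C := R[i].
Local Notation mu := (@lebesgue_measure R).
Local Notation I := (@I01 R).
Implicit Types (x y : R).

Lemma DeltaE (m : nat) (f : cfun R) y : Delta m f y = D2 f y - m%:R ^+ 2 * f y.
Proof. by []. Qed.

Lemma in01 x : 0 < x < 1 -> 0 <= x <= 1.
Proof. by move=> /andP[/ltW -> /ltW]. Qed.

Lemma real_ccont (k : R) a b : ccont_on a b (fun=> k%:C).
Proof. exact: ccont_cst. Qed.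

Lemma csol_helmholtz_zero (m : nat) (f p : R -> C) : (1 <= m)%N ->
  csol 0 1 (fun=> (m%:R ^+ 2)%:C) f p -> f 0 = 0 -> f 1 = 0 ->
  forall y, 0 <= y <= 1 -> f y = 0.
Proof.
move=> m1 fs f0 f1 y /andP[y0 y1].
have z := csol_zero_pos fs (fun _ _ => _) f0 f1.
have [->//|y0'] := eqVneq y 0; have [->//|y1'] := eqVneq y 1.
apply: z => [x|]; first by rewrite exprn_gt0 // ltr0n.
by rewrite !lt_neqAle y0 y1 y1' eq_sym y0'.
Qed.

Lemma Delta_unique (m : nat) (f g : cfun R) : (1 <= m)%N -> H2_dirichlet f -> H2_dirichlet g ->
  ae_eq mu I (Delta m f) (Delta m g) -> forall y, 0 <= y <= 1 -> f y = g y.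
Proof.
move=> m1 fH gH fg y y01.
have [kH kD] := D2_linear (- 1) fH gH; set k := fun y => _ in kH kD.
have kq : ae_eq mu I (D2 k) (fun y => (m%:R ^+ 2)%:C * k y).
  apply: ae01_imp2 kD fg _ => z _ ->; rewrite !DeltaE natrC /k.
  move: (D2 f z) (D2 g z) (f z) (g z) => a b c d /eqP; rewrite subr_eq => /eqP ->.
  by rewrite -natrC; ring.
have [p ps] := H2_dirichlet_csol kH kq (real_ccont _ _ _).
have [k0 k1] : k 0 = 0 /\ k 1 = 0 by case: kH.
have := csol_helmholtz_zero m1 ps k0 k1 y01; rewrite /k mulN1r addrC => /eqP.
by rewrite subr_eq0 => /eqP.
Qed.

(** Shows that [xget] never falls back on its default: if u(1) were 0, u would be a nonzero
    Dirichlet solution of u'' = m^2 u, against the positivity of m^2. *)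
Lemma Delta_inv_spec (m : nat) (h : cfun R) : (1 <= m)%N -> L2 h ->
  H2_dirichlet (Delta_inv m h) /\ ae_eq mu I (Delta m (Delta_inv m h)) h.
Proof.
move=> m1 hL; pose q (y : R) : C := (m%:R ^+ 2)%:C.
have [|u [p [v [r F]]]] := @fundamental_exists _ q.
  by move=> x _; split; exact: cvg_cst.
have [us _] := fundamental_csol F.
have u1 : u 1 != 0.
  apply/eqP => u1; case: F => _ _ [u0 p0] _.
  have uz := csol_helmholtz_zero m1 us u0 u1.
  have := csol_zero us (fun y y01 => uz y (in01 y01)); move=> /(_ 0).
  by rewrite lexx ler01 p0 => /(_ isT)/eqP; rewrite oner_eq0.
have [|psi [psiH psiD]] := dirichlet_problem F (real_ccont _ _ _) hL; first by left.
have ex : exists f, H2_dirichlet f /\ ae_eq01 (Delta m f) h.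
  exists psi; split => //; apply: ae01_imp psiD _ => y _; rewrite DeltaE => ->.
  by rewrite /q natrC addrC addrA addNr add0r.
rewrite /Delta_inv; case: xgetP => [f _ //|].
by case: ex => f hf /(_ f).
Qed.

Lemma H2_dirichlet0 : H2_dirichlet (0 : cfun R) /\ ae_eq mu I (D2 (0 : cfun R)) (fun=> 0).
Proof.
have c0 y : 0 <= y <= 1 -> (0 : C) = cci (fun=> 0) y.
  move=> y01; rewrite (@cci_FTC _ (fun=> 0) (fun=> 0)) ?subr0 //; first exact: ccont_cst.
  by move=> x _; exact: cder_cst.
apply: (@H2_dirichlet_intro _ _ (fun=> 0) (fun=> 0)) => //; first exact: L2_cst.
by move=> y /c0 <-; rewrite addr0.
Qed.

Lemma L2_Delta (m : nat) (f : cfun R) : H2_dirichlet f -> L2 (Delta m f).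
Proof.
move=> fH; have [DL _] := H2_dirichlet_repr fH.
apply: (@L2B _ (D2 f) (fun y => m%:R ^+ 2 * f y)) => //; apply: L2Z.
by case: fH => -[].
Qed.

Lemma ccont_id : ccont_on 0 1 (fun y : R => y%:C).
Proof.
split; last exact: cont_on_cst.
by apply: cont_on_continuous => x; exact: cvg_id.
Qed.

Lemma L2_ymul (f : cfun R) : L2 f -> L2 (ymul f).
Proof.
move=> fL; rewrite (_ : ymul f = fun y => f y * y%:C).
  by apply: (@L2M_cont _ f) => //; exact: ccont_id.
by apply/funext => y; rewrite /ymul mulrC.
Qed.

(** Both sides of the first component lie in H^2 with Dirichlet conditions, where Delta_m is
    injective; applying it removes the inverses. *)
Lemma shift_Lop_eq (beta : R) (m : nat) (c : C) (v w : state R) : (1 <= m)%N ->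
  X v -> X w ->
  eqX (Defs.shift (Lop beta m) c v) w <->
  ae01 (fun y => (y%:C - c) * Delta m v.1 y + (beta ^+ 2)%:C * v.2 y = Delta m w.1 y) /\
  ae01 (fun y => (y%:C - c) * v.2 y - v.1 y = w.2 y).
Proof.
move=> m1 [psiH rhoL] [fH gL].
pose A := Delta_inv m (ymul (Delta m v.1)); pose B := Delta_inv m v.2.
have [AH AD] : H2_dirichlet A /\ ae_eq mu I (Delta m A) (ymul (Delta m v.1)).
  by apply: Delta_inv_spec => //; apply: L2_ymul; exact: L2_Delta.
have [BH BD] : H2_dirichlet B /\ ae_eq mu I (Delta m B) v.2 by exact: Delta_inv_spec.
pose b : C := (beta ^+ 2)%:C.
(* [G] is the first component of (L - c) v, rearranged as nested combinations of the form treated by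
   [D2_linear]. *)
have [EH ED] := D2_linear b BH AH; set E := fun y => _ in EH ED.
have [GH GD] := D2_linear (- c) psiH EH; set G := fun y => _ in GH GD.
have GE y : (Defs.shift (Lop beta m) c v).1 y = G y.
  rewrite /Defs.shift /Lop /G /E /= -/A -/B.
  change (A y + b * B y - c * v.1 y = - c * v.1 y + (b * B y + A y)).
  by move: (A y) (B y) (v.1 y) => x1 x2 x3; rewrite mulNr addrC [A in _ + A = _]addrC.
have DG : ae01 (fun y => Delta m G y = (y%:C - c) * Delta m v.1 y + b * v.2 y).
  apply: ae01_imp3 AD BD (ae01_imp2 ED GD (fun y _ e1 e2 => conj e1 e2)) _ => y _.
  rewrite !DeltaE /ymul /G /E => hA hB [-> ->].
  move: hA hB; rewrite !DeltaE.
  move: (D2 A y) (D2 B y) (D2 v.1 y) (A y) (B y) (v.1 y) (v.2 y) => a1 a2 a3 x1 x2 x3 x4.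
  move: (m%:R ^+ 2) => k /eqP; rewrite subr_eq => /eqP -> <-.
  by ring.
have second y : (Defs.shift (Lop beta m) c v).2 y = (y%:C - c) * v.2 y - v.1 y.
  rewrite /Defs.shift /Lop /=.
  change (- v.1 y + y%:C * v.2 y - c * v.2 y = (y%:C - c) * v.2 y - v.1 y).
  by move: (v.1 y) (v.2 y) => x1 x2; rewrite mulrBl -addrA addrC.
split=> -[h1 h2]; split.
- have Gf : ae_eq mu I G w.1 by apply: ae01_imp h1 _ => y _ <-; rewrite GE.
  have EG := H2_dirichlet_ae_eq GH fH Gf.
  apply: ae01_imp2 DG (D2_ae_eq GH fH Gf) _ => y y01 <- e.
  by rewrite !DeltaE e (EG y (in01 y01)).
- by apply: ae01_imp h2 _ => y _ <-; rewrite second.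
- have GD' : ae_eq mu I (Delta m G) (Delta m w.1).
    by apply: ae01_imp2 DG h1 _ => y _ ->.
  have EG := Delta_unique m1 GH fH GD'.
  by apply: ae01_all => y y01; rewrite GE (EG y (in01 y01)).
- by apply: ae01_imp h2 _ => y _ <-; rewrite second.
Qed.

Lemma X0 : X (0 : state R).
Proof. by split; [exact: (H2_dirichlet0).1|exact: L2_cst]. Qed.

Lemma Delta0 (m : nat) : ae01 (fun y => Delta m (0 : cfun R) y = 0).
Proof.
apply: ae01_imp (H2_dirichlet0).2 _ => y _; rewrite DeltaE => ->.
by rewrite [(0 : cfun R) y](_ : _ = 0) // mulr0 subr0.
Qed.

Lemma shift_kernel_eq (beta : R) (m : nat) (c : C) (v : state R) : (1 <= m)%N -> X v ->
  eqX (Defs.shift (Lop beta m) c v) 0 <->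
  ae01 (fun y => (y%:C - c) * Delta m v.1 y + (beta ^+ 2)%:C * v.2 y = 0) /\
  ae01 (fun y => (y%:C - c) * v.2 y = v.1 y).
Proof.
move=> m1 vX; rewrite (shift_Lop_eq beta c m1 vX X0); split=> -[h1 h2]; split.
- by apply: ae01_imp2 h1 (Delta0 m) _ => y _ ->.
- by apply: ae01_imp h2 _ => y _ /eqP; rewrite subr_eq0 => /eqP.
- by apply: ae01_imp2 h1 (Delta0 m) _ => y _ -> ->.
- by apply: ae01_imp h2 _ => y _ ->; rewrite subrr.
Qed.

Lemma eigen_shift (T : state R -> state R) (c : C) (v : state R) :
  eqX (T v) (c *: v) <-> eqX (Defs.shift T c v) 0.
Proof.
split=> -[h1 h2]; split.
- by apply: ae01_imp h1 _ => y _ e; rewrite /Defs.shift /=; apply/eqP; rewrite subr_eq0 e.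
- by apply: ae01_imp h2 _ => y _ e; rewrite /Defs.shift /=; apply/eqP; rewrite subr_eq0 e.
- by apply: ae01_imp h1 _ => y _ /eqP; rewrite /Defs.shift /= subr_eq0 => /eqP.
- by apply: ae01_imp h2 _ => y _ /eqP; rewrite /Defs.shift /= subr_eq0 => /eqP.
Qed.

End the_operator.

(** * Outside the segment: resolvent and Fredholm property *)

Section outside_the_segment.
Context {R : realType}.
Local Notation C := R[i].
Local Notation mu := (@lebesgue_measure R).
Local Notation I := (@I01 R).
Implicit Types (x y : R) (u p v r : R -> C).
Variables (beta : R) (m : nat).
Hypotheses (beta_gt0 : 0 < beta) (m_ge1 : (1 <= m)%N).
Local Notation L := (Lop beta m).
Local Notation b := ((beta ^+ 2)%:C : C).

Definition taylor_goldstein (c : C) (y : R) : C :=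
  (m%:R ^+ 2)%:C - (beta ^+ 2)%:C / (y%:C - c) ^+ 2.
Local Notation q := taylor_goldstein.

Lemma b_neq0 : b != 0.
Proof. by rewrite eq_complex /= eqxx andbT sqrf_eq0 gt_eqF. Qed.

Lemma notin_segment (c : C) : ~ segment01 c -> forall y, 0 <= y <= 1 -> y%:C - c != 0.
Proof.
move=> cS y y01; apply/eqP => /eqP; rewrite subr_eq0 => /eqP yc; apply: cS.
by rewrite -yc /segment01 /=.
Qed.

Lemma cder_shift (c : C) y : cder (fun t : R => t%:C - c) y 1.
Proof.
by apply: cder_eq; [exact: cderB (cder_real (der_id y)) (cder_cst c y)|rewrite subr0].
Qed.

Lemma ccont_inv_shift (c : C) y : y%:C - c != 0 -> ccont_at y (fun t : R => (t%:C - c)^-1).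
Proof. move=> yc; exact: cder_ccont_at (cderV yc (cder_shift c y)). Qed.

Lemma cder_q (c : C) y : y%:C - c != 0 -> exists d, cder (q c) y d.
Proof.
move=> yc; have yc2 : (y%:C - c) * (y%:C - c) != 0 by rewrite mulf_neq0.
eexists; apply: (@cder_ext _ (fun t => (m%:R ^+ 2)%:C - b * ((t%:C - c) * (t%:C - c))^-1)).
  by move=> t; rewrite /q expr2.
apply: cderB; first exact: cder_cst.
apply: cderM; first exact: cder_cst.
by apply: cderV => //; apply: cderM; exact: cder_shift.
Qed.

Section fixed_c.
Variable c : C.
Hypothesis yc : forall y, 0 <= y <= 1 -> y%:C - c != 0.

Lemma q_cont_at y : 0 <= y <= 1 -> ccont_at y (q c).
Proof. by move=> /yc/cder_q[d]; exact: cder_ccont_at. Qed.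

Lemma ccont_on_of_at (a a' : R) (f : R -> C) : (forall x, a <= x <= a' -> ccont_at x f) ->
  ccont_on a a' f.
Proof.
move=> fc; split; apply: continuous_in_subspaceT => x;
  by rewrite inE/= in_itv/= => /fc[].
Qed.

Lemma q_cont : ccont_on 0 1 (q c).
Proof. by apply: ccont_on_of_at; exact: q_cont_at. Qed.

Lemma inv_cont : ccont_on 0 1 (fun t : R => (t%:C - c)^-1).
Proof. by apply: ccont_on_of_at => x /yc; exact: ccont_inv_shift. Qed.

Lemma kernel_csol (w : state R) : X w -> eqX (Defs.shift L c w) 0 ->
  exists p, csol 0 1 (q c) w.1 p.
Proof.
move=> wX; rewrite (shift_kernel_eq beta c m_ge1 wX) => -[h1 h2]; have [wH _] := wX.
apply: H2_dirichlet_csol => //; last exact: q_cont.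
apply: ae01_imp2 h1 h2 _ => y /in01/yc y0; rewrite DeltaE natrC /q => e1 e2.
move: e1 e2 y0; move: (D2 w.1 y) (w.1 y) (w.2 y) (y%:C - c) => d f rho s e1 e2 s0.
move: e1; rewrite -e2 => /eqP; rewrite addr_eq0 => /eqP e1.
apply: (mulfI s0); move: e1; rewrite mulrBr => /eqP; rewrite subr_eq => /eqP ->.
by field.
Qed.

Lemma fundamental_kernel u p v r : fundamental (q c) u p v r -> u 1 = 0 ->
  X ((u : cfun R), (fun t : R => u t / (t%:C - c)) : cfun R) /\
  eqX (Defs.shift L c ((u : cfun R), (fun t : R => u t / (t%:C - c)) : cfun R)) 0.
Proof.
move=> F u1; have [[uc pc _ _] _] := fundamental_csol F; case: F => ud _ [u0 p0] _.
have quc : ccont_on 0 1 (fun t => q c t * u t) by apply: ccont_onM => //; exact: q_cont.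
have uL : L2 (u : cfun R) by exact: L2_cont.
have [||||uH uD] := @H2_dirichlet_intro _ (u : cfun R) p (fun t => q c t * u t).
- exact: L2_cont.
- move=> y y01; rewrite (@cci_FTC _ u p pc _ y y01) ?u0 ?subr0 // => x /ud[d1 _]; exact: d1.
- move=> y y01; rewrite (@cci_FTC _ p _ quc _ y y01); first by rewrite addrC subrK.
  by move=> x /ud[].
- exact: u1.
have eX : X ((u : cfun R), (fun t : R => u t / (t%:C - c)) : cfun R).
  by split => //; apply: L2M_cont => //; exact: inv_cont.
split=> //; rewrite (shift_kernel_eq beta c m_ge1 eX) /=; split.
  apply: ae01_imp uD _ => y /in01/yc y0; rewrite DeltaE natrC => ->.
  by rewrite /q; move: (u y) => w; move: y0; move: (y%:C - c) => s s0; field.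
by apply: ae01_all => y /in01/yc y0; rewrite mulrC divfK.
Qed.

(** psi(0) = 0 leaves only multiples of [u], and rho = psi / (y - c) follows; the kernel has
    dimension at most one. *)
Lemma kernel_fundamental u p v r (w : state R) : fundamental (q c) u p v r ->
  X w -> eqX (Defs.shift L c w) 0 ->
  exists a : C, (forall y, 0 <= y <= 1 -> w.1 y = a * u y) /\
    ae_eq mu I w.2 (fun y => a * (u y / (y%:C - c))).
Proof.
move=> F wX wK; have [g ws] := kernel_csol wX wK.
have w0 : w.1 0 = 0 by case: wX => -[].
have E : forall y, 0 <= y <= 1 -> w.1 y = g 0 * u y.
  by move=> y y01; rewrite (fundamental_repr F ws y01) w0 mul0r add0r.
exists (g 0); split => //.
move: wK; rewrite (shift_kernel_eq beta c m_ge1 wX) => -[_ h2].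
apply: ae01_imp h2 _ => y /in01 y01 e; apply: (mulfI (yc y01)).
rewrite e (E y y01); have := yc y01; move: (y%:C - c) => s s0.
by rewrite mulrCA [s * _]mulrC divfK.
Qed.

(** For data w = (f, g) the second equation gives rho = (psi + g) / (y - c); inserting it in the
    first one leaves psi'' = q psi + h, and this is the source h. *)
Definition resolvent_rhs (w : state R) : R -> C :=
  fun y => (Delta m w.1 y - b * (w.2 y / (y%:C - c))) / (y%:C - c).

Lemma L2_resolvent_rhs (w : state R) : X w -> L2 (resolvent_rhs w : cfun R).
Proof.
move=> [fH gL]; apply: (@L2M_cont _ (fun y => Delta m w.1 y - b * (w.2 y / (y%:C - c)))).
  exact: inv_cont.
apply: (@L2B _ (Delta m w.1) (fun y => b * (w.2 y / (y%:C - c)))).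
  exact: L2_Delta.
apply: (@L2Z _ b (fun y => w.2 y / (y%:C - c))).
by apply: (@L2M_cont _ w.2) => //; exact: inv_cont.
Qed.

Lemma resolvent_solution u p v r (w : state R) : fundamental (q c) u p v r -> X w ->
  u 1 != 0 \/ cci (fun t => u t * resolvent_rhs w t) 1 = 0 ->
  exists z, X z /\ eqX (Defs.shift L c z) w.
Proof.
move=> F wX solv; have [fH gL] := wX.
have [psi [psiH psiD]] := dirichlet_problem F q_cont (L2_resolvent_rhs wX) solv.
pose rho : cfun R := fun y => (psi y + w.2 y) / (y%:C - c).
have psiL : L2 psi by case: psiH => -[].
have zX : X (psi, rho).
  split => //; apply: (@L2M_cont _ (fun y => psi y + w.2 y)); first exact: inv_cont.
  exact: L2D.
exists (psi, rho); split => //; rewrite (shift_Lop_eq beta c m_ge1 zX wX) /=; split.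
  apply: ae01_imp psiD _ => y /in01/yc y0; rewrite DeltaE natrC => ->.
  rewrite /resolvent_rhs /rho /q; move: (psi y) (w.2 y) (Delta m w.1 y) => x1 x2 x3.
  by move: y0; move: (y%:C - c) => s s0; field.
apply: ae01_all => y /in01/yc y0; rewrite /rho mulrC divfK //.
by rewrite addrC addKr.
Qed.

Lemma fundamental_norm_gt0 u p v r : fundamental (q c) u p v r -> 0 < ci (fun t => sqn (u t)) 1.
Proof.
move=> F; have [us _] := fundamental_csol F; have [[c1 c2] _ _ _] := us.
have sc : cont_on 0 1 (fun t => sqn (u t)).
  by apply: cont_on_ext (cont_onD (cont_onM c1 c1) (cont_onM c2 c2)) => y _; rewrite /sqn; ring.
have si := int01_cont sc.
rewrite lt_neqAle -{2}(ci0 (fun t => sqn (u t))); apply/andP; split.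
  apply/eqP => e.
  have z y : 0 < y < 1 -> sqn (u y) = 0.
    apply: (@der_ge0_eq0 _ 0 1 (ci (fun t => sqn (u t))) (fun t => sqn (u t))).
    - by move=> x x01; apply: (ci_der (f := fun t => sqn (u t))) => //; exact: cont_on_at x01.
    - exact: ci_cont.
    - by move=> x _; exact: sqn_ge0.
    - by rewrite ci0.
  case: F => _ _ [_ p0] _.
  have := csol_zero us _ (_ : (0 : R) <= 0 <= 1); rewrite p0 lexx ler01 => h.
  have uz y : 0 < y < 1 -> u y = 0 by move=> y01; apply/eqP; rewrite -sqn_eq0 z.
  by have /eqP := h uz isT; rewrite oner_eq0.
apply: (@der_ge0_le _ 0 1 (ci (fun t => sqn (u t))) (fun t => sqn (u t))) => //.
- by move=> x x01; apply: (ci_der (f := fun t => sqn (u t))) => //; exact: cont_on_at x01.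
- exact: ci_cont.
- by move=> x _; exact: sqn_ge0.
Qed.

Lemma fredholm_outside : fredholm (Defs.shift L c).
Proof.
have [u [p [v [r F]]]] := fundamental_exists q_cont_at.
case: (eqVneq (u 1) 0) => u1; last first.
  split; last first.
    exists 0%N, (fun=> 0); split => [[]//|w wX].
    have [|z [zX zw]] := resolvent_solution F wX; first by left.
    exists z, (fun=> 0); split => //; rewrite big_ord0.
    by case: zw => h1 h2; split; [apply: ae01_imp h1 _|apply: ae01_imp h2 _] => y _ <- /=;
      rewrite addr0.
  exists 0%N, (fun=> 0); split => [[]//|w wX wK].
  have [a [E1 E2]] := kernel_fundamental F wX wK.
  have a0 : a = 0.
    have w1 : w.1 1 = 0 by case: wX => -[].
    have : a * u 1 == 0 by rewrite -E1 ?w1 // ler01 lexx.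
    by rewrite mulf_eq0 (negbTE u1) orbF => /eqP.
  exists (fun=> 0); rewrite big_ord0; split.
    by apply: ae01_all => y /in01/E1 ->; rewrite a0 mul0r.
  by apply: ae01_imp E2 _ => y _ ->; rewrite a0 mul0r.
have [eX eK] := fundamental_kernel F u1.
split.
  exists 1%N, (fun=> ((u : cfun R), (fun t : R => u t / (t%:C - c)) : cfun R)).
  split => // w wX wK; have [a [E1 E2]] := kernel_fundamental F wX wK.
  exists (fun=> a); rewrite big_ord1; split.
    by apply: ae01_all => y /in01/E1 ->.
  by apply: ae01_imp E2 _ => y _ ->.
(* Chosen so that the source - b g0 / (y - c)^2 of the data (0, g0) is the conjugate of u. Its
   pairing with u is the integral of |u|^2, which is positive, so subtracting a multiple of (0, g0)
   makes any data solvable. *)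
pose g0 : cfun R := fun y => - ((y%:C - c) ^+ 2 * (u y)^* / b).
have [[uc _ _ _] _] := fundamental_csol F.
have [c1 c2] := uc.
have cuc : ccont_on 0 1 (fun y => (u y)^*).
  split; first by apply: cont_on_ext c1 => y _; case: (u y).
  by apply: cont_on_ext (cont_onN c2) => y _; case: (u y).
have shc : ccont_on 0 1 (fun y : R => y%:C - c).
  by apply: ccont_onD; [exact: ccont_id|exact: ccont_cst].
have g0X : X (0, g0).
  split; first exact: (H2_dirichlet0).1.
  apply: L2_cont; apply: ccont_onN; apply: ccont_onM; last exact: ccont_cst.
  by apply: ccont_onM => //; apply: ccont_on_ext (ccont_onM shc shc) => y _; rewrite expr2.
exists 1%N, (fun=> (0, g0)); split => // w wX.
pose s : C := (ci (fun t => sqn (u t)) 1)%:C.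
have s0 : s != 0 by rewrite eq_complex /= eqxx andbT gt_eqF // (fundamental_norm_gt0 F).
have wi := L2_cint01 (L2_resolvent_rhs wX).
have uwi : cint01 (fun t => u t * resolvent_rhs w t) by exact: cint01M_cont.
pose a := cci (fun t => u t * resolvent_rhs w t) 1 / s.
pose w' : state R := (w.1, (fun y => w.2 y - a * g0 y) : cfun R).
have w'X : X w'.
  by case: wX => fH gL; split => //; apply: L2B => //; apply: L2Z; case: g0X.
have [|z [zX [h1 h2]]] := resolvent_solution F w'X.
  right; rewrite (@cci_ext _ _ (fun t => u t * resolvent_rhs w t + (- a) * (u t * (u t)^*))).
    have uui : cint01 (fun t => u t * (u t)^*) by apply: cint01_cont; exact: ccont_onM.
    rewrite cciD ?cciZ //; last by apply: cint01M_cont => //; exact: ccont_cst.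
    have -> : cci (fun t => u t * (u t)^*) 1 = s.
      apply: complexP; rewrite /cci /s /=.
        by apply: ci_ext => t _; rewrite cReM /sqn; case: (u t) => ? ? /=; ring.
      rewrite (@ci_ext _ _ (fun=> 0)); last first.
        by move=> t _; rewrite cImM; case: (u t) => ? ? /=; ring.
      by rewrite (@ci_FTC _ (fun=> 0) (fun=> 0)) ?subrr ?ler01 ?lexx //;
        try exact: cont_on_cst; move=> x _; exact: der_cst.
    by rewrite /a mulNr divfK // subrr.
  move=> y y01; rewrite /resolvent_rhs /w' /g0 /=.
  move: (Delta m w.1 y) (w.2 y) (u y) ((u y)^*) => x1 x2 x3 x4.
  move: (yc y01); move: (y%:C - c) => t t0.
  have b0 := b_neq0; move: b b0 => k k0.
  by field; rewrite k0 t0.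
exists z, (fun=> a); split => //; rewrite big_ord1; split.
  apply: ae01_imp h1 _ => y _ e.
  change (w.1 y = (Defs.shift L c z).1 y + a * 0).
  by rewrite e mulr0 addr0.
apply: ae01_imp h2 _ => y _ e.
change (w.2 y = (Defs.shift L c z).2 y + a * g0 y).
by rewrite e subrK.
Qed.

Lemma fundamental_eigenvalue u p v r : fundamental (q c) u p v r -> u 1 = 0 ->
  eigenvalues L c.
Proof.
move=> F u1; have [eX eK] := fundamental_kernel F u1.
exists ((u : cfun R), (fun t : R => u t / (t%:C - c)) : cfun R); split => //.
  move=> -[uz _]; have [us _] := fundamental_csol F; have [uc _ _ _] := us.
  have uz' := @ae_eq_ccont _ u (fun=> 0) uc (ccont_cst _ _ _) uz.
  have := csol_zero us (fun y y01 => uz' y (in01 y01)); case: F => _ _ [_ p0] _.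
  by move=> /(_ 0); rewrite p0 lexx ler01 => /(_ isT)/eqP; rewrite oner_eq0.
exact/eigen_shift.
Qed.

(** If u(1) is nonzero, L - c is injective and surjective; otherwise u is an eigenfunction. *)
Lemma spectrum_eigenvalue : spectrum L c -> eigenvalues L c.
Proof.
move=> cs; have [u [p [v [r F]]]] := fundamental_exists q_cont_at.
case: (eqVneq (u 1) 0) => u1; last first.
  exfalso; apply: cs; split; last first.
    by move=> w wX; apply: (resolvent_solution F wX); left.
  move=> w wX wK; have [a [E1 E2]] := kernel_fundamental F wX wK.
  have a0 : a = 0.
    have w1 : w.1 1 = 0 by case: wX => -[].
    have : a * u 1 == 0 by rewrite -E1 ?w1 // ler01 lexx.
    by rewrite mulf_eq0 (negbTE u1) orbF => /eqP.
  split; first by apply: ae01_all => y /in01/E1 ->; rewrite a0 mul0r.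
  by apply: ae01_imp E2 _ => y _ ->; rewrite a0 mul0r.
exact: fundamental_eigenvalue F u1.
Qed.

End fixed_c.

End outside_the_segment.

(** * On the segment: infinite codimension of the range *)

Section on_the_segment.
Context {R : realType}.
Local Notation C := R[i].
Local Notation mu := (@lebesgue_measure R).
Local Notation I := (@I01 R).
Implicit Types (x y s : R).

Lemma ci_ae_lower (f : R -> R) (a b K : R) : int01 f -> 0 <= a -> a < b -> b <= 1 ->
  ae01 (fun y => a < y < b -> K <= f y) -> K * (b - a) <= ci f b - ci f a.
Proof.
move=> fi a0 ab b1 fK.
have fib : mu.-integrable `[0, b] (EFin \o f) by exact: int01_sub.
rewrite [X in _ <= X]Rintegral_itvB ?bnd_simp //; last exact: ltW.
have Dm : @measurable _ (measurableTypeR R) `]a, b[%classic by exact: measurable_itv.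
have fio : mu.-integrable `]a, b[ (EFin \o f).
  apply: integrableS (int01_cc fi) => // x /=; rewrite !in_itv/= => /andP[? ?].
  by apply/andP; split; lra.
have fm : measurable_fun `]a, b[ f by case/integrableP : fio => /measurable_EFinP.
(* The truncation lies below [f] everywhere and equals K almost everywhere on (a, b), which turns
   the almost everywhere bound into a pointwise comparison. *)
pose g x := Num.min (f x) K.
have Ki : mu.-integrable `]a, b[ (EFin \o (fun=> K)).
  apply: integrableS (int01_cc (int01_cst K)) => // x /=; rewrite !in_itv/= => /andP[? ?].
  by apply/andP; split; lra.
have gm : measurable_fun `]a, b[ g by exact: measurable_minr.
have gi : mu.-integrable `]a, b[ (EFin \o g).
  apply: (le_integrable Dm _ _ (integrableD Dm (integrable_abse fio) (integrable_abse Ki))).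
    exact/measurable_EFinP.
  move=> x _; rewrite /= lee_fin /g /Num.min.
  rewrite [X in _ <= X]ger0_norm ?addr_ge0 //.
  by case: ifP => _; rewrite ?lerDl ?lerDr.
rewrite -Rintegral_itv_bndo_bndc //.
have -> : K * (b - a) = (\int[mu]_(x in `]a, b[) K)%R.
  have mE : mu `]a, b[%classic = (b - a)%:E.
    by rewrite lebesgue_measure_itv /= lte_fin ab.
  by rewrite Rintegral_cst //; congr (_ * _); exact: (esym (congr1 fine mE)).
apply: (@le_trans _ _ (\int[mu]_(x in `]a, b[) g x)%R).
  apply: eq_ler; rewrite /Rintegral; congr fine; apply: ae_eq_integral => //.
  - exact/measurable_EFinP.
  - apply: (@filterS _ _ (ae_filter_ringOfSetsType mu) _ _ _ fK) => x h.
    rewrite /= in_itv/= => xab; rewrite /g min_r //; apply: h => //.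
    by apply/I01P; case/andP : xab => ? ?; apply/andP; split; lra.
by apply: le_Rintegral => // x _; rewrite /g ge_min lexx.
Qed.

(* Scale of the shells, signed so that they lie in [0,1]. *)
Definition shell_dir s : R := if s < 1 then 1 - s else - 1.

Definition shell s (k : nat) : set R :=
  [set y | (2^-1) ^+ k.+1 < (y - s) / shell_dir s < (2^-1) ^+ k].

Lemma shellP s k y : shell s k y <->
  (2^-1) ^+ k.+1 < (y - s) / shell_dir s /\ (y - s) / shell_dir s < (2^-1) ^+ k.
Proof. by rewrite /shell /=; split => [/andP|[-> ->]]. Qed.

Lemma half_exp_gt0 k : (0 : R) < (2^-1) ^+ k.
Proof. by rewrite exprn_gt0 // invr_gt0. Qed.

Lemma half_exp_le1 k : (2^-1 : R) ^+ k <= 1.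
Proof. by rewrite exprn_ile1 ?invr_ge0 // invf_le1 // ler1n. Qed.

Lemma half_exp_le k l : (k <= l)%N -> (2^-1 : R) ^+ l <= (2^-1) ^+ k.
Proof. by move=> kl; apply: ler_wiXn2l => //; rewrite ?invr_ge0 // invf_le1 // ler1n. Qed.

Lemma shell_dir_bounds s : 0 <= s <= 1 ->
  [/\ shell_dir s != 0, `|shell_dir s| <= 1 & 0 <= s + shell_dir s <= 1].
Proof.
move=> /andP[s0 s1]; rewrite /shell_dir; case: ltP => [s1'|s1'].
  split; [by rewrite subr_eq0 gt_eqF|by rewrite ger0_norm; lra|by lra].
by split; [rewrite oppr_eq0 oner_eq0|rewrite normrN1|lra].
Qed.

Lemma shell_measurable s k : @measurable _ (measurableTypeR R) (shell s k).
Proof.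
have mf : measurable_fun setT (fun y : R => (y - s) / shell_dir s).
  by apply: measurable_funM => //; apply: measurable_funB.
have := mf measurableT `](2^-1) ^+ k.+1, (2^-1) ^+ k[%classic (measurable_itv _).
by rewrite setTI; congr measurable; apply/seteqP; split => x /=; rewrite in_itv.
Qed.

Lemma shell_disjoint s k l y : shell s k y -> shell s l y -> k = l.
Proof.
move=> /shellP[k1 k2] /shellP[l1 l2]; case: (ltngtP k l) => // kl.
  by exfalso; have := half_exp_le kl; lra.
by exfalso; have := half_exp_le kl; lra.
Qed.

Lemma shell_dist s k y : 0 <= s <= 1 -> shell s k y -> `|y - s| <= (2^-1) ^+ k.
Proof.
move=> s01 /shellP[k1 k2]; have [d0 d1 _] := shell_dir_bounds s01.
have -> : y - s = (y - s) / shell_dir s * shell_dir s by rewrite divfK.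
rewrite normrM; set t := (y - s) / _ in k1 k2 *.
have t0 : 0 <= t by have := half_exp_gt0 k.+1; lra.
by rewrite (ger0_norm t0) -[X in _ <= X]mulr1; apply: ler_pM => //; exact: ltW.
Qed.

Lemma shell_itv s k : 0 <= s <= 1 -> exists a b : R,
  [/\ 0 <= a, a < b, b <= 1, b - a = `|shell_dir s| * (2^-1) ^+ k.+1 &
      forall y, a < y < b -> shell s k y].
Proof.
move=> s01; have [d0 d1 sd] := shell_dir_bounds s01.
have h0 := half_exp_gt0 k.+1; have hk : (2^-1 : R) ^+ k = 2 * (2^-1) ^+ k.+1.
  by rewrite exprS mulrA divff ?mul1r.
have hk1 := half_exp_le1 k; set t := (2^-1) ^+ k.+1 in h0 hk *; rewrite hk in hk1.
set d := shell_dir s in d0 d1 sd *.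
have /andP[s0 s1] := s01; have /andP[sd0 sd1] := sd.
have [dp|dn|/eqP] := ltgtP d 0; last by rewrite (negbTE d0).
- have t1 : t * - d <= t * s by rewrite ler_pM2l //; lra.
  exists (s + d * (2 * t)), (s + d * t); rewrite ltr0_norm //; split.
  + have : (2 * t) * - d <= - d by rewrite ler_piMl //; lra.
    lra.
  + by have := mulr_gt0 h0 (_ : 0 < - d); rewrite oppr_gt0 => /(_ dp); lra.
  + have := mulr_gt0 h0 (_ : 0 < - d); rewrite oppr_gt0 => /(_ dp); lra.
  + by ring.
  + move=> y /andP[y1 y2]; apply/shellP; rewrite -/d -/t hk ltr_ndivlMr // ltr_ndivrMr //.
    by split; [move: y2|move: y1]; lra.
- exists (s + d * t), (s + d * (2 * t)); rewrite gtr0_norm //.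
  have := mulr_gt0 h0 dn; have : (2 * t) * d <= d by rewrite ler_piMl //; lra.
  move=> h1 h2; split; try lra.
  move=> y /andP[y1 y2]; apply/shellP; rewrite -/d -/t hk ltr_pdivlMr // ltr_pdivrMr //.
  by split; [move: y1|move: y2]; lra.
Qed.

(* [1/(y - s)] is not square integrable on any union of infinitely many shells. *)
Lemma singular_quotient_small s (rho phi : R -> C) (K : R) : 0 <= s <= 1 ->
  L2 (rho : cfun R) -> ae01 (fun y => (y%:C - s%:C) * rho y = phi y) -> 0 < K ->
  ~ (forall n, exists2 k, (n <= k)%N & forall y, shell s k y -> K <= sqn (phi y)).
Proof.
move=> s01 [_ _ ri] e K0 hK; have [d0 d1 sd] := shell_dir_bounds s01.
pose d : R := `|shell_dir s|; have dgt : 0 < d by rewrite normr_gt0.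
pose M := ci (fun y => sqn (rho y)) 1.
(* On the k-th shell |y - s|^2 <= 4^(-k), so |rho|^2 >= K 4^k over a length d 2^(-k-1): the integral
   over this shell alone grows like 2^k. *)
have step k : (forall y, shell s k y -> K <= sqn (phi y)) -> K * d * 2 ^+ k / 2 <= M.
  move=> hk; have [a [b [a0 ab b1 bE hab]]] := shell_itv k s01.
  have : K * 4 ^+ k * (b - a) <= ci (fun y => sqn (rho y)) b - ci (fun y => sqn (rho y)) a.
    apply: ci_ae_lower => //; apply: ae01_imp e _ => y _ ey yab.
    have sy := hab y yab; have := hk y sy; rewrite -ey sqnM => hh.
    have ys : sqn (y%:C - s%:C) <= (4^-1) ^+ k.
      have -> : sqn (y%:C - s%:C) = `|y - s| ^+ 2.
        by rewrite real_normK ?num_real // /sqn /= subr0 expr0n addr0.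
      have -> : (4^-1 : R) ^+ k = ((2^-1) ^+ k) ^+ 2.
        by rewrite -exprM mulnC exprM; congr (_ ^+ _); field.
      by rewrite lerXn2r ?nnegrE ?normr_ge0 ?(ltW (half_exp_gt0 k)) // shell_dist.
    have h4 : 0 < (4 : R) ^+ k by rewrite exprn_gt0.
    rewrite -ler_pdivlMr // -exprVn; apply: le_trans hh _.
    by rewrite mulrC ler_wpM2l // sqn_ge0.
  move=> h; apply: (@le_trans _ _ (K * 4 ^+ k * (b - a))).
    apply: eq_ler; rewrite bE -/d exprS exprVn.
    have -> : (4 : R) ^+ k = 2 ^+ k * 2 ^+ k by rewrite -exprMn; congr (_ ^+ _); ring.
    by field; rewrite expf_neq0.
  apply: le_trans h _; rewrite lerBlDr; apply: (@le_trans _ _ M).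
    by apply: ci_le1 => // x; exact: sqn_ge0.
  by rewrite lerDl; apply: Rintegral_ge0 => x _; exact: sqn_ge0.
have KdM : 0 < K * d by rewrite mulr_gt0.
pose n := Num.truncn (2 * M / (K * d)).
have [k nk hk] := hK n.+1.
have := step k hk; apply/negP; rewrite -ltNge.
have h1 : 2 * M / (K * d) < n.+1%:R by rewrite truncnS_gt.
have h2 : (n.+1%:R : R) <= 2 ^+ k.
  rewrite -natrX ler_nat; apply: leq_trans nk (ltnW (ltn_expl _ _)) => //.
move: h1; rewrite ltr_pdivrMr // => h1.
have : n.+1%:R * (K * d) <= 2 ^+ k * (K * d) by rewrite ler_pM2r.
by rewrite [K * d * _]mulrC; move: h1; lra.
Qed.

Lemma sqn_lower (z w : C) : sqn (w - z) <= sqn z / 4 -> sqn z / 4 <= sqn w.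
Proof.
move=> h; have := sqnD_le w (z - w); rewrite addrC subrK => hh.
have e : sqn (z - w) = sqn (w - z) by rewrite -opprB /sqn cReN cImN; ring.
by rewrite e in hh; have := sqn_ge0 z; lra.
Qed.

Lemma half_exp_cvg0 (e : R) : 0 < e -> exists n, forall k, (n <= k)%N -> (2^-1 : R) ^+ k < e.
Proof.
move=> e0; pose n := Num.truncn e^-1; exists n.+1 => k nk.
have h1 : e^-1 < n.+1%:R by rewrite truncnS_gt.
have h2 : (n.+1%:R : R) <= 2 ^+ k.
  rewrite -natrX ler_nat; apply: leq_trans nk (ltnW (ltn_expl _ _)) => //.
by rewrite exprVn invf_plt ?posrE ?exprn_gt0 //; apply: lt_le_trans h1 h2.
Qed.

Lemma ccont_on_near_point s (psi : R -> C) (e : R) : ccont_on 0 1 psi -> 0 <= s <= 1 -> 0 < e ->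
  exists2 dl : R, 0 < dl & forall y, 0 <= y <= 1 -> `|y - s| < dl -> sqn (psi y - psi s) <= e.
Proof.
move=> [c1 c2] s01 e0.
have aux (h : R -> R) : cont_on 0 1 h -> exists2 dl : R, 0 < dl &
    forall y, 0 <= y <= 1 -> `|y - s| < dl -> (h y - h s) ^+ 2 <= e / 2.
  move=> hc; pose r := Num.min 1 (e / 2).
  have r0 : 0 < r by rewrite lt_min ltr01; lra.
  have sI : `[0, 1]%classic s by rewrite /= in_itv.
  have /cvgrPdist_lt/(_ r r0) := (subspace_continuousP _ _).1 hc s sI.
  rewrite /within/= => -[dl /= dl0 hdl]; exists dl => // y y01 ys.
  have : `|h s - h y| < r.
    by apply: hdl; rewrite /= ?in_itv // distrC.
  rewrite distrC => hr; rewrite -real_normK ?num_real //.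
  have hr1 : `|h y - h s| <= 1 by apply: ltW; apply: lt_le_trans hr _; rewrite ge_min lexx.
  have hr2 : `|h y - h s| <= e / 2 by apply: ltW; apply: lt_le_trans hr _; rewrite ge_min lexx orbT.
  by apply: le_trans hr2; rewrite expr2 ler_piMl.
have [d1 d10 h1] := aux _ c1; have [d2 d20 h2] := aux _ c2.
exists (Num.min d1 d2); first by rewrite lt_min d10.
move=> y y01; rewrite lt_min => /andP[y1 y2]; rewrite /sqn !cReD !cImD !cReN !cImN.
by have := h1 y y01 y1; have := h2 y y01 y2; lra.
Qed.

Lemma shell_in01 s k y : 0 <= s <= 1 -> shell s k y -> 0 <= y <= 1.
Proof.
move=> s01 sy; have [d0 d1 sd] := shell_dir_bounds s01; have /shellP[k1 k2] := sy.
have h0 := half_exp_gt0 k.+1; have h1 := half_exp_le1 k.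
have -> : y = s + (y - s) / shell_dir s * shell_dir s by rewrite divfK // addrC subrK.
set t := (y - s) / shell_dir s in k1 k2 *.
move: (shell_dir s) sd => d /andP[sd0 sd1]; have /andP[s0 s1] := s01.
have -> : s + t * d = (1 - t) * s + t * (s + d) by ring.
have t0 : 0 <= t by lra.
have t1 : 0 <= 1 - t by lra.
have A := mulr_ge0 t1 s0; have B := mulr_ge0 t0 sd0.
have A' : (1 - t) * s <= (1 - t) * 1 by rewrite ler_wpM2l.
have B' : t * (s + d) <= t * 1 by rewrite ler_wpM2l.
by apply/andP; split; lra.
Qed.

(** If psi(s) + z were nonzero, continuity of psi would keep |psi + g| away from 0 on infinitely
    many shells near s, against the square integrability of rho. *)
Lemma singular_quotient_value s (psi rho g : R -> C) (z : C) : 0 <= s <= 1 ->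
  ccont_on 0 1 psi -> L2 (rho : cfun R) ->
  ae01 (fun y => (y%:C - s%:C) * rho y = psi y + g y) ->
  (forall n, exists2 k, (n <= k)%N & forall y, shell s k y -> g y = z) ->
  psi s + z = 0.
Proof.
move=> s01 pc rL e hg; apply/eqP; case: (eqVneq (psi s + z) 0) => // zn.
have zs : 0 < sqn (psi s + z) / 4 by rewrite divr_gt0 // sqn_gt0.
have [dl dl0 hdl] := ccont_on_near_point pc s01 zs.
have [n0 hn0] := half_exp_cvg0 dl0.
exfalso; apply: (singular_quotient_small s01 rL e zs) => n.
have [k nk hk] := hg (maxn n n0); move: nk; rewrite geq_max => /andP[nk n0k].
exists k => // y sy; apply: sqn_lower; rewrite (hk y sy).
have -> : psi y + z - (psi s + z) = psi y - psi s by ring.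
apply: hdl; first exact: shell_in01 sy.
by apply: le_lt_trans (shell_dist s01 sy) _; exact: hn0.
Qed.

Lemma L2_sum (n : nat) (f : 'I_n -> R -> C) : (forall i, L2 (f i : cfun R)) ->
  L2 ((fun y => \sum_(i < n) f i y) : cfun R).
Proof.
elim: n f => [|n IH] f fL.
  by rewrite (_ : (fun y => _) = fun=> 0); [exact: L2_cst|apply/funext => y; rewrite big_ord0].
rewrite (_ : (fun y => _) = fun y => f ord0 y + \sum_(i < n) f (lift ord0 i) y).
  by apply: L2D => //; exact: (IH (fun i => f (lift ord0 i))).
by apply/funext => y; rewrite big_ord_recl.
Qed.

Lemma ccont_sum (n : nat) (f : 'I_n -> R -> C) : (forall i, ccont_on 0 1 (f i)) ->
  ccont_on 0 1 (fun y => \sum_(i < n) f i y).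
Proof.
elim: n f => [|n IH] f fL.
  by rewrite (_ : (fun y => _) = fun=> 0); [exact: ccont_cst|apply/funext => y; rewrite big_ord0].
rewrite (_ : (fun y => _) = fun y => f ord0 y + \sum_(i < n) f (lift ord0 i) y).
  by apply: ccont_onD => //; exact: (IH (fun i => f (lift ord0 i))).
by apply/funext => y; rewrite big_ord_recl.
Qed.

Lemma ae01_forall (n : nat) (P : 'I_n -> R -> Prop) : (forall i, ae01 (P i)) ->
  ae01 (fun y => forall i, P i y).
Proof.
elim: n P => [|n IH] P hP; first by apply: ae01_all => y _ [].
apply: ae01_imp2 (hP ord0) (IH (fun i => P (lift ord0 i)) (fun i => hP _)) _ => y _ h0 h i.
by case: (unliftP ord0 i) => [j|] ->.
Qed.

Lemma sum_state_snd (n : nat) (a : 'I_n -> C) (e : 'I_n -> state R) y :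
  (\sum_(i < n) a i *: e i).2 y = \sum_(i < n) a i * (e i).2 y.
Proof.
elim: n a e => [|n IH] a e; first by rewrite !big_ord0.
by rewrite !big_ord_recl /= -(IH (fun i => a (lift ord0 i)) (fun i => e (lift ord0 i))).
Qed.

Lemma kernel_row (n : nat) (A : 'M[C]_(n.+1, n)) :
  exists2 l : 'rV[C]_n.+1, l != 0 & l *m A = 0.
Proof.
have : kermx A != 0.
  rewrite kermx_eq0 /row_free; apply/eqP => h.
  by have := rank_leq_col A; rewrite h ltnn.
case/rowV0Pn => l /sub_kermxP lA l0; by exists l.
Qed.

Section codimension.
Variables (beta : R) (m : nat).
Local Notation L := (Lop beta m).

(** If n states span a complement of the range, some nontrivial combination of n + 1 right-hand
    sides lies in the range. One more family of shells, on which all of them vanish, separates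
    psi(s) from the coefficients. *)
Lemma not_fredholm_on_segment s : 0 <= s <= 1 -> ~ fredholm (Defs.shift L s%:C).
Proof.
move=> s01 [_ [n [e [eX hw]]]].
(* Shells with index congruent to j modulo n + 2. The classes j < n + 1 carry the right-hand sides;
   the class n + 1 is kept free, and these vanish on it. *)
pose A (j : nat) : set R := \bigcup_k shell s (k * n.+2 + j)%N.
have Am j : @measurable _ (measurableTypeR R) (A j).
  by apply: bigcup_measurable => k _; exact: shell_measurable.
pose g (j : nat) : cfun R := fun y => (\1_(A j) y)%:C.
have gL j : L2 (g j).
  apply: (@L2_intro _ _ (fun=> 1)).
  - have : @measurable_fun _ _ (measurableTypeR R) (measurableTypeR R) I (\1_(A j)).
      exact: measurable_indic.
    by [].
  - exact: measurable_cst.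
  - exact: int01_cst.
  - move=> x _; rewrite /sqn /g /= expr0n addr0 indicE.
    by case: (_ \in _); rewrite ?expr1n ?expr0n //= ler01.
have gE i j k y : (i < n.+2)%N -> (j < n.+2)%N -> shell s (k * n.+2 + i)%N y ->
    g j y = (i == j)%:R.
  move=> il jl sy; rewrite /g indicE; case: (eqVneq i j) => [<-|ij].
    by rewrite mem_set //; exists k.
  rewrite memNset // => -[l _ sl]; have := shell_disjoint sy sl.
  move=> /(congr1 (modn^~ n.+2)); rewrite !modnMDl !modn_small // => ij'.
  by rewrite ij' eqxx in ij.
have ex (j : 'I_n.+1) : exists p : state R * ('I_n -> C),
    X p.1 /\ eqX (0, g j) (Defs.shift L s%:C p.1 + \sum_(i < n) p.2 i *: e i).
  have [|u [a [uX ua]]] := hw (0, g j); last by exists (u, a).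
  by split; [exact: (H2_dirichlet0).1|exact: gL].
have /choice[P hP] := ex.
pose u j := (P j).1; pose a j := (P j).2.
(* A row in the kernel of the coefficient matrix eliminates the states [e i] from the
   combination. *)
have [l l0 lA] := kernel_row (\matrix_(j < n.+1, i < n) a j i).
pose psi y := \sum_(j < n.+1) - l 0 j * (u j).1 y.
pose rho y := \sum_(j < n.+1) l 0 j * (u j).2 y.
have uX j : X (u j) by have [] := hP j.
have psic : ccont_on 0 1 (fun y => - psi y).
  apply: ccont_onN; apply: ccont_sum => j; apply: ccont_onM; first exact: ccont_cst.
  by have [[_ ? ? _ _] _] := uX j.
have rhoL : L2 (rho : cfun R).
  by apply: L2_sum => j; apply: L2Z; have [] := uX j.
have eq : ae01 (fun y => (y%:C - s%:C) * rho y = - psi y + \sum_(j < n.+1) l 0 j * g j y).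
  have all : ae01 (fun y => forall j : 'I_n.+1,
      g j y = (- (u j).1 y + y%:C * (u j).2 y - s%:C * (u j).2 y) +
              \sum_(i < n) a j i * (e i).2 y).
    apply: ae01_forall => j; have [_ [_ h2]] := hP j.
    by apply: ae01_imp h2 _ => y _ /= -> /=; rewrite -sum_state_snd.
  apply: ae01_imp all _ => y _ h.
  have -> : \sum_(j < n.+1) l 0 j * g j y =
      \sum_(j < n.+1) (- l 0 j * (u j).1 y + (y%:C - s%:C) * (l 0 j * (u j).2 y)) +
      \sum_(j < n.+1) \sum_(i < n) l 0 j * a j i * (e i).2 y.
    rewrite -big_split; apply: eq_bigr => j _; rewrite h mulrDr /=; congr (_ + _).
      by move: ((u j).1 y) ((u j).2 y) (l 0 j) => x1 x2 x3; ring.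
    by rewrite mulr_sumr; apply: eq_bigr => i _; rewrite mulrA.
  rewrite exchange_big /= [X in _ + (_ + X)]big1 ?addr0.
    by rewrite big_split /= -mulr_sumr addrA addNr add0r.
  move=> i _; rewrite -mulr_suml.
  have /matrixP/(_ 0 i) := lA; rewrite !mxE.
  under eq_bigr do rewrite mxE.
  by move=> ->; rewrite mul0r.
have vals i : (i < n.+2)%N ->
    - psi s + \sum_(j < n.+1) l 0 j * (i == j :> nat)%:R = 0.
  move=> il; apply: (singular_quotient_value s01 psic rhoL eq) => N.
  exists (N * n.+2 + i)%N; first by rewrite mulnS -addnA leq_addr.
  move=> y sy; apply: eq_bigr => j _; congr (_ * _); apply: gE sy => //.
  by rewrite ltnS ltnW // ltn_ord.
(* The free class n + 1 gives psi(s) = 0, after which the class j gives l_j = 0. *)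
have psi0 : - psi s = 0.
  have := vals n.+1 (ltnSn _); rewrite big1 ?addr0 // => j _.
  by rewrite gtn_eqF ?mulr0 // ltn_ord.
move/negP : l0; apply; apply/eqP/rowP => j; rewrite mxE.
have := vals j (ltnW (ltn_ord _)); rewrite psi0 add0r (bigD1 j) //= eqxx mulr1.
rewrite big1 ?addr0 // => k kj; rewrite (_ : (j == k :> nat) = false) ?mulr0 //.
by apply/negbTE; rewrite eq_sym.
Qed.

End codimension.

End on_the_segment.

(** * Absence of nonreal eigenvalues *)

Section nonreal.
Context {R : realType}.
Local Notation C := R[i].
Implicit Types (x y : R).
Variables (beta : R) (m : nat).
Hypotheses (beta_gt0 : 0 < beta) (m_ge1 : (1 <= m)%N).
Local Notation L := (Lop beta m).
Local Notation q := (taylor_goldstein beta m).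

Lemma eigen_csol (c : C) : (forall y, 0 <= y <= 1 -> y%:C - c != 0) -> eigenvalues L c ->
  exists f p, [/\ csol 0 1 (q c) f p, f 0 = 0, f 1 = 0 &
    ~ (forall y, 0 < y < 1 -> f y = 0)].
Proof.
move=> yc [w [wX wn /eigen_shift wK]].
have [p ws] := kernel_csol m_ge1 yc wX wK.
exists w.1, p; split => //; [by case: wX => -[]|by case: wX => -[]|move=> f0].
apply: wn; split; first exact: ae01_all.
move: wK; rewrite (shift_kernel_eq beta c m_ge1 wX) => -[_ h2].
apply: ae01_imp h2 _ => y y01; rewrite f0 // => /eqP; rewrite mulf_eq0.
by rewrite (negbTE (yc y (in01 y01))) => /eqP.
Qed.

Lemma sin_atan_cos (t : R) : sin (atan t) = t * cos (atan t) /\ 0 < cos (atan t).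
Proof.
have c0 : 0 < cos (atan t).
  by rewrite cos_gt0_pihalf // atan_gtNpi2 atan_ltpi2.
by split => //; rewrite -{2}(atanK t) /tan divfK // gt_eqF.
Qed.

Section fixed_c.
Variable c : C.
Hypothesis ic : Im c != 0.
Variable s : R.
Hypothesis sE : s = - Im c.
Let W (y : R) : C := y%:C - c.
Let Wb (y : R) : C := y%:C - c^*.

Let s0 : s != 0. Proof. by rewrite sE oppr_eq0. Qed.

Let WE y : W y = (y - Re c) +i* s.
Proof. by rewrite /W sE; case: c => a b; apply: complexP => /=; rewrite ?sub0r. Qed.

Let WbE y : Wb y = (y - Re c) +i* (- s).
Proof. by rewrite /Wb sE; case: c => a b; apply: complexP => /=; rewrite ?sub0r ?opprK. Qed.

Let W0 y : W y != 0.
Proof. by rewrite WE eq_complex /= negb_and s0 orbT. Qed.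

Let Wb0 y : Wb y != 0.
Proof. by rewrite WbE eq_complex /= negb_and oppr_eq0 s0 orbT. Qed.

(** The argument in (0, pi) of W / s. Dividing by s, which may be negative, treats both signs of Im
    c at once and changes E only by a constant phase. *)
Let theta y : R := pi / 2 - atan ((y - Re c) / s).

Let theta_der y : der theta y (- s / (s ^+ 2 + (y - Re c) ^+ 2)).
Proof.
have d1 : der (fun z => (z - Re c) / s) y s^-1.
  apply: der_eq; first exact: derM (derB (der_id y) (der_cst _ y)) (der_cst s^-1 y).
  by rewrite /=; ring.
have d2 := @der_comp _ atan (fun z => (z - Re c) / s) y _ _ (is_derive1_atan _) d1.
apply: der_eq; first exact: derB (der_cst (pi / 2) y) d2.
rewrite /=; set x := y - Re c.
have n1 : s ^+ 2 + x ^+ 2 != 0.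
  by rewrite gt_eqF // ltr_pwDl ?sqr_ge0 // lt_neqAle sqr_ge0 andbT eq_sym expf_neq0.
have n2 : 1 + (x / s) ^+ 2 != 0.
  by rewrite gt_eqF // ltr_pwDl ?sqr_ge0.
have -> : 1 + (x / s) ^+ 2 = (s ^+ 2 + x ^+ 2) / s ^+ 2 by field.
by field; rewrite s0 n1.
Qed.

Variable a : R.
Let E y : C := cos (2 * a * theta y) +i* sin (2 * a * theta y).

(** Follows from 2 i theta' = 1 / W - 1 / W^*, as E is the exponential of 2 i a theta. *)
Let E_der y : cder E y (a%:C * ((W y)^-1 - (Wb y)^-1) * E y).
Proof.
set k := - s / (s ^+ 2 + (y - Re c) ^+ 2).
have d : der (fun z => 2 * a * theta z) y (2 * a * k).
  by apply: der_eq; [exact: derM (der_cst (2 * a) y) (theta_der y)|rewrite /k mul0r add0r].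
have dc := @der_comp _ cos (fun z => 2 * a * theta z) y _ _ (is_derive_cos _) d.
have ds := @der_comp _ sin (fun z => 2 * a * theta z) y _ _ (is_derive_sin _) d.
have -> : (W y)^-1 - (Wb y)^-1 = 0 +i* (2 * k).
  rewrite WE WbE /k; set x := y - Re c.
  have n1 : s ^+ 2 + x ^+ 2 != 0.
    by rewrite gt_eqF // ltr_pwDl ?sqr_ge0 // lt_neqAle sqr_ge0 andbT eq_sym expf_neq0.
  have n2 : x ^+ 2 + s ^+ 2 != 0 by rewrite addrC.
  have n3 : x ^+ 2 + (- s) ^+ 2 != 0 by rewrite sqrrN.
  apply: complexP; rewrite ?cReD ?cImD ?cReN ?cImN ?cReV ?cImV /sqn /=.
    by rewrite sqrrN subrr.
  by rewrite sqrrN; field; rewrite ?n1 ?n2.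
split; [apply: der_eq dc _|apply: der_eq ds _]; rewrite ?cReM ?cImM /=; ring.
Qed.

Let theta_bounds y : 0 < theta y < pi.
Proof.
have := atan_ltpi2 ((y - Re c) / s); have := atan_gtNpi2 ((y - Re c) / s).
by rewrite /theta; lra.
Qed.

Hypotheses (a_gt0 : 0 < a) (a_le : a <= 1 / 2).
(** The second case makes [delta] vanish, and has a real solution a only for beta^2 <= 1/4. Above
    that value a = 1/2, the maximiser of a (1 - a), gives [delta] >= 0 and makes E a real multiple
    of W. *)
Hypothesis aE : (a = 1 / 2 /\ 1 / 4 <= beta ^+ 2) \/ a * (1 - a) = beta ^+ 2.

Let E_Im y : 0 < Im (E y).
Proof.
rewrite /E /=; apply: sin_gt0_pi; have /andP[t0 tpi] := theta_bounds y.
apply/andP; split; first by rewrite mulr_gt0 // mulr_gt0.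
have a1 : 2 * a <= 1 by move: a_le; lra.
by apply: le_lt_trans tpi; apply: ler_piMl a1; exact: ltW.
Qed.

Let delta : R := beta ^+ 2 - a * (1 - a).

(** For a = 1/2 one has E = k W with k real of the sign of s, so E / W^2 = k / W has imaginary part
    - k s / |W|^2 < 0. *)
Let excess_ge0 y : 0 <= - (delta * Im (E y / W y ^+ 2)).
Proof.
case: aE => [[ah b4]|ab]; last by rewrite /delta ab subrr mul0r oppr0.
have d0 : 0 <= delta.
  rewrite /delta ah; have -> : 1 / 2 * (1 - 1 / 2) = 1 / 4 :> R by field.
  by rewrite subr_ge0.
rewrite -mulrN mulr_ge0 // oppr_ge0.
pose t := (y - Re c) / s; have [st ct] := sin_atan_cos t.
have EW : E y = (cos (atan t) / s)%:C * W y.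
  have th : 2 * a * theta y = pi / 2 - atan t by rewrite ah /theta -/t; field.
  rewrite WE /E th; apply: complexP; rewrite ?cReM ?cImM /=.
    by rewrite cosB cos_pihalf sin_pihalf st /t; field.
  by rewrite sinB cos_pihalf sin_pihalf; field.
have -> : E y / W y ^+ 2 = (cos (atan t) / s)%:C * (W y)^-1.
  by rewrite EW; have := W0 y; move: (W y) (_%:C) => w k w0; field.
rewrite cImM cImV /= mul0r addr0 WE /=.
have -> : cos (atan t) / s * (- s / sqn ((y - Re c) +i* s)) =
   - (cos (atan t) / sqn ((y - Re c) +i* s)).
  by have n := W0 y; rewrite WE -sqn_eq0 in n; field; rewrite n.
by rewrite oppr_le0 divr_ge0 ?sqn_ge0 // ltW.
Qed.

(* With [W = y - c] and [E = (W / |W|)^{2a}], the function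
   [G = E f^* (f' - a f / W)] has derivative
   [E (|f' - a f / W|^2 + m^2 |f|^2) - (beta^2 - a (1 - a)) E |f|^2 / W^2]. *)
Lemma nonreal_csol_zero (f p : R -> C) : csol 0 1 (q c) f p -> f 0 = 0 -> f 1 = 0 ->
  forall y, 0 < y < 1 -> f y = 0.
Proof.
move=> [fc pc fd pd] f0 f1 y y01.
pose fb y := (f y)^*; pose pb y := (p y)^*.
have cconj g : ccont_on 0 1 g -> ccont_on 0 1 (fun y => (g y)^*).
  move=> [c1 c2]; split; first by apply: cont_on_ext c1 => z _; case: (g z).
  by apply: cont_on_ext (cont_onN c2) => z _; case: (g z).
have dconj g z d : cder g z d -> cder (fun y => (g y)^*) z d^*.
  move=> [d1 d2]; split; first by case: d d1 d2 => ? ? d1 _; apply: der_ext d1 => w; case: (g w).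
  by case: d d1 d2 => ? ? _ d2; apply: der_ext (derN d2) => w; case: (g w).
pose chi z := p z - a%:C * (f z / W z).
pose chib z := pb z - a%:C * (fb z / Wb z).
have chibE z : chib z = (chi z)^*.
  rewrite /chib /chi /pb /fb WE WbE; case: (p z) => p1 p2; case: (f z) => u v.
  by apply: complexP; rewrite /= ?sqrrN; ring.
pose G z := E z * fb z * chi z.
pose K z : C := (m%:R ^+ 2)%:C - delta%:C / W z ^+ 2.
pose dG z := E z * (chi z * chib z + fb z * f z * K z).
have dW z : cder W z 1 by exact: cder_shift.
have Gd z : 0 < z < 1 -> cder G z (dG z).
  move=> z01; apply: cder_eq.
    apply: cderM (cderM (E_der z) (dconj _ _ _ (fd z z01))) (cderB (pd z z01) _).
    exact: cderM (cder_cst _ z) (cderM (fd z z01) (cderV (W0 z) (dW z))).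
  have dE : (delta%:C : C) = (beta ^+ 2)%:C - a%:C * (1 - a%:C).
    by rewrite /delta; apply: complexP; rewrite /= ?oppr0; ring.
  rewrite /dG /K dE /chib /chi /taylor_goldstein -/(fb z) -/(pb z) -/(W z).
  cbv beta.
  rewrite -/(fb z) -/(pb z).
  move: (fb z) (pb z) (f z) (p z) (E z) (W z) (Wb z) (W0 z) (Wb0 z) => x1 x2 x3 x4 x5 x6 x7 h6 h7.
  move: ((m%:R ^+ 2)%:C) (a%:C) ((beta ^+ 2)%:C) => k1 k2 k3.
  by field; rewrite h6 h7.
have fW : cont_on 0 1 (fun y => Im (G y)).
  have Ec : ccont_on 0 1 E by apply: ccont_on_cder => w _; exact: E_der.
  have Wc : ccont_on 0 1 (fun y => (W y)^-1).
    by apply: ccont_on_cder => w _; exact: cderV (W0 w) (dW w).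
  have Gc : ccont_on 0 1 G.
    apply: ccont_onM; first by apply: ccont_onM => //; exact: cconj.
    apply: ccont_onD => //; apply: ccont_onN; apply: ccont_onM; first exact: ccont_cst.
    exact: ccont_onM.
  by case: Gc.
have ImdG z : Im (dG z) = Im (E z) * (sqn (chi z) + m%:R ^+ 2 * sqn (f z)) +
    sqn (f z) * - (delta * Im (E z / W z ^+ 2)).
  have e1 : chi z * chib z = (sqn (chi z))%:C.
    by rewrite chibE; case: (chi z) => u v; apply: complexP; rewrite /sqn /=; ring.
  have e2 : fb z * f z = (sqn (f z))%:C.
    by rewrite /fb; case: (f z) => u v; apply: complexP; rewrite /sqn /=; ring.
  have -> : dG z = E z * ((sqn (chi z))%:C + (sqn (f z))%:C * (m%:R ^+ 2)%:C) -
     (sqn (f z))%:C * (delta%:C * (E z / W z ^+ 2)).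
    by rewrite /dG /K e1 e2; have := W0 z; move: (W z) => w w0; field.
  by rewrite cImD cImN !cImM !cReD !cImD !cReM !cImM /=; ring.
have ge0 z : 0 <= Im (dG z).
  rewrite ImdG; apply: addr_ge0; last by rewrite mulr_ge0 ?sqn_ge0 ?excess_ge0.
  by rewrite mulr_ge0 ?(ltW (E_Im _)) // addr_ge0 ?sqn_ge0 // mulr_ge0 ?sqn_ge0 // sqr_ge0.
have G01 : Im (G 0) = Im (G 1).
  have fb0 : fb 0 = 0 by rewrite /fb f0; apply: complexP; rewrite /= ?oppr0.
  have fb1 : fb 1 = 0 by rewrite /fb f1; apply: complexP; rewrite /= ?oppr0.
  by rewrite /G fb0 fb1 !mulr0 !mul0r.
have := @der_ge0_eq0 _ 0 1 (fun z => Im (G z)) (fun z => Im (dG z))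
  (fun z z01 => (Gd z z01).2) fW (fun z _ => ge0 z) G01 y y01.
have Q0 : 0 <= sqn (chi y) + m%:R ^+ 2 * sqn (f y).
  by rewrite addr_ge0 ?sqn_ge0 // mulr_ge0 ?sqn_ge0 // sqr_ge0.
have EQ0 : 0 <= Im (E y) * (sqn (chi y) + m%:R ^+ 2 * sqn (f y)).
  by rewrite mulr_ge0 // ltW // E_Im.
have m0 : m%:R != 0 :> R by rewrite pnatr_eq0 -lt0n.
rewrite ImdG => /eqP; rewrite paddr_eq0 //; last by rewrite mulr_ge0 ?sqn_ge0 ?excess_ge0.
rewrite mulf_eq0 gt_eqF ?E_Im //= => /andP[+ _].
rewrite paddr_eq0 ?sqn_ge0 ?mulr_ge0 ?sqr_ge0 ?sqn_ge0 // => /andP[_].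
by rewrite mulf_eq0 sqrf_eq0 (negbTE m0) sqn_eq0 /= => /eqP.
Qed.

End fixed_c.

Lemma eigenvalue_real (c : C) : eigenvalues L c -> Im c = 0.
Proof.
move=> ce; apply/eqP; case: (eqVneq (Im c) 0) => // ic.
have yc y : 0 <= y <= 1 -> y%:C - c != 0.
  move=> _; rewrite subr_eq0; apply: contraNneq ic => <-; by rewrite /= eqxx.
have [f [p [fs f0 f1 fn]]] := eigen_csol yc ce.
exfalso; apply: fn => y y01.
have [b4|b4] := leP (1 / 4) (beta ^+ 2).
  apply: (@nonreal_csol_zero c ic _ erefl (1 / 2) _ _ _ f p) => //; left; split=> //.
(* 1/2 - r is the smaller root of a (1 - a) = beta^2; it is positive because beta is. *)
pose r := Num.sqrt (1 / 4 - beta ^+ 2).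
have r2 : r ^+ 2 = 1 / 4 - beta ^+ 2 by rewrite sqr_sqrtr //; lra.
have r0 : 0 <= r by exact: sqrtr_ge0.
have bb : 0 < beta ^+ 2 by rewrite exprn_gt0.
have rh : r < 1 / 2.
  have : r ^+ 2 < (1 / 2) ^+ 2.
    have -> : (1 / 2) ^+ 2 = 1 / 4 :> R by field.
    by rewrite r2; lra.
  by rewrite ltr_pXn2r ?nnegrE // divr_ge0.
apply: (@nonreal_csol_zero c ic _ erefl (1 / 2 - r) _ _ _ f p) => //; [lra|lra|right].
have -> : (1 / 2 - r) * (1 - (1 / 2 - r)) = 1 / 4 - r ^+ 2 by field.
by rewrite r2; ring.
Qed.

End nonreal.

(** * Real eigenvalues: Hardy's inequality and the far range *)

Section real_eigenvalues.
Context {R : realType}.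
Local Notation C := R[i].
Local Notation mu := (@lebesgue_measure R).
Implicit Types (x y s : R).

(** A derivative at the given point is wanted, although [h] agrees with the continuous [k] only
    almost everywhere and only on (a, b). Clamping extends [k] to the line, and the primitive of the
    difference is constant on (a, b). *)
Lemma ci_der_local (h k : R -> R) (a b x : R) : int01 h -> 0 <= a -> a < x < b -> b <= 1 ->
  (forall y, a <= y <= b -> {for y, continuous k}) ->
  ae01 (fun y => a < y < b -> h y = k y) -> der (ci h) x (k x).
Proof.
move=> hi a0 xab b1 kc hk; have /andP[ax xb] := xab.
pose cl y := Num.max a (Num.min b y).
have clE y : a <= y <= b -> cl y = y.
  by move=> /andP[? ?]; rewrite /cl min_r // max_r.
have clab y : a <= cl y <= b.
  by rewrite /cl le_max lexx /= ge_max ge_min lexx /= andbT; lra.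
have clc : continuous cl.
  move=> y; apply: (@cvg_max_real _ (fun=> a) (fun y => Num.min b y)); first exact: cvg_cst.
  by apply: (@cvg_min_real _ (fun=> b) (fun y => y)); [exact: cvg_cst|exact: cvg_id].
pose k' y := k (cl y).
have k'c : continuous k'.
  by move=> y; apply: (@continuous_comp _ _ _ cl k); [exact: clc|exact: kc].
have k'i : int01 k' by apply: int01_cont; exact: cont_on_continuous.
have di : int01 (fun y => h y - k' y) by exact: int01B.
have dE y : a < y < b -> ci (fun y => h y - k' y) y = ci (fun y => h y - k' y) a.
  move=> /andP[ay yb]; apply/eqP; rewrite eq_le -[X in X && _]subr_ge0 -[X in _ && X]subr_ge0.
  have z : ae01 (fun t => a < t < y -> h t - k' t = 0).
    apply: ae01_imp hk _ => t _ ht /andP[ta ty].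
    by rewrite ht /k' ?clE ?subrr //; apply/andP; split; lra.
  have y1 : y <= 1 by lra.
  apply/andP; split.
    have := @ci_ae_lower _ (fun y => - (h y - k' y)) a y 0 (int01N di) a0 ay y1.
    rewrite !ciN //; last by lra.
    rewrite mul0r opprK addrC; apply.
    by apply: ae01_imp z _ => t _ ht /ht ->; rewrite oppr0.
  have := @ci_ae_lower _ (fun y => h y - k' y) a y 0 di a0 ay y1.
  by rewrite mul0r; apply; apply: ae01_imp z _ => t _ ht /ht ->.
have x01 : 0 < x < 1 by apply/andP; split; lra.
have -> : k x = k' x by rewrite /k' clE //; apply/andP; split; lra.
apply: (@der_near _ (fun y => ci k' y + ci (fun y => h y - k' y) a)).
  apply: (near_open01 xab) => y yab; rewrite -(dE y yab) ciB //; first by ring.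
  by case/andP: yab; lra.
rewrite -[X in der _ _ X]addr0; apply: derD; last exact: der_cst.
by apply: ci_der => //; exact: k'c.
Qed.

(** Makes a solution vanishing at s of order |y - s|, as [singular_square_cont] requires. *)
Lemma lipschitz_der (a b M : R) (u p : R -> R) : cont_on a b u ->
  (forall y, a < y < b -> der u y (p y)) -> (forall y, a <= y <= b -> `|p y| <= M) ->
  forall y z, a <= y <= b -> a <= z <= b -> `|u y - u z| <= M * `|y - z|.
Proof.
move=> uc ud pM.
have main y z : a <= y -> y <= z -> z <= b -> `|u y - u z| <= M * (z - y).
  move=> ay yz zb.
  have sub t : y < t < z -> a < t < b by move=> /andP[? ?]; apply/andP; split; lra.
  have pMt t : y < t < z -> - M <= p t <= M.
    by move=> /sub/andP[? ?]; rewrite -ler_norml; apply: pM; apply/andP; split; lra.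
  have uc' : cont_on y z u by apply: cont_on_sub uc.
  have Mc : cont_on y z (fun t => M * t).
    by apply: cont_onM; [exact: cont_on_cst|apply: cont_on_continuous => t; exact: cvg_id].
  have Md t : der (fun t => M * t) t M.
    by apply: der_eq; [exact: derM (der_cst M t) (der_id t)|rewrite /=; ring].
  have h1 := @der_ge0_le _ y z (fun t => M * t - u t) (fun t => M - p t) yz
    (fun t tt => derB (Md t) (ud t (sub t tt))) (cont_onD Mc (cont_onN uc')).
  have h2 := @der_ge0_le _ y z (fun t => M * t + u t) (fun t => M + p t) yz
    (fun t tt => derD (Md t) (ud t (sub t tt))) (cont_onD Mc uc').
  have {}h1 : M * y - u y <= M * z - u z by apply: h1 => t /pMt/andP[]; lra.
  have {}h2 : M * y + u y <= M * z + u z by apply: h2 => t /pMt/andP[]; lra.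
  by rewrite ler_norml; apply/andP; split; rewrite mulrBr; lra.
move=> y z /andP[ay yb] /andP[az zb]; have [yz|zy] := leP y z.
  by rewrite [`|y - z|]distrC (ger0_norm (_ : 0 <= z - y)) ?subr_ge0 // main.
have yz0 : 0 <= y - z by lra.
by rewrite (ger0_norm yz0) distrC; apply: main => //; exact: ltW.
Qed.

(** Near s the function is bounded by |M| |u|, which tends to 0; its value at s is 0 since u(s) =
    0. *)
Lemma singular_square_cont (a b s M : R) (u : R -> R) : cont_on a b u ->
  (a <= s <= b -> u s = 0) ->
  (a <= s <= b -> forall y, a <= y <= b -> `|u y| <= M * `|y - s|) ->
  cont_on a b (fun y => (2 * (y - s))^-1 * u y ^+ 2).
Proof.
move=> uc us uM; apply/subspace_continuousP => x xab.
have xab' : a <= x <= b by move: xab; rewrite /= in_itv.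
have ux : u y @[y --> within `[a, b] (nbhs x)] --> u x.
  exact: (subspace_continuousP _ _).1 uc x xab.
change ((2 * (y - s))^-1 * u y ^+ 2 @[y --> within `[a, b] (nbhs x)] -->
  (2 * (x - s))^-1 * u x ^+ 2).
have [xs|xs] := eqVneq x s; last first.
  have invc : {for x, continuous (fun y : R => (2 * (y - s))^-1)}.
    apply: der_continuous; apply: derV; first by rewrite mulf_neq0 // subr_eq0.
    exact: derM (der_cst 2 x) (derB (der_id x) (der_cst s x)).
  apply: cvgM; first by apply: cvg_within_filter; exact: invc.
  by apply: cvgM; exact: ux.
move: xab' ux => {xab}; rewrite xs => sab ux; rewrite us // expr0n mulr0.
have M0 : 0 <= `|M| by [].
have bnd y : a <= y <= b -> `|(2 * (y - s))^-1 * u y ^+ 2| <= `|M| * `|u y|.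
  move=> yab; have [->|ys] := eqVneq y s; first by rewrite us // expr0n mulr0 !normr0 mulr0.
  have ys0 : 0 < `|y - s| by rewrite normr_gt0 subr_eq0.
  rewrite expr2 mulrA normrM ler_wpM2r // normrM normfV normrM (ger0_norm (_ : 0 <= 2)) //.
  rewrite mulrC ler_pdivrMr ?mulr_gt0 //.
  apply: le_trans (uM sab y yab) _; apply: le_trans (ler_norm _) _.
  by rewrite normrM normr_id mulrCA ler_peMl ?mulr_ge0 // ler1n.
apply/cvgrPdist_lt => e e0.
have eM : 0 < e / (`|M| + 1) by rewrite divr_gt0 //; lra.
have /cvgrPdist_lt/(_ _ eM) := ux; rewrite us // => hh.
near=> y.
have yab' : a <= y <= b.
  by near: y; rewrite near_withinE; apply: nearW => z /=; rewrite in_itv.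
have hy : `|0 - u y| < e / (`|M| + 1) by near: y.
move: hy; rewrite !sub0r !normrN => hy.
apply: le_lt_trans (bnd y yab') _.
move: hy; rewrite ltr_pdivlMr; last by lra.
by have := normr_ge0 (u y); lra.
Unshelve. all: by end_near. Qed.

Variables (beta : R) (m : nat).
Hypotheses (beta_gt0 : 0 < beta) (m_ge1 : (1 <= m)%N).
Local Notation L := (Lop beta m).
Local Notation q := (taylor_goldstein beta m).

Definition real_potential s y : R := m%:R ^+ 2 - beta ^+ 2 / (y - s) ^+ 2.

Lemma taylor_goldstein_real s y : q s%:C y = (real_potential s y)%:C.
Proof.
rewrite /taylor_goldstein /real_potential.
have -> : (y%:C - s%:C : C) = (y - s)%:C by apply: complexP; rewrite /= ?subr0.
have -> : ((y - s)%:C ^+ 2 : C) = ((y - s) ^+ 2)%:C by rewrite rmorphXn.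
have -> : ((beta ^+ 2)%:C / ((y - s) ^+ 2)%:C : C) = (beta ^+ 2 / (y - s) ^+ 2)%:C.
  exact: (esym (fmorph_div (real_complex R) _ _)).
by apply: complexP; rewrite /= ?subr0.
Qed.

Lemma real_complexE (c : C) : Im c = 0 -> c = (Re c)%:C.
Proof. by case: c => a b /= ->. Qed.

(** With g = 1 / (2 (y - s)), the coefficient q - g' - g^2 of the Riccati identity is m^2 + (1/4 -
    beta^2) / (y - s)^2, whence the threshold 1/4. If s is an end point, u(s) = 0 keeps u^2 / (y -
    s) continuous there. *)
Lemma hardy_zero (a b s : R) (u p : R -> R) : beta ^+ 2 <= 1 / 4 -> a <= b ->
  ~~ (a < s < b) -> cont_on a b u -> cont_on a b p ->
  (forall y, a < y < b -> der u y (p y)) ->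
  (forall y, a < y < b -> der p y (real_potential s y * u y)) ->
  u a = 0 -> u b = 0 -> (a <= s <= b -> u s = 0) ->
  forall y, a < y < b -> u y = 0.
Proof.
move=> b4 ab sab uc pc ud pd ua ub us.
have [M M0 hM] := cont_on_bounded ab pc.
have ys y : a < y < b -> y - s != 0.
  by move=> yab; rewrite subr_eq0; apply: contraNneq sab => <-.
apply: (@riccati_zero _ a b u p (real_potential s) (fun y => (2 * (y - s))^-1)
  (fun y => - (2 * (y - s) ^+ 2)^-1)) => //.
- move=> y yab; have ysn := ys y yab; apply: der_eq.
    apply: derV; first by rewrite mulf_neq0.
    exact: derM (der_cst 2 y) (derB (der_id y) (der_cst s y)).
  by rewrite /=; field.
- move=> y yab; have ysn := ys y yab; rewrite /real_potential.
  have -> : m%:R ^+ 2 - beta ^+ 2 / (y - s) ^+ 2 - - (2 * (y - s) ^+ 2)^-1 -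
      (2 * (y - s))^-1 ^+ 2 = m%:R ^+ 2 + (1 / 4 - beta ^+ 2) / (y - s) ^+ 2 by field.
  by rewrite ltr_pwDl ?exprn_gt0 ?ltr0n // divr_ge0 ?sqr_ge0 // subr_ge0.
- apply: cont_onD; first exact: cont_onM.
  apply: cont_onN; apply: (@singular_square_cont _ _ _ M) => // sab' y yab.
  by have := lipschitz_der uc ud hM yab sab'; rewrite us // subr0.
- by rewrite ua ub !mul0r expr0n !mulr0.
Qed.

Lemma ae01_neq s : ae01 (fun y => y != s).
Proof.
have h : {ae mu, forall y, ~ [set s] y}.
  exists [set s]; split => //; first exact: lebesgue_measure_set1.
  by move=> y /= /contrapT.
apply: (@filterS _ _ (ae_filter_ringOfSetsType mu) _ _ _ h) => y ys _.
exact/eqP.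
Qed.

(** Here s may lie in [0, 1], where the potential is singular: the derivative of psi stays
    continuous across s, while the second-order equation is recovered only off s. *)
Lemma kernel_regular s (w : state R) : X w -> eqX (Defs.shift L s%:C w) 0 ->
  exists2 p, ccont_on 0 1 p & forall y, 0 < y < 1 -> y != s ->
    cder w.1 y (p y) /\ cder p y ((real_potential s y)%:C * w.1 y).
Proof.
move=> wX; rewrite (shift_kernel_eq beta s%:C m_ge1 wX) => -[h1 h2]; have [wH _] := wX.
have [DL [p [pc fE pE]]] := H2_dirichlet_repr wH.
have [D1 D2i] := L2_cint01 DL; have pi := cint01_cont pc.
have fc : ccont_on 0 1 w.1 by case: wH.
pose k y := (real_potential s y)%:C * w.1 y.
have Dk : ae01 (fun y => y != s -> D2 w.1 y = k y).
  apply: ae01_imp2 h1 h2 _ => y _; rewrite DeltaE natrC /k -taylor_goldstein_real /taylor_goldstein.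
  have : y != s -> y%:C - s%:C != 0 :> C.
    by move=> ys; rewrite subr_eq0; apply: contraNneq ys => -[->].
  move: (D2 w.1 y) (w.1 y) (w.2 y) (y%:C - s%:C) => d f rho t t0' e1 e2 /t0' t0.
  move: e1; rewrite -e2 => /eqP; rewrite addr_eq0 => /eqP e1.
  apply: (mulfI t0); move: e1; rewrite mulrBr => /eqP; rewrite subr_eq => /eqP ->.
  by field.
exists p => // y y01 ys; split.
  apply: (@cder_near _ (cci p)); last by apply: cci_der => //; exact: ccont_on_at y01.
  by apply: (near_open01 y01) => z /in01/fE ->.
have kc z : 0 < z < 1 -> z != s -> ccont_at z k.
  move=> z01 zs; have [f1 f2] := ccont_on_at fc z01.
  have rc : {for z, continuous (real_potential s)}.
    apply: der_continuous; apply: derB; first exact: der_cst.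
    apply: derM; first exact: der_cst.
    apply: derV; first by rewrite expf_neq0 // subr_eq0.
    by apply: der_sqr; exact: derB (der_id z) (der_cst s z).
  split.
    have -> : (fun y => Re (k y)) = fun y => real_potential s y * Re (w.1 y).
      by apply/funext => t; rewrite /k cReM /= mul0r subr0.
    exact: cvgM rc f1.
  have -> : (fun y => Im (k y)) = fun y => real_potential s y * Im (w.1 y).
    by apply/funext => t; rewrite /k cImM /= mul0r addr0.
  exact: cvgM rc f2.
have [a [b [a0 yab b1 sab]]] : exists a b : R, [/\ 0 <= a, a < y < b, b <= 1 &
    forall z, a <= z <= b -> 0 < z < 1 /\ z != s].
  (* Half the distance from y to the nearest of s, 0 and 1. *)
  have /andP[y0 y1] := y01; pose dl := Num.min `|y - s| (Num.min y (1 - y)) / 2.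
  have dp : 0 < Num.min `|y - s| (Num.min y (1 - y)).
    by rewrite !lt_min normr_gt0 subr_eq0 ys y0 subr_gt0.
  have d1 : Num.min `|y - s| (Num.min y (1 - y)) <= `|y - s| by rewrite ge_min lexx.
  have d2 : Num.min `|y - s| (Num.min y (1 - y)) <= y by rewrite !ge_min lexx !orbT.
  have d3 : Num.min `|y - s| (Num.min y (1 - y)) <= 1 - y by rewrite !ge_min lexx !orbT.
  exists (y - dl), (y + dl); rewrite /dl; move: dp d1 d2 d3; set D := Num.min _ _ => dp d1 d2 d3.
  split; try lra.
  move=> z /andP[z1 z2]; split; first by apply/andP; split; lra.
  apply/eqP => zs; move: d1; rewrite -zs => d1.
  have : `|y - z| <= D / 2 by rewrite ler_norml; apply/andP; split; lra.
  by lra.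
have loc : ae01 (fun z => a < z < b -> D2 w.1 z = k z).
  apply: ae01_imp Dk _ => z _ hz /andP[za zb]; apply: hz.
  by have [] := sab z _; first by rewrite !ltW.
have dD : cder (cci (D2 w.1)) y (k y).
  split.
    apply: (ci_der_local (k := fun z => Re (k z)) D1 a0 yab b1).
      by move=> z /sab[z01 zs]; case: (kc z z01 zs).
    by apply: ae01_imp loc _ => z _ hz /hz ->.
  apply: (ci_der_local (k := fun z => Im (k z)) D2i a0 yab b1).
    by move=> z /sab[z01 zs]; case: (kc z z01 zs).
  by apply: ae01_imp loc _ => z _ hz /hz ->.
apply: (@cder_near _ (fun y => p 0 + cci (D2 w.1) y)).
  by apply: (near_open01 y01) => z /in01/pE ->.
by rewrite -[X in cder _ _ X]add0r; apply: cderD; [exact: cder_cst|].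
Qed.

Lemma no_real_eigenvalue (s : R) : beta ^+ 2 <= 1 / 4 -> ~ eigenvalues L s%:C.
Proof.
move=> b4 [w [wX wn /eigen_shift wK]]; apply: wn.
have [p [pc1 pc2] wd] := kernel_regular wX wK.
move: wK; rewrite (shift_kernel_eq beta s%:C m_ge1 wX) => -[_ h2].
have [[_ fc1 fc2 f0 f1] rhoL] := wX.
(* rho = psi / (y - s) is square integrable and every shell qualifies with g = 0. The resulting
   psi(s) = 0 splits the interval at s into two Dirichlet problems. *)
have fs : 0 <= s <= 1 -> w.1 s = 0.
  move=> s01; rewrite -[LHS]addr0; apply: (@singular_quotient_value _ s w.1 w.2 (fun=> 0) 0 s01 _ rhoL).
  - by split; [exact: fc1|exact: fc2].
  - by apply: ae01_imp h2 _ => y _ ->; rewrite addr0.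
  - by move=> n; exists n.
have ends (a b : R) : 0 <= a -> a <= b -> b <= 1 -> ~~ (a < s < b) -> w.1 a = 0 -> w.1 b = 0 ->
    forall y, a < y < b -> w.1 y = 0.
  move=> a0 ab b1 sab fa fb y yab.
  have sub z : a < z < b -> 0 < z < 1 /\ z != s.
    move=> zab; split; first by case/andP: zab => ? ?; apply/andP; split; lra.
    by apply: contraNneq sab => <-.
  have ss : a <= s <= b -> w.1 s = 0.
    by move=> /andP[? ?]; apply: fs; apply/andP; split; lra.
  have main (u r : R -> R) : cont_on 0 1 u -> cont_on 0 1 r ->
      (forall z, 0 < z < 1 -> z != s -> der u z (r z) /\
         der r z (real_potential s z * u z)) ->
      u a = 0 -> u b = 0 -> (a <= s <= b -> u s = 0) -> u y = 0.
    move=> uc rc ud ua ub us; apply: (@hardy_zero a b s u r) yab => //.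
    - exact: cont_on_sub uc.
    - exact: cont_on_sub rc.
    - by move=> z /sub[z01 zs]; case: (ud z z01 zs).
    - by move=> z /sub[z01 zs]; case: (ud z z01 zs).
  apply: complexP => /=.
    apply: (main _ _ fc1 pc1) => [z z01 zs|||/ss ->]; rewrite ?fa ?fb //.
    have [[d1 _] [d2 _]] := wd z z01 zs; split => //.
    by apply: der_eq d2 _; rewrite cReM /= mul0r subr0.
  apply: (main _ _ fc2 pc2) => [z z01 zs|||/ss ->]; rewrite ?fa ?fb //.
  have [[_ d1] [_ d2]] := wd z z01 zs; split => //.
  by apply: der_eq d2 _; rewrite cImM /= mul0r addr0.
have fz y : 0 < y < 1 -> w.1 y = 0.
  move=> y01; have [s01|s01] := boolP (0 < s < 1); last first.
    by apply: (ends 0 1).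
  have /andP[s0 s1] := s01; have /andP[y0 y1] := y01.
  have [ys|ys|->] := ltgtP y s; last by apply: fs; exact: in01.
    apply: (ends 0 s) => //; [exact: ltW|exact: ltW|by rewrite ltxx andbF|..].
      by apply: fs; exact: in01.
    by rewrite y0.
  apply: (ends s 1) => //; [exact: ltW|exact: ltW|by rewrite ltxx|..].
    by apply: fs; exact: in01.
  by rewrite ys.
split; first exact: ae01_all.
(* At y = s the equation (y - s) rho = 0 says nothing about rho, but this is a null set. *)
apply: ae01_imp2 h2 (ae01_neq s) _ => y y01 e ys; move: e; rewrite fz // => /eqP.
rewrite mulf_eq0 => /orP[|/eqP //]; rewrite subr_eq0 => /eqP[] e.
by rewrite e eqxx in ys.
Qed.

(** At distance more than beta / m from [0, 1] the potential is positive, so [csol_zero_pos]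
    applies. *)
Lemma no_far_eigenvalue (s : R) : s < - (beta / m%:R) \/ 1 + beta / m%:R < s ->
  ~ eigenvalues L s%:C.
Proof.
move=> sfar se; have m0 : 0 < m%:R :> R by rewrite ltr0n.
have bm : 0 < beta / m%:R by rewrite divr_gt0.
have far y : 0 <= y <= 1 -> beta / m%:R < `|y - s|.
  move=> /andP[y0 y1]; case: sfar => h; first by rewrite ger0_norm; lra.
  by rewrite ltr0_norm; lra.
have yc y : 0 <= y <= 1 -> y%:C - s%:C != 0 :> C.
  move=> /far ys; rewrite subr_eq0; apply/eqP => -[e].
  by move: ys; rewrite e subrr normr0; lra.
have [f [p [fs f0 f1 fn]]] := eigen_csol m_ge1 yc se.
apply: fn; apply: (@csol_zero_pos _ 0 1 (real_potential s) f p) => //.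
  by rewrite (_ : (fun y => (real_potential s y)%:C) = q s%:C) //; apply/funext => y;
    rewrite taylor_goldstein_real.
move=> y /in01/far ys; rewrite /real_potential subr_gt0.
have y2 : 0 < (y - s) ^+ 2.
  by rewrite -real_normK ?num_real // exprn_gt0 //; lra.
rewrite ltr_pdivrMr // -(real_normK (num_real (y - s))) -exprMn.
have lt0 : beta < m%:R * `|y - s| by move: ys; rewrite ltr_pdivrMr // mulrC.
by rewrite ltr_pXn2r ?nnegrE // ?mulr_ge0 // ltW.
Qed.

End real_eigenvalues.

(** * Oscillation at the singularity and the shooting function *)

Section oscillation.
Context {R : realType}.
Implicit Types (x y t : R) (f g u p : R -> R).

(** The quotient form covers both sides of x at once: f(x + h) has the sign of h. *)
Lemma der_sign f x d : der f x d -> f x = 0 -> 0 < d ->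
  exists2 e : R, 0 < e & forall h, h != 0 -> `|h| < e -> 0 < h^-1 * f (x + h).
Proof.
move=> [fd fE] fx d0; have /cvgrPdist_lt/(_ d d0) : h^-1 *: ((f \o shift x) (h *: (1 : R)) - f x) @[h --> (0 : R)^'] --> d.
  by rewrite -fE; exact: fd.
rewrite near_withinE => /nbhs_ballP[e /= e0 he]; exists e => // h h0 hE.
have := he h; rewrite /ball /= sub0r normrN => /(_ hE h0).
rewrite fx subr0 /GRing.scale/= mulr1 [h + x]addrC => hh.
have := ltr_normlW hh; lra.
Qed.

(** z is the infimum of the points where f <= 0: f is positive before z, and a positive slope at z
    would make it negative just before. *)
Lemma down_crossing f p (a b : R) : a < b -> (forall x, a <= x <= b -> der f x (p x)) ->
  0 < f a -> f b < 0 -> exists z, [/\ a < z, z < b, f z = 0 & p z <= 0].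
Proof.
move=> ab fd fa fb; pose S := [set x | a <= x <= b /\ f x <= 0].
have Sb : S b by split; [rewrite lexx ltW|exact: ltW].
have Sinf : has_inf S by split; [exists b|exists a => x [/andP[]]].
have lbS x : S x -> inf S <= x by move=> Sx; exact: (ge_inf Sinf.2).
have aS : a <= inf S by apply: lb_le_inf; [exists b|move=> x [/andP[]]].
have Sle : inf S <= b by exact: lbS.
set z := inf S in lbS aS Sle *.
have zab : a <= z <= b by rewrite aS.
have fc : {for z, continuous f} := der_continuous (fd z zab).
have fz1 : f z <= 0.
  rewrite leNgt; apply/negP => fz.
  have /cvgrPdist_lt/(_ _ fz)/nbhs_normP[e /= e0 he] := fc.
  have [x [xab fx] xe] := inf_adherent e0 Sinf.
  have zx : z <= x by exact: lbS.
  have : `|f z - f x| < f z.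
    by apply: he; rewrite /= ler0_norm; move: xe; rewrite -/z; lra.
  by move/ltr_normlW; lra.
have az : a < z.
  by rewrite lt_neqAle aS andbT; apply: contraTneq fa => ->; rewrite -leNgt.
have pos x : a <= x -> x < z -> 0 < f x.
  move=> ax xz; rewrite ltNge; apply/negP => fx.
  by have := lbS x (conj _ fx); rewrite ax /= => /(_ _); move: xz; lra.
have fz : f z = 0.
  apply/eqP; rewrite eq_le fz1 /= leNgt; apply/negP => fz.
  have nfz : 0 < - f z by rewrite oppr_gt0.
  have /cvgrPdist_lt/(_ _ nfz)/nbhs_normP[e /= e0 he] := fc.
  pose x := Num.max a (z - e / 2).
  have xz : x < z by rewrite gt_max az; lra.
  have fx : 0 < f x by apply: pos => //; rewrite le_max lexx.
  have : `|f z - f x| < - f z.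
    apply: he; rewrite /= ger0_norm; last by lra.
    by have : z - e / 2 <= x by [rewrite le_max lexx orbT]; lra.
  by rewrite distrC => /ltr_normlW; lra.
exists z; split => //.
  by rewrite lt_neqAle Sle andbT; apply: contraTneq fb => <-; rewrite fz ltxx.
rewrite leNgt; apply/negP => pz.
have [e e0 he] := der_sign (fd z zab) fz pz.
pose h := - Num.min (e / 2) (z - a).
have h0 : 0 < Num.min (e / 2) (z - a) by rewrite lt_min; apply/andP; split; lra.
have hz : h != 0 by rewrite oppr_eq0 gt_eqF.
have hle : `|h| < e.
  rewrite normrN gtr0_norm //; have : Num.min (e / 2) (z - a) <= e / 2 by rewrite ge_min lexx.
  by lra.
have := he h hz hle.
have fzh : 0 < f (z + h).
  apply: pos; rewrite /h; last by lra.
  have : Num.min (e / 2) (z - a) <= z - a by rewrite ge_min lexx orbT.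
  by lra.
rewrite pmulr_lgt0 // invr_gt0 /h; lra.
Qed.

Variables (beta : R) (m : nat).
Hypotheses (beta_gt0 : 0 < beta) (m_ge1 : (1 <= m)%N) (beta_gt : 1 / 4 < beta ^+ 2).

Definition potential x : R := m%:R ^+ 2 - beta ^+ 2 / x ^+ 2.

Definition solves f p := forall x, 0 < x -> der f x (p x) /\ der p x (potential x * f x).

(* The substitution [f x = sqrt x * g (ln x)] removes the singularity at 0. *)
Lemma solves_exists (a b : R) : exists f p, [/\ solves f p, f 1 = a & p 1 = b].
Proof.
(* At s = ln x one finds x^2 f'' = sqrt x (g'' - g / 4), so g'' = k g with k = x^2 [potential] +
   1/4, which is regular on the whole line. *)
pose k (s : R) : R := m%:R ^+ 2 * expR (2 * s) - (beta ^+ 2 - 1 / 4).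
have kc : continuous k.
  move=> s; apply: (@der_continuous _ k s); apply: derB; last exact: der_cst.
  by apply: derM; [exact: der_cst|exact: der_expR_lin].
pose A (i j : 'I_2) : R -> R :=
  match val i, val j with 0%N, 1%N => fun=> 1 | 1%N, 0%N => k | _, _ => fun=> 0 end.
have Ac i j : continuous (A i j).
  by move=> s; rewrite /A; case: i j => [[|[|i]] hi] [[|[|j]] hj] //=;
    try exact: cvg_cst; exact: kc.
(* f'(1) = g(0) / 2 + g'(0), hence the initial slope b - a / 2 for g. *)
pose b0 (i : 'I_2) : R := if val i == 0%N then a else b - a / 2.
have [Y hY] := linear_system_solution b0 Ac.
pose g := Y ord0; pose h := Y ord_max.
have g0 : g 0 = a by rewrite /g (hY ord0).1.
have h0 : h 0 = b - a / 2 by rewrite /h (hY ord_max).1.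
have l1 : lift ord0 ord0 = ord_max :> 'I_2 by exact/val_inj.
have gd s : der g s (h s).
  apply: der_eq ((hY ord0).2 s) _.
  by rewrite !big_ord_recl big_ord0 l1 /A /= mul0r mul1r addr0 add0r.
have hd s : der h s (k s * g s).
  apply: der_eq ((hY ord_max).2 s) _.
  by rewrite !big_ord_recl big_ord0 l1 /A /= mul0r !addr0.
pose E x := expR (2^-1 * ln x).
have Ed x : 0 < x -> der E x (2^-1 * x^-1 * E x).
  move=> x0; apply: der_eq.
    exact: (@der_comp _ expR (fun x => 2^-1 * ln x) x _ _ (is_derive_expR _)
      (derM (der_cst 2^-1 x) (is_derive1_ln x0))).
  by rewrite /E /=; ring.
pose f x := E x * g (ln x).
pose p x := x^-1 * (E x * (g (ln x) / 2 + h (ln x))).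
have gld x : 0 < x -> der (fun x => g (ln x)) x (h (ln x) * x^-1).
  by move=> x0; exact: (der_comp (gd _) (is_derive1_ln x0)).
have hld x : 0 < x -> der (fun x => h (ln x)) x (k (ln x) * g (ln x) * x^-1).
  by move=> x0; exact: (der_comp (hd _) (is_derive1_ln x0)).
exists f, p; split.
- move=> x x0; have xn : x != 0 by rewrite gt_eqF.
  split.
    apply: der_eq; first exact: derM (Ed x x0) (gld x x0).
    by rewrite /p; field.
  apply: der_eq.
    apply: derM (derV xn (der_id x)) (derM (Ed x x0) (derD _ (hld x x0))).
    exact: derM (gld x x0) (der_cst 2^-1 x).
  rewrite /f /potential /k.
  have -> : expR (2 * ln x) = x ^+ 2.
    by rewrite expRM_natl lnK.
  by rewrite /=; field.
- by rewrite /f /E ln1 mulr0 expR0 g0 mul1r.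
- by rewrite /p /E ln1 mulr0 expR0 g0 h0 invr1; field.
Qed.

Lemma solves_opp f p : solves f p -> solves (fun x => - f x) (fun x => - p x).
Proof.
by move=> fs x /fs[d1 d2]; split; [exact: derN|apply: der_eq (derN d2) _; rewrite mulrN].
Qed.

Lemma solves_comb (a b : R) f p g r : solves f p -> solves g r ->
  solves (fun x => a * f x + b * g x) (fun x => a * p x + b * r x).
Proof.
move=> fs gs x x0; have [f1 f2] := fs x x0; have [g1 g2] := gs x x0; split.
  apply: der_eq; first exact: derD (derM (der_cst a x) f1) (derM (der_cst b x) g1).
  by rewrite /=; ring.
apply: der_eq; first exact: derD (derM (der_cst a x) f2) (derM (der_cst b x) g2).
by rewrite /=; ring.
Qed.

(* [r = x f' / f] satisfies [x r' = - (r - 1/2)^2 - (beta^2 - 1/4 - m^2 x^2)],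
   which forces a blow-up on a long enough logarithmic interval. *)
Lemma solves_zero f p (a b : R) : solves f p -> 0 < a -> a < b ->
  m%:R ^+ 2 * b ^+ 2 <= (beta ^+ 2 - 1 / 4) / 2 ->
  pi <= Num.sqrt ((beta ^+ 2 - 1 / 4) / 2) * (ln b - ln a) ->
  exists x, a <= x <= b /\ f x = 0.
Proof.
move=> fs a0 ab mb lnab; apply: contrapT => nz.
have fn x : a <= x <= b -> f x != 0.
  by move=> xab; apply/eqP => fx; apply: nz; exists x.
set K := (beta ^+ 2 - 1 / 4) / 2 in mb lnab; have K0 : 0 < K by rewrite divr_gt0 // subr_gt0.
set k := Num.sqrt K in lnab; have k0 : 0 < k by rewrite sqrtr_gt0.
have k2 : k ^+ 2 = K by rewrite sqr_sqrtr // ltW.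
pose r x := x * p x / f x.
have xpos x : a <= x -> 0 < x by lra.
pose dr x := - ((r x - 2^-1) ^+ 2 + (beta ^+ 2 - 1 / 4 - m%:R ^+ 2 * x ^+ 2)) / x.
have rd x : a <= x <= b -> der r x (dr x).
  move=> xab; have /andP[ax xb] := xab; have x0 := xpos x ax.
  have [d1 d2] := fs x x0; have fx := fn x xab; have xn : x != 0 by rewrite gt_eqF.
  apply: der_eq; first exact: derM (derM (der_id x) d2) (derV fx d1).
  by rewrite /dr /r /potential /=; field; rewrite fx xn.
(* G is nondecreasing because k^2 = K <= beta^2 - 1/4 - m^2 x^2 on [a, b]. Two arctangents differ by
   less than pi, so k (ln b - ln a) would be below pi. *)
pose G x := - (k * ln x) - atan ((r x - 2^-1) / k).
pose dG x := - (k * x^-1) - (1 + ((r x - 2^-1) / k) ^+ 2)^-1 * (dr x / k).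
have Gd x : a <= x <= b -> der G x (dG x).
  move=> xab; have /andP[ax xb] := xab; have x0 := xpos x ax.
  have d1 : der (fun x => (r x - 2^-1) / k) x (dr x / k).
    apply: der_eq; first exact: derM (derB (rd x xab) (der_cst 2^-1 x)) (der_cst k^-1 x).
    by rewrite /=; ring.
  have d2 := @der_comp _ atan (fun x => (r x - 2^-1) / k) x _ _ (is_derive1_atan _) d1.
  apply: der_eq; first exact: derB (derN (derM (der_cst k x) (is_derive1_ln x0))) d2.
  by rewrite /dG /=; ring.
have Gc : cont_on a b G by apply: cont_on_der => x; exact: Gd.
have sub x : a < x < b -> a <= x <= b by move=> /andP[/ltW -> /ltW].
have dG0 x : a < x < b -> 0 <= dG x.
  move=> /[dup] /sub xab /andP[ax xb]; have x0 := xpos x (ltW ax).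
  rewrite /dG /dr; set z := r x - 2^-1.
  have kz : 0 < k ^+ 2 + z ^+ 2 by rewrite ltr_pwDl ?sqr_ge0 // exprn_gt0.
  have xn : x != 0 by rewrite gt_eqF.
  have kn : k != 0 by rewrite gt_eqF.
  have kzn : k ^+ 2 + z ^+ 2 != 0 by rewrite gt_eqF.
  have -> : - (k / x) - (1 + (z / k) ^+ 2)^-1 *
      (- (z ^+ 2 + (beta ^+ 2 - 1 / 4 - m%:R ^+ 2 * x ^+ 2)) / x / k) =
      k / x / (k ^+ 2 + z ^+ 2) * (beta ^+ 2 - 1 / 4 - m%:R ^+ 2 * x ^+ 2 - k ^+ 2).
    have -> : 1 + (z / k) ^+ 2 = (k ^+ 2 + z ^+ 2) / k ^+ 2 by field.
    by field; rewrite kzn kn xn.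
  apply: mulr_ge0; first by rewrite divr_ge0 ?ltW // divr_gt0.
  have : m%:R ^+ 2 * x ^+ 2 <= m%:R ^+ 2 * b ^+ 2.
    by rewrite ler_wpM2l ?sqr_ge0 // lerXn2r ?nnegrE ?ltW //; lra.
  by move: mb; rewrite k2 /K; lra.
have := der_ge0_le (ltW ab) (fun x xab => Gd x (sub x xab)) Gc dG0.
rewrite /G; have := atan_ltpi2 ((r a - 2^-1) / k); have := atan_gtNpi2 ((r b - 2^-1) / k).
have := atan_gtNpi2 ((r a - 2^-1) / k); have := atan_ltpi2 ((r b - 2^-1) / k).
by move: lnab; rewrite mulrBr; lra.
Qed.

Lemma zero_below f p (d : R) : solves f p -> 0 < d -> exists x, 0 < x < d /\ f x = 0.
Proof.
move=> fs d0; pose K := (beta ^+ 2 - 1 / 4) / 2; have K0 : 0 < K by rewrite divr_gt0 // subr_gt0.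
have m0 : 0 < m%:R :> R by rewrite ltr0n.
(* The bound sqrt K / m gives m^2 b^2 <= K; [a] is then placed at logarithmic distance exactly pi /
   sqrt K below [b]. *)
pose b := Num.min (d / 2) (Num.sqrt K / m%:R).
have sK : 0 < Num.sqrt K by rewrite sqrtr_gt0.
have b0 : 0 < b by rewrite lt_min !divr_gt0.
have bd : b < d by apply: (@le_lt_trans _ _ (d / 2)); [rewrite ge_min lexx|lra].
have mb : m%:R ^+ 2 * b ^+ 2 <= K.
  have : m%:R * b <= Num.sqrt K.
    by rewrite mulrC -ler_pdivlMr // ge_min lexx orbT.
  rewrite -exprMn -[X in _ -> _ <= X](sqr_sqrtr (ltW K0)) => h.
  by rewrite lerXn2r ?nnegrE ?mulr_ge0 // ltW.
pose a := expR (ln b - pi / Num.sqrt K).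
have a0 : 0 < a by exact: expR_gt0.
have lna : ln a = ln b - pi / Num.sqrt K by rewrite expRK.
have ab : a < b by rewrite -(lnK b0) ltr_expR gtrBl divr_gt0 // pi_gt0.
have [|x [/andP[ax xb] fx]] := solves_zero fs a0 ab mb.
  by rewrite lna subKr mulrC divfK ?lexx // gt_eqF.
exists x; split => //; apply/andP; split; lra.
Qed.

Lemma wronskian_solves f p g r (c : R) : solves f p -> solves g r ->
  f 1 * r 1 - p 1 * g 1 = c -> forall x, 0 < x -> f x * r x - p x * g x = c.
Proof.
move=> fs gs <- x x0.
have Wd y : 0 < y -> der (fun y => f y * r y - p y * g y) y 0.
  move=> y0; have [f1 f2] := fs y y0; have [g1 g2] := gs y y0.
  by apply: der_eq; [exact: derB (derM f1 g2) (derM f2 g1)|ring].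
have Wc a b : 0 < a -> cont_on a b (fun y => f y * r y - p y * g y).
  by move=> a0; apply: (cont_on_der (df := fun=> 0)) => y /andP[ay _]; apply: Wd; lra.
have eqW a b y z : 0 < a -> a <= y <= b -> a <= z <= b ->
    f y * r y - p y * g y = f z * r z - p z * g z.
  move=> a0 yab zab; have h := @der0_cst _ a b (fun y => f y * r y - p y * g y).
  have {}h : forall t, a <= t <= b -> f t * r t - p t * g t = f a * r a - p a * g a.
    by apply: h => [t /andP[at_ _]|]; [apply: Wd; lra|exact: Wc].
  by rewrite (h y) // (h z).
have [x1|x1] := leP x 1; first by apply: (eqW x 1) => //; rewrite lexx x1.
by apply: (eqW 1 x) => //; rewrite lexx ltW.
Qed.

Section shooting.
Variables (f1 p1 f2 p2 : R -> R).
Hypotheses (s1 : solves f1 p1) (s2 : solves f2 p2).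
Hypotheses (f11 : f1 1 = 0) (p11 : p1 1 = 1) (f21 : f2 1 = 1) (p21 : p2 1 = 0).

(** With the Wronskian -1, this is minus the value at 1 + t of the solution that vanishes at t with
    slope 1. *)
Definition shooting t : R := f1 t * f2 (1 + t) - f2 t * f1 (1 + t).

Let W x : 0 < x -> f1 x * p2 x - p1 x * f2 x = - 1.
Proof. by apply: wronskian_solves => //; rewrite f11 p11 f21 p21; ring. Qed.

Lemma shooting_der t : 0 < t -> der shooting t
  (p1 t * f2 (1 + t) + f1 t * p2 (1 + t) - (p2 t * f1 (1 + t) + f2 t * p1 (1 + t))).
Proof.
move=> t0; have t1 : 0 < 1 + t by lra.
have sh f p : solves f p -> der (fun t => f (1 + t)) t (p (1 + t)).
  move=> fs; have [d _] := fs _ t1; apply: der_eq.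
    exact: (@der_comp _ f (fun t => 1 + t) t _ _ d (derD (der_cst 1 t) (der_id t))).
  by rewrite add0r mulr1.
have [d1 _] := s1 t0; have [d2 _] := s2 t0.
exact: derB (derM d1 (sh _ _ s2)) (derM d2 (sh _ _ s1)).
Qed.

(** H = [potential] f^2 - p^2 has derivative [potential]' f^2 >= 0 and reduces to - p^2 where f
    vanishes. Equality would force f = 0 between t and 1 + t, against the positive slope at t. *)
Lemma energy_decreases f p t : solves f p -> 0 < t -> f t = 0 -> f (1 + t) = 0 ->
  0 < p t -> p (1 + t) ^+ 2 < p t ^+ 2.
Proof.
move=> fs t0 ft ft1 pt.
pose H x := potential x * f x ^+ 2 - p x ^+ 2.
pose dH x := 2 * beta ^+ 2 / x ^+ 3 * f x ^+ 2.
have Hd x : 0 < x -> der H x (dH x).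
  move=> x0; have [d1 d2] := fs x x0; have xn : x != 0 by rewrite gt_eqF.
  have x2n : x ^+ 2 != 0 by rewrite expf_neq0.
  have dp : der potential x (2 * beta ^+ 2 / x ^+ 3).
    apply: der_eq.
      exact: derB (der_cst (m%:R ^+ 2) x) (derM (der_cst (beta ^+ 2) x)
        (@derV _ (fun x => x ^+ 2) _ _ x2n (der_sqr (der_id x)))).
    by rewrite /=; field.
  apply: der_eq; first exact: derB (derM dp (der_sqr d1)) (der_sqr d2).
  by rewrite /dH; ring.
have dHp x : 0 < x -> 0 <= dH x.
  by move=> x0; rewrite mulr_ge0 ?sqr_ge0 // divr_ge0 ?exprn_ge0 ?mulr_ge0 ?sqr_ge0 // ltW.
have tt : t <= 1 + t by lra.
have Hc : cont_on t (1 + t) H.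
  by apply: cont_on_der => x /andP[tx _]; apply: Hd; lra.
have pos x : t < x < 1 + t -> 0 < x by move=> /andP[? _]; lra.
have le : p (1 + t) ^+ 2 <= p t ^+ 2.
  have := der_ge0_le tt (fun x xt => Hd x (pos x xt)) Hc (fun x xt => dHp x (pos x xt)).
  by rewrite /H ft ft1 expr0n !mulr0 !sub0r lerN2.
rewrite lt_neqAle le andbT; apply/eqP => e.
have fz x : t < x < 1 + t -> f x = 0.
  move=> xt; have Hab : H t = H (1 + t) by rewrite /H ft ft1 e expr0n !mulr0.
  have := der_ge0_eq0 (fun x xt => Hd x (pos x xt)) Hc (fun x xt => dHp x (pos x xt)) Hab xt.
  have x0 := pos x xt; move/eqP; rewrite /dH mulf_eq0 sqrf_eq0 => /orP[|/eqP //].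
  by rewrite gt_eqF // divr_gt0 ?exprn_gt0 // mulr_gt0 ?exprn_gt0.
have [d1 _] := fs t t0; have [eps e0 he] := der_sign d1 ft pt.
pose h := Num.min (eps / 2) (2^-1).
have h0 : 0 < h by rewrite lt_min; apply/andP; split; lra.
have h1 : h <= eps / 2 by rewrite ge_min lexx.
have h2 : h <= 2^-1 by rewrite ge_min lexx orbT.
have := he h; rewrite gt_eqF // gtr0_norm // => /(_ isT); rewrite fz; last first.
  by apply/andP; split; lra.
have he2 : h < eps by lra.
by rewrite mulr0 => /(_ he2); rewrite ltxx.
Qed.

Lemma shooting_simple t : 0 < t -> shooting t = 0 ->
  p1 t * f2 (1 + t) + f1 t * p2 (1 + t) - (p2 t * f1 (1 + t) + f2 t * p1 (1 + t)) != 0.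
Proof.
move=> t0 Dt; have t1 : 0 < 1 + t by lra.
have w0 := W t0; have w1 := W t1; move: Dt; rewrite /shooting.
have us := solves_comb (f2 t) (- f1 t) s1 s2.
have := energy_decreases us t0; rewrite /= => E.
have E1 : f2 t * f1 t + - f1 t * f2 t = 0 by ring.
move=> Dt; have E2 : f2 t * f1 (1 + t) + - f1 t * f2 (1 + t) = 0 by move: Dt; lra.
have E3 : f2 t * p1 t + - f1 t * p2 t = 1 by move: w0; lra.
have {E} := E E1 E2; rewrite E3 expr1n => /(_ ltr01).
move: (f1 t) (p1 t) (f2 t) (p2 t) (f1 (1 + t)) (p1 (1 + t)) (f2 (1 + t)) (p2 (1 + t)) w0 w1 Dt {E1 E2 E3}.
move=> a1 c1 a2 c2 b1 e1 b2 e2 w0 w1 Dt P2; apply/eqP => D'.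
(* Here a2 e1 - a1 e2 is u'(1 + t), and D' = 0 makes c1 b2 - c2 b1 equal to it. The product of the
   two is the product of the Wronskians at t and 1 + t up to a multiple of D(t) = 0, hence 1. *)
have e : (a2 * e1 + - a1 * e2) ^+ 2 = 1.
  have -> : (a2 * e1 + - a1 * e2) ^+ 2 = (a2 * e1 + - a1 * e2) *
     ((c1 * b2 - c2 * b1) - (c1 * b2 + a1 * e2 - (c2 * b1 + a2 * e1))) by ring.
  rewrite D' subr0.
  have -> : (a2 * e1 + - a1 * e2) * (c1 * b2 - c2 * b1) =
    (a1 * c2 - c1 * a2) * (b1 * e2 - e1 * b2) - (a1 * b2 - a2 * b1) * (c1 * e2 - c2 * e1) by ring.
  by rewrite w0 w1 Dt; ring.
by rewrite e ltxx in P2.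
Qed.

Lemma shooting_isolated t : 0 < t -> shooting t = 0 ->
  exists2 e : R, 0 < e & forall t', t' != t -> `|t' - t| < e -> shooting t' != 0.
Proof.
move=> t0 Dt; have d := shooting_der t0; have n := shooting_simple t0 Dt.
move: d n; set D' := _ - _ => d n.
have main g d' : der g t d' -> g t = 0 -> 0 < d' ->
    exists2 e : R, 0 < e & forall t', t' != t -> `|t' - t| < e -> g t' != 0.
  move=> gd gt d0; have [e e0 he] := der_sign gd gt d0; exists e => // t' tt te.
  have := he (t' - t); rewrite subr_eq0 [t + _]addrC subrK => /(_ tt te).
  by apply: contraTneq => ->; rewrite mulr0 ltxx.
have [Dp|Dn|/eqP] := ltgtP 0 D'; last by rewrite eq_sym (negbTE n).
  exact: main d Dt Dp.
have [|| e e0 he] := main _ _ (derN d); [by rewrite Dt oppr0|by rewrite oppr_gt0|].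
by exists e => // t' tt te; rewrite -oppr_eq0; exact: he.
Qed.

(** Below a zero of positive slope [zero_below] gives another zero. If its slope is positive too, f
    is positive just after it and negative just before the first one, so [down_crossing] gives a
    zero of negative slope in between. From a zero of negative slope the same is done with - f. *)
Let crossing f p (d : R) : solves f p -> 0 < d ->
  (forall x, 0 < x -> f x = 0 -> p x != 0) ->
  exists z z', [/\ 0 < z < d, 0 < z' < d, f z = 0 /\ f z' = 0 & 0 < p z /\ p z' < 0].
Proof.
move=> fs d0 simple.
have wl g r : solves g r -> (forall x, 0 < x -> g x = 0 -> r x != 0) ->
    forall x, 0 < x < d -> g x = 0 -> 0 < r x ->
    exists z', [/\ 0 < z' < d, g z' = 0 & r z' < 0].
  move=> gs sg x xd gx rx; have /andP[x0 xd'] := xd.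
  have [y [/andP[y0 yx] gy]] := zero_below gs x0.
  have [ry|ry] := ltP (r y) 0; first by exists y; split => //; apply/andP; split; lra.
  have {}ry : 0 < r y by rewrite lt_neqAle eq_sym sg.
  have [e1 e10 h1] := der_sign (gs y y0).1 gy ry.
  have [e2 e20 h2] := der_sign (gs x x0).1 gx rx.
  pose h := Num.min (Num.min (e1 / 2) (e2 / 2)) ((x - y) / 3).
  have hp : 0 < h by rewrite !lt_min; apply/andP; split; [apply/andP; split|]; lra.
  have ha : h <= e1 / 2 by rewrite !ge_min lexx.
  have hb : h <= e2 / 2 by rewrite !ge_min lexx orbT.
  have hc : h <= (x - y) / 3 by rewrite ge_min lexx orbT.
  have ga : 0 < g (y + h).
    have := h1 h; rewrite gt_eqF // gtr0_norm // => /(_ isT) hh.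
    by rewrite -(pmulr_rgt0 _ (_ : 0 < h^-1)) ?invr_gt0 //; apply: hh; lra.
  have gb : g (x - h) < 0.
    have := h2 (- h); rewrite oppr_eq0 gt_eqF // normrN gtr0_norm // => /(_ isT) hh.
    have : 0 < (- h)^-1 * g (x - h) by apply: hh; lra.
    by rewrite nmulr_rgt0 // invr_lt0 oppr_lt0.
  have [||z [yz zx gz rz]] := @down_crossing g r (y + h) (x - h) _ _ ga gb; [lra| |].
    by move=> w /andP[w1 w2]; apply: (gs w _).1; lra.
  have z0 : 0 < z by lra.
  exists z; split => //; first by apply/andP; split; lra.
  by rewrite lt_neqAle rz andbT; exact: sg.
have [x [xd fx]] := zero_below fs d0; have /andP[x0 _] := xd.
have [px|px|/eqP] := ltgtP (p x) 0; last by rewrite (negbTE (simple x x0 fx)).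
  have osimple y : 0 < y -> - f y = 0 -> - p y != 0.
    by move=> y0 /eqP; rewrite !oppr_eq0 => /eqP; exact: simple.
  have [||z [zd fz pz]] := wl _ _ (solves_opp fs) osimple x xd.
  - by rewrite fx oppr0.
  - by rewrite oppr_gt0.
  exists z, x; split => //; split => //; last by rewrite oppr_lt0 in pz.
  by apply/eqP; rewrite -oppr_eq0 fz.
have [z [zd fz pz]] := wl _ _ fs simple x xd fx px.
by exists x, z; split.
Qed.

(** At a zero of f1 the Wronskian gives p1 f2 = 1, so D p1 = - f1(1 + t), which is negative for
    small t because f1 crosses 0 upwards at 1. Zeros of f1 with opposite slopes thus give opposite
    signs of D. *)
Lemma shooting_zero_below (d : R) : 0 < d -> exists t, 0 < t < d /\ shooting t = 0.
Proof.
move=> d0.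
have simple x : 0 < x -> f1 x = 0 -> p1 x != 0.
  move=> x0 fx; apply/eqP => px; have := W x0; rewrite fx px !mul0r subr0 => /eqP.
  by rewrite eq_sym oppr_eq0 oner_eq0.
have one0 : (0 : R) < 1 by [].
have p1gt : 0 < p1 1 by rewrite p11.
have [eta eta0 he] := der_sign (s1 one0).1 f11 p1gt.
have pos t : 0 < t < eta -> 0 < f1 (1 + t).
  move=> /andP[t0 te]; have := he t; rewrite gt_eqF // gtr0_norm // => /(_ isT te).
  by rewrite pmulr_rgt0 // invr_gt0.
have dm : 0 < Num.min d eta by rewrite lt_min d0.
have [z [z' [/andP[z0 zd] /andP[z0' zd'] [fz fz'] [pz pz']]]] := crossing s1 dm simple.
have D1 t : 0 < t -> t < Num.min d eta -> f1 t = 0 ->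
    exists2 k : R, 0 < k & shooting t * p1 t = - k.
  move=> t0; rewrite lt_min => /andP[_ te] ft; exists (f1 (1 + t)); first by apply: pos; rewrite t0.
  have := W t0; rewrite /shooting ft !mul0r !sub0r => w.
  have -> : - (f2 t * f1 (1 + t)) * p1 t = - (p1 t * f2 t) * f1 (1 + t) by ring.
  by rewrite w mulN1r.
have [k k0 kE] := D1 z z0 zd fz; have [k' k0' kE'] := D1 z' z0' zd' fz'.
have Dz : shooting z < 0 by rewrite -(pmulr_llt0 _ pz) kE oppr_lt0.
have Dz' : 0 < shooting z' by rewrite -(nmulr_llt0 _ pz') kE' oppr_lt0.
have cD a b : 0 < a -> cont_on a b shooting.
  by move=> a0; apply: cont_on_der => t /andP[at_ _]; apply: shooting_der; lra.
have dd : Num.min d eta <= d by rewrite ge_min lexx.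
have [zz|zz] := leP z z'.
  have [|t] := @IVT R shooting z z' 0 zz (cD _ _ z0).
    by rewrite ge_min le_max (ltW Dz) (ltW Dz') orbT.
  by rewrite in_itv/= => /andP[t1 t2] Dt; exists t; split => //; apply/andP; split; lra.
have [|t] := @IVT R shooting z' z 0 (ltW zz) (cD _ _ z0').
  by rewrite ge_min le_max (ltW Dz) (ltW Dz') orbT.
by rewrite in_itv/= => /andP[t1 t2] Dt; exists t; split => //; apply/andP; split; lra.
Qed.

End shooting.
End oscillation.

(** * The dispersion relation and the discrete spectrum *)

Section discrete_spectrum.
Context {R : realType}.
Local Notation C := R[i].
Implicit Types (x y s t : R).

Variables (beta : R) (m : nat).
Hypotheses (beta_gt0 : 0 < beta) (m_ge1 : (1 <= m)%N).
Local Notation L := (Lop beta m).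
Local Notation q := (taylor_goldstein beta m).

(* [p] is the derivative of [u], and [p 0 != 0] expresses that [u] is not zero. *)
Definition neutral_mode s := exists u p : R -> R,
  [/\ forall y, 0 <= y <= 1 -> der u y (p y) /\ der p y (real_potential beta m s y * u y),
      u 0 = 0, u 1 = 0 & p 0 != 0].

(** The potential is real, so the real part of the complex solution with slope 1 at 0 is already a
    real mode. *)
Lemma eigenvalue_neutral_mode s : (forall y, 0 <= y <= 1 -> y%:C - s%:C != 0 :> C) ->
  eigenvalues L s%:C <-> neutral_mode s.
Proof.
move=> ys; have qE : q s%:C = fun y => (real_potential beta m s y)%:C.
  by apply/funext => y; rewrite taylor_goldstein_real.
have [U [P [V [S F]]]] := fundamental_exists (q_cont_at beta m ys).
have x0 : 0 <= (0 : R) <= 1 by rewrite lexx ler01.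
have x1 : 0 <= (1 : R) <= 1 by rewrite lexx ler01.
split=> [se|[u [p [ud u0 u1 p0]]]].
  have [f [g [fs f0 f1 fn]]] := eigen_csol m_ge1 ys se.
  have E y : 0 <= y <= 1 -> f y = g 0 * U y.
    by move=> y01; rewrite (fundamental_repr F fs y01) f0 mul0r add0r.
  have U1 : U 1 = 0.
    apply/eqP; have : g 0 * U 1 == 0 by rewrite -E ?f1.
    rewrite mulf_eq0 => /orP[/eqP g0|//]; exfalso; apply: fn => y y01.
    by rewrite E ?g0 ?mul0r //; exact: in01.
  case: F => Ud _ [U0 P0] _.
  exists (fun y => Re (U y)), (fun y => Re (P y)); split.
  - move=> y /Ud[[d1 _] [d2 _]]; split => //; apply: der_eq d2 _.
    by rewrite qE cReM /= mul0r subr0.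
  - by rewrite U0.
  - by rewrite U1.
  - by rewrite P0 oner_neq0.
apply: (fundamental_eigenvalue m_ge1 ys F).
pose f y : C := (u y)%:C; pose g y : C := (p y)%:C.
have fd y : 0 <= y <= 1 -> cder f y (g y) by move=> /ud[d _]; exact: cder_real.
have gd y : 0 <= y <= 1 -> cder g y (q s%:C y * f y).
  move=> /ud[_ d]; apply: cder_eq; first exact: cder_real d.
  by rewrite qE /f; apply: complexP; rewrite ?cReM ?cImM /=; ring.
have fs : csol 0 1 (q s%:C) f g.
  split; [exact: ccont_on_cder fd|exact: ccont_on_cder gd| |] => y /in01; [exact: fd|exact: gd].
have := fundamental_repr F fs x1; rewrite /f u0 u1 mul0r add0r => /esym/eqP.
rewrite mulf_eq0 => /orP[|/eqP //]; rewrite /g => /eqP[] /eqP; by rewrite (negbTE p0).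
Qed.

Section oscillating.
Variables (f1 p1 f2 p2 : R -> R).
Hypotheses (s1 : solves beta m f1 p1) (s2 : solves beta m f2 p2).
Hypotheses (f11 : f1 1 = 0) (p11 : p1 1 = 1) (f21 : f2 1 = 1) (p21 : p2 1 = 0).

(** x0 + sg y is the distance from y to s: x0 = t, sg = 1 for s = - t, and x0 = 1 + t, sg = -1 for s
    = 1 + t. Both sides of the segment thus use the same solutions on x > 0. *)
Lemma neutral_mode_shooting s x0 sg : sg ^+ 2 = 1 ->
  (forall y, 0 <= y <= 1 -> 0 < x0 + sg * y) ->
  (forall y, (y - s) ^+ 2 = (x0 + sg * y) ^+ 2) ->
  neutral_mode s <-> f1 x0 * f2 (x0 + sg) - f2 x0 * f1 (x0 + sg) = 0.
Proof.
move=> sg2 xpos xs.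
have y0 : 0 <= (0 : R) <= 1 by rewrite lexx ler01.
have y1 : 0 <= (1 : R) <= 1 by rewrite lexx ler01.
pose X y := x0 + sg * y.
have X0 : X 0 = x0 by rewrite /X mulr0 addr0.
have X1 : X 1 = x0 + sg by rewrite /X mulr1.
have sd f p : solves beta m f p -> forall y, 0 <= y <= 1 ->
    der (fun y => f (X y)) y (sg * p (X y)) /\
    der (fun y => sg * p (X y)) y (real_potential beta m s y * f (X y)).
  move=> fs y y01; have Xd : der X y sg.
    apply: der_eq; first exact: derD (der_cst x0 y) (derM (der_cst sg y) (der_id y)).
    by rewrite /=; ring.
  have [d1 d2] := fs _ (xpos y y01); split.
    by apply: der_eq; [exact: (@der_comp _ f X y _ _ d1 Xd)|rewrite mulrC].
  apply: der_eq; first exact: derM (der_cst sg y) (@der_comp _ p X y _ _ d2 Xd).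
  have -> : real_potential beta m s y = potential beta m (X y).
    by rewrite /real_potential /potential xs.
  rewrite /= mul0r add0r /X -[RHS]mul1r -sg2; ring.
have {}sd1 := sd _ _ s1; have {}sd2 := sd _ _ s2.
split=> [[u [p [ud u0 u1 p0]]]|e].
  have W g r : (forall y, 0 <= y <= 1 -> der g y (r y) /\
      der r y (real_potential beta m s y * g y)) -> p 1 * g 1 = p 0 * g 0.
    move=> gd; have Wd y : 0 <= y <= 1 -> der (fun y => u y * r y - p y * g y) y 0.
      move=> y01; have [d1 d2] := ud y y01; have [d3 d4] := gd y y01.
      by apply: der_eq; [exact: derB (derM d1 d4) (derM d2 d3)|ring].
    have := @der0_cst _ 0 1 (fun y => u y * r y - p y * g y)
      (fun y y01 => Wd y (in01 y01)) (cont_on_der Wd) 1 y1.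
    by rewrite u0 u1 !mul0r !sub0r => /oppr_inj.
  have e1 := W _ _ sd1; have e2 := W _ _ sd2; rewrite /= X0 X1 in e1 e2.
  apply: (mulfI p0); rewrite mulr0 mulrBr !mulrA -e1 -e2; ring.
exists (fun y => f2 x0 * f1 (X y) + - f1 x0 * f2 (X y)),
  (fun y => f2 x0 * (sg * p1 (X y)) + - f1 x0 * (sg * p2 (X y))); split.
- move=> y y01; have [d1 d2] := sd1 y y01; have [d3 d4] := sd2 y y01; split.
    apply: der_eq; first exact: derD (derM (der_cst _ y) d1) (derM (der_cst _ y) d3).
    by rewrite /=; ring.
  apply: der_eq; first exact: derD (derM (der_cst _ y) d2) (derM (der_cst _ y) d4).
  by rewrite /=; ring.
- by rewrite X0; ring.
- by rewrite X1; move: e; lra.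
- have x0p : 0 < x0 by rewrite -X0; exact: xpos.
  have w : f1 x0 * p2 x0 - p1 x0 * f2 x0 = - 1.
    by apply: (wronskian_solves s1 s2) => //; rewrite f11 p11 f21 p21; ring.
  rewrite X0 (_ : _ + _ = - (sg * (f1 x0 * p2 x0 - p1 x0 * f2 x0))); last by ring.
  by rewrite w mulrN1 opprK; apply: contra_eqN sg2 => /eqP ->; rewrite expr0n eq_sym oner_eq0.
Qed.

End oscillating.

Lemma off_segment_left t : 0 < t -> forall y, 0 <= y <= 1 -> y%:C - (- t)%:C != 0 :> C.
Proof.
move=> t0 y /andP[y0 _]; rewrite subr_eq0; apply/eqP => -[e]; move: t0 y0; rewrite e; lra.
Qed.

Lemma off_segment_right t : 0 < t -> forall y, 0 <= y <= 1 -> y%:C - (1 + t)%:C != 0 :> C.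
Proof.
move=> t0 y /andP[_ y1]; rewrite subr_eq0; apply/eqP => -[e]; move: t0 y1; rewrite e; lra.
Qed.

(** One D serves both sides of the segment because of the symmetry y -> 1 - y, which appears here as
    a mere change of sign of the determinant. *)
Lemma dispersion_function : 1 / 4 < beta ^+ 2 -> exists D : R -> R,
  [/\ forall t, 0 < t -> (eigenvalues L (- t)%:C <-> D t = 0) /\
                         (eigenvalues L (1 + t)%:C <-> D t = 0),
      forall t, 0 < t -> D t = 0 -> exists2 e : R, 0 < e &
        forall t', t' != t -> `|t' - t| < e -> D t' != 0 &
      forall d, 0 < d -> exists t, 0 < t < d /\ D t = 0].
Proof.
move=> b4; have [f1 [p1 [s1 f11 p11]]] := solves_exists beta m 0 1.
have [f2 [p2 [s2 f21 p21]]] := solves_exists beta m 1 0.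
exists (shooting f1 f2); split.
- move=> t t0; split.
    rewrite (eigenvalue_neutral_mode (off_segment_left t0)).
    rewrite (@neutral_mode_shooting f1 p1 f2 p2 _ _ _ _ _ _ (- t) t 1) //; first by rewrite [t + 1]addrC.
    - by rewrite expr1n.
    - by move=> y /andP[y0 _]; lra.
    - by move=> y; ring.
  rewrite (eigenvalue_neutral_mode (off_segment_right t0)).
  rewrite (@neutral_mode_shooting f1 p1 f2 p2 _ _ _ _ _ _ (1 + t) (1 + t) (- 1)) //.
  - rewrite /shooting (_ : 1 + t - 1 = t); last by ring.
    by split=> h; move: h; lra.
  - by rewrite sqrrN expr1n.
  - by move=> y /andP[_ y1]; lra.
  - by move=> y; ring.
- by move=> t; apply: (shooting_isolated beta_gt0 s1 s2).
- by move=> d; apply: (shooting_zero_below m_ge1 b4 s1 s2).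
Qed.

Lemma segment_Re (c : C) : Im c = 0 -> ~ segment01 c ->
  Re c < 0 \/ 1 < Re c.
Proof.
move=> ic cS; have [c0|c0] := ltP (Re c) 0; first by left.
by have [c1|c1] := ltP 1 (Re c); [right|exfalso; apply: cS; rewrite /segment01 /= c0].
Qed.

(** Off the segment the spectrum consists of real eigenvalues, which are zeros of D and hence
    isolated. *)
Lemma spectrum_separated (c : C) : 1 / 4 < beta ^+ 2 -> eigenvalues L c -> ~ segment01 c ->
  exists2 e : R, 0 < e & forall c' : C, spectrum L c' -> c' != c ->
    ~ (`|Re c' - Re c| < e).
Proof.
move=> b4 ce cS; have ic := eigenvalue_real beta_gt0 m_ge1 ce.
have [D [DE Diso _]] := dispersion_function b4.
have off (c' : C) : spectrum L c' -> Re c' < 0 \/ 1 < Re c' ->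
    eigenvalues L c' /\ Im c' = 0.
  move=> sc h; have se : eigenvalues L c'.
    apply: (spectrum_eigenvalue m_ge1) => // y /andP[y0 y1].
    rewrite subr_eq0; apply/eqP => e; rewrite -e /= in h; case: h; lra.
  by split => //; exact: (eigenvalue_real beta_gt0 m_ge1 se).
have main (g h : R -> R) : (forall t, h (g t) = t) ->
    (forall t, 0 < t -> eigenvalues L (h t)%:C <-> D t = 0) ->
    (forall x y, `|g x - g y| = `|x - y|) -> 0 < g (Re c) ->
    (forall c', spectrum L c' -> 0 < g (Re c') -> eigenvalues L c' /\ Im c' = 0) ->
    exists2 e : R, 0 < e & forall c', spectrum L c' -> c' != c ->
      ~ (`|Re c' - Re c| < e).
  move=> hg DE' gn t0 offg; have Dt : D (g (Re c)) = 0.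
    by apply/(DE' _ t0); rewrite hg -real_complexE.
  have [e e0 he] := Diso _ t0 Dt.
  (* g(Re c) is the distance from c to the segment; staying closer than this keeps c' on the same
     side, where it is real and a zero of D. *)
  exists (Num.min e (g (Re c))); first by rewrite lt_min e0.
  move=> c' sc' cc'; rewrite lt_min => /andP[l1 l2].
  have t0' : 0 < g (Re c') by rewrite -gn distrC in l2; have := ltr_normlW l2; lra.
  have [ec' ic'] := offg c' sc' t0'.
  have Dt' : D (g (Re c')) = 0 by apply/(DE' _ t0'); rewrite hg -real_complexE.
  have := he (g (Re c')); rewrite gn Dt' eqxx (can_eq hg) => k.
  suff /k/(_ l1) : Re c' != Re c by [].
  apply: contraNneq cc' => e1.
  by rewrite (real_complexE ic) (real_complexE ic') e1.
case: (segment_Re ic cS) => rc.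
  apply: (main (fun t => - t) (fun t => - t)).
  - exact: opprK.
  - by move=> t /DE[].
  - by move=> x y; rewrite -opprD normrN.
  - by rewrite oppr_gt0.
  - by move=> c' sc; rewrite oppr_gt0 => h; apply: off => //; left.
apply: (main (fun t => t - 1) (fun t => 1 + t)).
- by move=> t; ring.
- by move=> t /DE[].
- by move=> x y; congr Num.norm; ring.
- by rewrite subr_gt0.
- by move=> c' sc; rewrite subr_gt0 => h; apply: off => //; right.
Qed.

Lemma eigenvalue_spectrum (T : state R -> state R) (c : C) : eigenvalues T c -> spectrum T c.
Proof. by move=> [v [vX vn /eigen_shift vT]] [inj _]; apply: vn; exact: inj. Qed.

Lemma nbhs_Re (c : C) (e : R) : 0 < e ->
  nbhs (c : C^o) [set z | `|Re z - Re c| < e].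
Proof.
move=> e0; apply: (nbhs_normP (V := C^o) c _).2; exists e%:C => /=; first by rewrite ltcR.
move=> z /= h; have := le_lt_trans (normc_ge_Re (c - z)) h; rewrite ltcR.
by rewrite distrC cReD cReN.
Qed.

(** The eigenvalues are real, so a neighbourhood in the complex plane is tested along the horizontal
    line through its centre. *)
Lemma nbhs_real_line (c : C) (U : set C) : nbhs (c : C^o) U ->
  exists2 r : R, 0 < r & forall t, `|t| < r -> U (c + t%:C).
Proof.
move=> /(nbhs_normP (V := C^o) c U).1[e /= e0 he]; have [eR eI] : 0 < Re e /\ Im e = 0.
  by move: e0; rewrite ltcE /= => /andP[/eqP <- ->].
exists (Re e) => // t tr; apply: he => /=.
have -> : c - (c + t%:C) = (- t)%:C by apply: complexP => /=; rewrite ?cReD ?cImD ?cReN ?cImN ?cReD ?cImD /=; ring.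
by rewrite normc_def /= expr0n addr0 sqrtr_sqr normrN (real_complexE eI) ltcR.
Qed.

Lemma eigenvalue_discrete (c : C) : 1 / 4 < beta ^+ 2 -> eigenvalues L c -> ~ segment01 c ->
  discrete_eigenvalues L c.
Proof.
move=> b4 ce cS; split => //; have [e e0 he] := spectrum_separated b4 ce cS.
have sc := eigenvalue_spectrum ce.
split; first exact/mem_set.
exists [set z | `|Re z - Re c| < e]; first exact: nbhs_Re.
apply/seteqP; split=> z /=; last by move=> ->; rewrite subrr normr0.
by move=> [zc sz]; apply: contrapT => /eqP zn; exact: (he z sz zn).
Qed.

(** The real parts form a set of reals all of whose points are isolated, which is countable, and Re
    is injective on A. *)
Lemma countable_Re_separated (A : set C) : (forall c, A c -> Im c = 0) ->
  (forall c, A c -> exists2 e : R, 0 < e & forall c', A c' -> c' != c ->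
     ~ (`|Re c' - Re c| < e)) -> countable A.
Proof.
move=> A0 Asep; pose S : set R := @complex.Re R @` A.
have Siso : S `<=` isolated S.
  move=> _ [c Ac <-]; split; first by apply/mem_set; exists c.
  have [e e0 he] := Asep c Ac.
  exists (ball (Re c) e); first exact: nbhsx_ballx.
  apply/seteqP; split=> [z|_ -> /=]; last by split; [exact: ballxx|exists c].
  move=> [/[swap] -[c' Ac' <-]]; rewrite /ball /= distrC => h; apply: contrapT => cc; apply: (he c' Ac' _ h).
  by apply: contra_notN cc => /eqP ->.
have Sc : countable S := sub_countable (subset_card_le Siso) (countable_isolated S).
have /countable_injP[f finj] := Sc.
apply/countable_injP; exists (f \o @complex.Re R) => c c' /set_mem Ac /set_mem Ac' /= e.
have e' : Re c = Re c'.
  by apply: finj e; apply/mem_set; [exists c|exists c'].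
by rewrite (real_complexE (A0 c Ac)) (real_complexE (A0 c' Ac')) e'.
Qed.

(** A finite set is closed, so its complement would be a neighbourhood of c that misses A. *)
Lemma limit_point_infinite (A : set C) (c : C) : limit_point (A : set C^o) c -> ~ A c ->
  infinite_set A.
Proof.
move=> lim Ac fA; have clA : closed (A : set C^o).
  exact: (accessible_finite_set_closed.1 (hausdorff_accessible (@norm_hausdorff _ (C^o : normedModType C)))).
have [|y [_ Ay ny]] := lim (~` A); last exact: ny.
by apply: open_nbhs_nbhs; split => //; exact: closed_openC.
Qed.

End discrete_spectrum.

(** * Accumulation of eigenvalues at 0 and 1 *)

Section limit_points.
Context {R : realType} (beta : R) (m : nat).
Hypotheses (beta_gt0 : 0 < beta) (m_ge1 : (1 <= m)%N) (beta_gt : 1 / 4 < beta ^+ 2).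
Local Notation C := R[i].
Local Notation L := (Lop beta m).

Definition neutral_eigenvalues : set C := [set c | [/\ discrete_eigenvalues L c,
  Im c = 0 & - (beta / m%:R) < Re c < 0 \/
                     1 < Re c < 1 + beta / m%:R]].

Lemma neutral_eigenvalues_countable : countable neutral_eigenvalues.
Proof.
apply: countable_Re_separated => c [[ce _ cS] ic _] //.
have [e e0 he] := spectrum_separated beta_gt0 m_ge1 beta_gt ce cS.
by exists e => // c' [[ce' _ _] _ _]; apply: he; exact: eigenvalue_spectrum.
Qed.

Lemma neutral_eigenvalues_limit_point :
  limit_point (neutral_eigenvalues : set C^o) 0 /\
  limit_point (neutral_eigenvalues : set C^o) 1.
Proof.
have bm : 0 < beta / m%:R by rewrite divr_gt0 // ltr0n.
have [D [DE _ Dz]] := dispersion_function beta_gt0 m_ge1 beta_gt.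
(* The bound r puts the eigenvalue into the neighbourhood, and beta / m keeps it in the required
   interval. *)
split=> U /nbhs_real_line[r r0 hr]; have [|t [/andP[t0 td] Dt]] := Dz (Num.min r (beta / m%:R)).
- by rewrite lt_min r0.
- move: td; rewrite lt_min => /andP[tr tb].
  exists (- t)%:C; split.
  + by apply/eqP => -[] /eqP; rewrite oppr_eq0 gt_eqF.
  + split=> //=; last by left; apply/andP; split; lra.
    apply: eigenvalue_discrete => //; first exact/(DE t t0).1.
    by rewrite /segment01 /= => -[_ /andP[]]; lra.
  + by rewrite -[X in U X]add0r; apply: hr; rewrite normrN gtr0_norm.
- by rewrite lt_min r0.
move: td; rewrite lt_min => /andP[tr tb].
exists (1 + t)%:C; split.
- by apply/eqP => -[] /eqP; rewrite -subr_eq0 addrC addKr gt_eqF.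
- split=> //=; last by right; apply/andP; split; lra.
  apply: eigenvalue_discrete => //; first exact/(DE t t0).2.
  by rewrite /segment01 /= => -[_ /andP[]]; lra.
- rewrite (_ : (1 + t)%:C = 1 + t%:C); first by apply: hr; rewrite gtr0_norm.
  by rewrite rmorphD rmorph1.
Qed.

Lemma neutral_eigenvalues_infinite : infinite_set neutral_eigenvalues.
Proof.
apply: limit_point_infinite (neutral_eigenvalues_limit_point).1 _.
by move=> [_ _ /=]; rewrite ltxx andbF => -[//|/andP[]]; lra.
Qed.

End limit_points.

Lemma Lop_essential_spectrum (R : realType) (beta : R) (m : nat) : 0 < beta -> (1 <= m)%N ->
  essential_spectrum (Lop beta m) = segment01.
Proof.
move=> b0 m1; apply/seteqP; split=> c.
  move=> nf; apply: contrapT => cS; apply: nf; apply: fredholm_outside => //.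
  exact: notin_segment.
by move=> [ic c01]; rewrite (real_complexE ic); exact: not_fredholm_on_segment.
Qed.

Lemma no_eigenvalue (R : realType) (beta : R) (m : nat) : 0 < beta -> (1 <= m)%N ->
  beta ^+ 2 <= 1 / 4 -> forall c, ~ eigenvalues (Lop beta m) c.
Proof.
move=> b0 m1 b4 c ce; have := ce; rewrite (real_complexE (eigenvalue_real b0 m1 ce)).
exact: no_real_eigenvalue.
Qed.

Theorem theorem3 (R : realType) (beta : R) (m : nat)
    (beta_gt0 : 0 < beta) (m_ge1 : (1 <= m)%N) :
  let L := Lop beta m in
  [/\ essential_spectrum L = segment01,
      (forall c : R[i], eigenvalues L c ->
         1 / 2 <= `|complex.Re c - 1 / 2| -> complex.Im c = 0),
      (1 / 4 < beta ^+ 2 ->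
         [/\ ~ (exists c : R[i], [/\ eigenvalues L c, complex.Im c != 0 &
                  0 < complex.Re c < 1]),
             ~ (exists c : R[i], [/\ eigenvalues L c, complex.Im c = 0 &
                  complex.Re c < - (beta / m%:R) \/
                  1 + beta / m%:R < complex.Re c]) &
             let D := [set c : R[i] |
                  [/\ discrete_eigenvalues L c, complex.Im c = 0 &
                      - (beta / m%:R) < complex.Re c < 0 \/
                      1 < complex.Re c < 1 + beta / m%:R]] in
             [/\ countable D, infinite_set D,
                 limit_point (D : set R[i]^o) 0 & limit_point (D : set R[i]^o) 1]]) &
      (beta ^+ 2 <= 1 / 4 ->
         ~ (exists c : R[i], eigenvalues L c /\
              (complex.Re c <= 0 \/ 1 <= complex.Re c)) /\
         (exists eps0 : R, 0 < eps0 /\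
            ~ (exists c : R[i], eigenvalues L c /\
                 (beta / m%:R <= `|complex.Im c| \/
                  `|complex.Im c| <= eps0))))].
Proof.
split=> [|c ce _|b4|b4].
- exact: Lop_essential_spectrum.
- exact: eigenvalue_real ce.
- split; last split.
  + by move=> [c [ce ic _]]; rewrite (eigenvalue_real beta_gt0 m_ge1 ce) eqxx in ic.
  + move=> [c [ce ic far]]; rewrite (real_complexE ic) in ce.
    exact: no_far_eigenvalue far ce.
  + exact: neutral_eigenvalues_countable.
  + exact: neutral_eigenvalues_infinite.
  + by have [] := neutral_eigenvalues_limit_point beta_gt0 m_ge1 b4.
  + by have [] := neutral_eigenvalues_limit_point beta_gt0 m_ge1 b4.
split; first by move=> [c [ce _]]; exact: no_eigenvalue ce.
(* There is no eigenvalue at all in this case, so any positive number serves. *)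
by exists 1; split => // -[c [ce _]]; exact: no_eigenvalue ce.
Qed.
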